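(* Let $F$ be a homogeneous symmetric function of degree $n$ with rational coefficients. If $F$ is positively $h$-alternating, then $(\nabla F)|_{q=1}$ is $e$-positive (and hence Schur positive), i.e. its coefficients in the elementary basis (and in the Schur basis) are polynomials in $t$ with nonnegative coefficients. In particular, if $\omega(F)$ is $p$-positive, then $(\nabla F)|_{q=1}$ is $e$-positive.
   Context: $F$ is positively $h$-alternating if, writing $F=\sum_{\lambda\vdash n}c_\lambda(-1)^{n-\ell(\lambda)}h_\lambda$, all $c_\lambda\ge0$ ($\ell(\lambda)$ = number of parts). $\nabla$ is the linear operator on symmetric functions over $\mathbb Q(q,t)$ with $\nabla\tilde H_\mu=t^{n(\mu)}q^{n(\mu')}\tilde H_\mu$ on the modified Macdonald polynomials, $n(\mu)=\sum_i(i-1)\mu_i$; $|_{q=1}$ means setting $q=1$. $\omega$ is the involution with $\omega(p_k)=(-1)^{k-1}p_k$; $p$-positive means nonnegative coefficients in the power sum basis. *)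

(* Defs.v *)
From HB Require Import structures.
From mathcomp Require Import all_boot all_order all_algebra.
From mathcomp Require Import mpoly.

Set Implicit Arguments.
Unset Strict Implicit.
Unset Printing Implicit Defensive.

Import Order.TTheory GRing.Theory Num.Theory.
Local Open Scope ring_scope.

(** * Integer partitions *)

(* A partition of n is stored as a weakly decreasing n-tuple of sum n, padded
   with zeros; [parts] is the list of its positive parts. *)
Definition is_intpart n (t : n.-tuple 'I_n.+1) : bool :=
  sorted geq (map val t) && (sumn (map val t) == n).

Record intpart n := IntPart {
  intpart_tuple :> n.-tuple 'I_n.+1;
  intpartP : is_intpart intpart_tuple
}.

HB.instance Definition _ n := [isSub for @intpart_tuple n].
HB.instance Definition _ n := [Countable of intpart n by <:].
HB.instance Definition _ n := [Finite of intpart n by <:].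

Definition parts n (la : intpart n) : seq nat :=
  [seq k <- map val (intpart_tuple la) | (0 < k)%N].

Definition conj_parts (s : seq nat) : seq nat :=
  mkseq (fun j => count (fun k => (j < k)%N) s) (head 0%N s).

(* n(mu) = \sum_(i >= 1) (i - 1) mu_i; here the parts are numbered from 0. *)
Definition nstat (s : seq nat) : nat := (\sum_(i < size s) i * nth 0 s i)%N.

(* r <= s in dominance order; only used for partitions of the same integer. *)
Definition dominated (r s : seq nat) : Prop :=
  forall k : nat, (sumn (take k r) <= sumn (take k s))%N.

(** * The ring of symmetric functions *)

(* As an inverse limit: a symmetric function over R is a family of symmetric
   polynomials F N in N variables, of bounded degree, such that setting the
   last variable of F N.+1 to 0 gives F N. *)
Definition symfamily (R : nzRingType) := forall N : nat, {mpoly R[N]}.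

Definition kill_last (R : comNzRingType) N (p : {mpoly R[N.+1]}) :
    {mpoly R[N]} :=
  p \mPo [tuple oapp (fun j : 'I_N => 'X_j) 0 (unlift ord_max i) | i < N.+1].

Definition is_symfun (R : comNzRingType) (F : symfamily R) : Prop :=
  [/\ forall N, F N \is symmetric,
      forall N, kill_last (F N.+1) = F N
    & exists d : nat, forall N, (msize (F N) <= d)%N].

Definition homogeneous (R : nzRingType) (n : nat) (F : symfamily R) : Prop :=
  forall N, F N \is n.-homog.

Definition lincomb (R : nzRingType) n (c : intpart n -> R)
    (B : intpart n -> symfamily R) : symfamily R :=
  fun N => \sum_(la : intpart n) c la *: B la N.

Section Bases.
Variable R : comNzRingType.

Definition elem_sym (k : nat) : symfamily R := fun N => mesym N R k.

Definition complete_sym (k : nat) : symfamily R :=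
  fun N => \sum_(m : 'X_{1..N < k.+1} | mdeg m == k) 'X_[m].

Definition power_sum (k : nat) : symfamily R :=
  fun N => \sum_(i < N) 'X_i ^+ k.

Definition ebasis n (la : intpart n) : symfamily R :=
  fun N => \prod_(k <- parts la) elem_sym k N.

Definition hbasis n (la : intpart n) : symfamily R :=
  fun N => \prod_(k <- parts la) complete_sym k N.

Definition pbasis n (la : intpart n) : symfamily R :=
  fun N => \prod_(k <- parts la) power_sum k N.

(* Cells (i, j) of the Young diagram (i-th row, j-th column, from 0); a
   partition of n has at most n rows and n columns. *)
Definition cell n (la : intpart n) :=
  {x : 'I_n * 'I_n | (x.2 < nth 0%N (parts la) x.1)%N}.

Definition semistandard n (la : intpart n) N
    (T : {ffun cell la -> 'I_N}) : bool :=
  [forall x : cell la, forall y : cell la,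
     (((val x).1 == (val y).1) && ((val x).2 < (val y).2)%N
        ==> (T x <= T y)%N)
  && (((val x).2 == (val y).2) && ((val x).1 < (val y).1)%N
        ==> (T x < T y)%N)].

Definition schur n (la : intpart n) : symfamily R :=
  fun N => \sum_(T : {ffun cell la -> 'I_N} | semistandard T)
              \prod_(x : cell la) 'X_(T x).

(* G is the image of F, homogeneous of degree n, under the R-algebra
   endomorphism p_k |-> a_k p_k of symmetric functions. Meaningful when R is a
   Q-algebra, the p_la being then a basis. *)
Definition scale_power_sums (n : nat) (a : nat -> R)
    (F G : symfamily R) : Prop :=
  exists c : intpart n -> R,
    (forall N, F N = lincomb c (@pbasis n) N) /\
    (forall N, G N =
       lincomb (fun la => c la * \prod_(k <- parts la) a k) (@pbasis n) N).

Definition omega_rel (n : nat) : symfamily R -> symfamily R -> Prop :=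
  scale_power_sums n (fun k => (-1) ^+ k.-1).

(* G = F[X(1 - u)], for an indeterminate u of the coefficient field. *)
Definition pleth_1minus (n : nat) (u : R) :
    symfamily R -> symfamily R -> Prop :=
  scale_power_sums n (fun k => 1 - u ^+ k).

Definition in_schur_span n (P : intpart n -> Prop) (F : symfamily R) : Prop :=
  exists c : intpart n -> R,
    (forall la, c la != 0 -> P la) /\
    (forall N, F N = lincomb c (@schur n) N).

End Bases.

(** * Coefficients *)

(* {poly {poly rat}} is Q[t][q], with outer variable q. *)
Notation Qt := {fraction {poly rat}}.
Notation Qqt := {fraction {poly {poly rat}}}.

Definition qvar : Qqt := FracField.tofrac ('X : {poly {poly rat}}).
Definition tvar : Qqt := FracField.tofrac (('X : {poly rat})%:P).

Definition rat_to_Qqt (a : rat) : Qqt :=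
  FracField.tofrac ((a%:P : {poly rat})%:P).

Definition extend_scalars (F : symfamily rat) : symfamily Qqt :=
  fun N => map_mpoly rat_to_Qqt (F N).

(* c has no pole at q = 1, and its value there is v. *)
Definition coef_at_q1 (c : Qqt) (v : Qt) : Prop :=
  exists a b : {poly {poly rat}},
    [/\ b.[1] != 0,
        c = FracField.tofrac a / FracField.tofrac b
      & v = FracField.tofrac a.[1] / FracField.tofrac b.[1]].

Definition specializes_at_q1 (F : symfamily Qqt) (G : symfamily Qt) : Prop :=
  forall N (m : 'X_{1..N}), coef_at_q1 (F N)@_m (G N)@_m.

(** * Modified Macdonald polynomials and nabla *)

(* The defining properties of the family H~_mu: triangularity of
   H~_mu[X(1-q)] and of H~_mu[X(1-t)], normalized by H~_mu[1] = 1, where [1]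
   is evaluation at the single variable x_1 = 1. *)
Definition is_modified_macdonald n (mu : intpart n)
    (H : symfamily Qqt) : Prop :=
  [/\ is_symfun H,
      homogeneous n H,
      exists2 G, pleth_1minus n qvar H G
        & in_schur_span (fun la : intpart n =>
            dominated (parts mu) (parts la)) G,
      exists2 G, pleth_1minus n tvar H G
        & in_schur_span (fun la : intpart n =>
            dominated (conj_parts (parts mu)) (parts la)) G
    & (H 1%N).@[fun _ => 1] = 1].

Definition is_nabla (H : forall n, intpart n -> symfamily Qqt)
    (nabla : symfamily Qqt -> symfamily Qqt) : Prop :=
  (forall (a : Qqt) (F G : symfamily Qqt), is_symfun F -> is_symfun G ->
     forall N, nabla (fun M => a *: F M + G M) N
               = a *: nabla F N + nabla G N) /\
  (forall n (mu : intpart n) N,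
     nabla (H n mu) N =
       (tvar ^+ nstat (parts mu) * qvar ^+ nstat (conj_parts (parts mu)))
         *: H n mu N).

(** * Positivity *)

Definition positively_h_alternating (n : nat) (F : symfamily rat) : Prop :=
  exists c : intpart n -> rat,
    (forall la, 0 <= c la) /\
    (forall N, F N =
       lincomb (fun la => c la * (-1) ^+ (n - size (parts la)))
         (@hbasis rat n) N).

Definition p_positive (n : nat) (F : symfamily rat) : Prop :=
  exists c : intpart n -> rat,
    (forall la, 0 <= c la) /\ (forall N, F N = lincomb c (@pbasis rat n) N).

(* Coefficients in the basis B are polynomials in t with coefficients >= 0. *)
Definition t_positive (n : nat) (B : intpart n -> symfamily Qt)
    (F : symfamily Qt) : Prop :=
  exists c : intpart n -> {poly rat},
    (forall la, c la \is a polyOver Num.nneg) /\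
    (forall N, F N = lincomb (fun la => FracField.tofrac (c la)) B N).

Definition e_positive (n : nat) : symfamily Qt -> Prop :=
  t_positive (@ebasis Qt n).

Definition schur_positive (n : nat) : symfamily Qt -> Prop :=
  t_positive (@schur Qt n).

(* Main.v *)
(* At q = 1 the operator nabla becomes multiplicative. Indeed a Macdonald
   polynomial H_mu, scaled to be regular and nonzero at q = 1, satisfies two
   triangularities there. Its expansion in the g_la = h_la[X/(1-t)] only involves
   la >= mu' (from the condition on X(1-t)). Its expansion in the power sums only
   involves p_nu with nu <= mu': the condition on X(1-q) says, after applying
   omega, that the coefficient of each x^nu, nu not <= mu', vanishes in the sum of
   the +-c_rho \prod_i (1 - q^(rho_i)) p_rho; dividing by (1 - q)^(length nu) and
   setting q = 1 only leaves c_nu, since a monomial of p_rho other than x^rho has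
   fewer variables than rho has parts. As g_la only involves p_rho for rho = la or
   rho with more parts than la, H_mu becomes a multiple of g_mu', and nabla
   multiplies g_nu by t^(\sum_i binomial(nu_i, 2)).

   Let K_k be the image of h_k under this multiplicative map, and
   P(z) = \sum_(k >= 1) (-1)^(k-1) K_k z^k. With B(z) the sum of the
   (-1)^k t^binomial(k, 2) g_k z^k, the relations between h, e and g read
   B(z) = (1 - P(z)) B(tz) and B(tz) = \sum_j e_j t^binomial(j, 2) z^j B(t^j z), so
   P(z) = \sum_(j >= 1) e_j t^binomial(j, 2) z^j / \prod_(0 < i < j) (1 - P(t^i z)),
   which is e-positive by induction on the degree. Newton's identities carry this
   over to (-1)^(k-1) p_k, and e-positivity implies Schur positivity by the Pieri
   rule. *)
Require Import Defs.
From HB Require Import structures.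
From mathcomp Require Import all_boot all_order all_algebra all_fingroup.
From mathcomp Require Import generic_quotient fraction.
From mathcomp Require Import mpoly.
From mathcomp Require Import zify ring.
From Stdlib Require Import FunctionalExtensionality.

Set Implicit Arguments.
Unset Strict Implicit.
Unset Printing Implicit Defensive.

Import Order.TTheory GRing.Theory Num.Theory.
Local Open Scope ring_scope.

(** * Newton identities *)

(** Generating series are replaced by Newton's recursion k a_k = \sum_i x_i a_(k-i), which in
    characteristic 0 determines a from x; each identity between series becomes one between the x_i,
    checked in every number N of variables. A symmetric function of degree n is handled through its
    power sum coefficients, which do not depend on N and are already determined by N = n.

    The triangularities in the definition concern Schur functions, given by tableaux, whereas the
    argument at q = 1 needs the bases h and e. The Jacobi-Trudi identity makes the passage, since it
    only moves up in dominance order.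

    The delicate point at q = 1 is that neither H_mu nor the coefficients of F in the H_mu are known
    in advance to be free of poles. Scaling makes H_mu regular, and the normalization H_mu[1] = 1
    then removes the scaling, because h_k[1/(1-t)] is nonzero. The limits of the H_mu are still
    independent, so Cramer's rule in the local ring of q = 1 makes the coefficients of F regular as
    well. *)

Section Exponential.
Variable A : comNzRingType.
Implicit Types x y a b : nat -> A.

(* [a] is the coefficient sequence of exp (\sum_(i >= 1) x_i z^i / i). *)
Definition isexp x a :=
  a 0%N = 1 /\ forall k, a k *+ k = \sum_(i < k) x i.+1 * a (k - i.+1)%N.

Definition conv a b k := \sum_(i < k.+1) a i * b (k - i)%N.

(** With A(z) = \sum a_k z^k and X(z) = \sum_(i >= 1) x_i z^i, Newton's recursion is z A'(z) = X(z)
    A(z). Truncation beyond degree k leaves the coefficients up to k unchanged. *)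
Lemma isexp_poly x a k j : isexp x a -> (j <= k)%N ->
  ((\poly_(i < k.+1) (if i is 0 then 0 else x i)) * \poly_(i < k.+1) a i)`_j
    = a j *+ j.
Proof.
move=> [_ ea] lejk; rewrite coefM ea big_ord_recl coef_poly /= mul0r add0r.
apply: eq_bigr => i _; rewrite !coef_poly /= /bump leq0n add1n.
have := ltn_ord i => ltij.
have -> : (i.+1 < k.+1)%N by lia.
by have -> : (j - i.+1 < k.+1)%N by lia.
Qed.

(** Leibniz rule for z d/dz: logarithmic derivatives add when series are multiplied. *)
Lemma isexp_conv x y a b :
  isexp x a -> isexp y b -> isexp (fun i => x i + y i) (conv a b).
Proof.
move=> ea eb; split.
  by rewrite /conv big_ord1 ea.1 eb.1 mulr1.
move=> k.
pose px x := \poly_(i < k.+1) (if i is 0 then 0 else x i : A).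
pose pa a := \poly_(i < k.+1) (a i : A).
have -> : conv a b k *+ k = ((px x + px y) * (pa a * pa b))`_k.
  have -> : (px x + px y) * (pa a * pa b)
            = (px x * pa a) * pa b + pa a * (px y * pa b) by ring.
  rewrite coefD !coefM -big_split /= /conv -sumrMnl; apply: eq_bigr => i _.
  have lik : (i <= k)%N by rewrite -ltnS.
  rewrite (isexp_poly ea) // (isexp_poly eb) ?leq_subr // !coef_poly.
  rewrite !ltn_ord !ltnS ?leq_subr.
  by rewrite mulrnAl mulrnAr -mulrnDr subnKC //.
rewrite coefM big_ord_recl coefD !coef_poly /= addr0 mul0r add0r.
apply: eq_bigr => i _; rewrite coefD !coef_poly /bump leq0n add1n ltnS ltn_ord.
congr (_ * _); rewrite coefM /conv; apply: eq_bigr => j _.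
have ltj := ltn_ord j; have lti := ltn_ord i.
rewrite !coef_poly.
have -> : (j < k.+1)%N by lia.
by have -> : (k - i.+1 - j < k.+1)%N by lia.
Qed.

Lemma isexp_scale x a (c : A) :
  isexp x a -> isexp (fun i => c ^+ i * x i) (fun k => c ^+ k * a k).
Proof.
move=> [a0 ea]; split; first by rewrite a0 mulr1.
move=> k; rewrite -mulrnAr ea mulr_sumr; apply: eq_bigr => i _.
rewrite mulrACA -exprD; congr (_ ^+ _ * _); have := ltn_ord i; lia.
Qed.

Lemma isexp_ext x y a b : (forall i, x i.+1 = y i.+1) -> a =1 b ->
  isexp x a -> isexp y b.
Proof.
move=> exy eab [a0 ea]; split=> [|k]; rewrite -eab // ea.
by apply: eq_bigr => i _; rewrite exy eab.
Qed.

(** The series is 1 / (1 - u z), whose logarithm is \sum_(i >= 1) u^i z^i / i. *)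
Lemma isexp_powers (u : A) : isexp (fun i => u ^+ i) (fun k => u ^+ k).
Proof.
split=> // k.
have -> : u ^+ k *+ k = \sum_(i < k) u ^+ k by rewrite sumr_const card_ord.
by apply: eq_bigr => i _; rewrite -exprD subnKC.
Qed.

(** The recursion gives k a_k, hence a_k itself only in the absence of torsion. *)
Lemma isexp_unique x a b : (forall (u : A) k, u *+ k.+1 = 0 -> u = 0) ->
  isexp x a -> isexp x b -> a =1 b.
Proof.
move=> tf [a0 ea] [b0 eb]; elim/ltn_ind=> -[|k] IH; first by rewrite a0 b0.
apply/eqP; rewrite -subr_eq0; apply/eqP/(tf _ k).
rewrite mulrnBl ea eb; apply/eqP; rewrite subr_eq0; apply/eqP.
by apply: eq_bigr => i _; rewrite IH // subSS ltnS leq_subr.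
Qed.

Lemma isexp0 : isexp (fun=> 0) (fun k => (k == 0%N)%:R).
Proof.
split=> // -[|k]; rewrite ?mulr0n ?big_ord0 //= mul0rn big1 // => i _.
by rewrite mul0r.
Qed.

End Exponential.

Lemma sign_scale (L : nzRingType) (A : lalgType L) i (x : A) :
  (-1) ^+ i * x = (-1) ^+ i *: x.
Proof.
by rewrite -[X in X * _]signr_odd -[X in X *: _]signr_odd; case: odd;
  rewrite ?expr0 ?expr1 ?mulN1r ?scaleN1r ?mul1r ?scale1r.
Qed.

(** * Formal polynomials in the power sums, as lists of terms *)

Section Lists.
Variable K : fieldType.
Implicit Types (L : seq (K * seq nat)).

(* The list L stands for the formal sum of the a p_s, for (a, s) in L. *)
Definition lev (A : comAlgType K) L (x : nat -> A) : A :=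
  \sum_(c <- L) c.1 *: \prod_(k <- c.2) x k.

Definition lmul L1 L2 := [seq (c.1 * d.1, c.2 ++ d.2) | c <- L1, d <- L2].

Definition lscale (u : K) L := [seq (u * c.1, c.2) | c <- L].

(* p_k |-> u_k p_k on coefficient lists. *)
Definition ltwist (u : nat -> K) L :=
  [seq (c.1 * \prod_(k <- c.2) u k, c.2) | c <- L].

(** Weighted homogeneity of degree n. Positivity of the entries excludes p_0, so that each index
    list sorts to a partition of n. *)
Definition lwf n L :=
  all (fun c => (sumn c.2 == n) && all (fun k => (0 < k)%N) c.2) L.

Section Eval.
Variable A : comAlgType K.
Implicit Types x : nat -> A.

Lemma lev_cat L1 L2 x : lev (L1 ++ L2) x = lev L1 x + lev L2 x.
Proof. by rewrite /lev big_cat. Qed.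

Lemma lev_nil x : lev [::] x = 0.
Proof. by rewrite /lev big_nil. Qed.

Lemma lev1 u s x : lev [:: (u, s)] x = u *: \prod_(k <- s) x k.
Proof. by rewrite /lev big_seq1. Qed.

Lemma lev_mul L1 L2 x : lev (lmul L1 L2) x = lev L1 x * lev L2 x.
Proof.
rewrite /lev big_allpairs_dep mulr_suml; apply: eq_bigr => c _.
rewrite mulr_sumr; apply: eq_bigr => d _ /=.
by rewrite big_cat /= -scalerAl -scalerAr scalerA.
Qed.

Lemma lev_scale u L x : lev (lscale u L) x = u *: lev L x.
Proof.
by rewrite /lev big_map scaler_sumr; apply: eq_bigr => c _; rewrite /= scalerA.
Qed.

Lemma lev_twist u L x : lev (ltwist u L) x = lev L (fun k => u k *: x k).
Proof.
rewrite /lev big_map; apply: eq_bigr => c _ /=.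
by rewrite scaler_prod scalerA.
Qed.

End Eval.

Lemma lwf_cat n L1 L2 : lwf n (L1 ++ L2) = lwf n L1 && lwf n L2.
Proof. exact: all_cat. Qed.

Lemma lwf_mul n m L1 L2 : lwf n L1 -> lwf m L2 -> lwf (n + m)%N (lmul L1 L2).
Proof.
move=> /allP w1 /allP w2; apply/allP=> _ /allpairsP[[c d] /= [cL dL ->]] /=.
have /andP[/eqP sc pc] := w1 _ cL; have /andP[/eqP sd pd] := w2 _ dL.
by rewrite sumn_cat sc sd eqxx all_cat pc.
Qed.

Lemma lwf_scale n u L : lwf n (lscale u L) = lwf n L.
Proof. by rewrite /lwf all_map; apply: eq_all. Qed.

Lemma ltwist_cat u L1 L2 : ltwist u (L1 ++ L2) = ltwist u L1 ++ ltwist u L2.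
Proof. exact: map_cat. Qed.

Lemma ltwist_mul u L1 L2 : ltwist u (lmul L1 L2) = lmul (ltwist u L1) (ltwist u L2).
Proof.
rewrite /ltwist /lmul map_allpairs allpairs_mapl allpairs_mapr /=.
by apply: eq_allpairs => c d /=; rewrite big_cat /= mulrACA.
Qed.

Lemma ltwist_scale u v L : ltwist u (lscale v L) = lscale v (ltwist u L).
Proof.
by rewrite /ltwist /lscale -!map_comp; apply: eq_map => c /=; rewrite mulrA.
Qed.

End Lists.

(* A table of the lists h_k, h_(k-1), ..., h_0, where k h_k = \sum_i p_i h_(k-i). *)
Fixpoint hl_table k : seq (seq (rat * seq nat)) :=
  if k is k'.+1 then
    flatten [seq [seq (c.1 / k%:R, i.+1 :: c.2) | c <- nth [::] (hl_table k') i]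
               | i <- iota 0 k] :: hl_table k'
  else [:: [:: (1, [::])]].

(* The expansion of h_k in power sums. *)
Definition hl k := head [::] (hl_table k).

Lemma nth_hl_table k i : (i <= k)%N -> nth [::] (hl_table k) i = hl (k - i).
Proof.
by elim: k i => [|k IH] [|i] //= lik; rewrite subSS IH.
Qed.

Lemma hlS k : hl k.+1 =
  flatten [seq [seq (c.1 / k.+1%:R, i.+1 :: c.2) | c <- hl (k - i)]
             | i <- iota 0 k.+1].
Proof.
transitivity (flatten [seq [seq (c.1 / k.+1%:R, i.+1 :: c.2)
  | c <- nth [::] (hl_table k) i] | i <- iota 0 k.+1]) => //.
congr (flatten _); apply/eq_in_map => i.
by rewrite mem_iota add0n => /andP[_ lik]; rewrite nth_hl_table.
Qed.

Lemma hl_wf k : lwf k (hl k).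
Proof.
elim/ltn_ind: k => -[|k] IH //; rewrite hlS.
apply/allP=> c /flattenP[_ /mapP[i + ->] /mapP[d dL ->]] /=.
rewrite mem_iota add0n => /andP[_ lik].
have /allP/(_ _ dL) /andP[/eqP -> ->] := IH (k - i)%N ltac:(lia).
by rewrite andbT; lia.
Qed.

Definition hls s := foldr (fun k => lmul (hl k)) [:: (1, [::])] s.

Lemma hls_wf s : lwf (sumn s) (hls s).
Proof. by elim: s => //= k s IH; apply: lwf_mul => //; apply: hl_wf. Qed.

(* A ring morphism from the rationals encodes that K has characteristic 0. *)
Section RatLists.
Variables (K : fieldType) (kap : {rmorphism rat -> K}).

Lemma natr_neq0 k : k.+1%:R != 0 :> K.
Proof. by rewrite -(rmorph_nat kap) fmorph_eq0 pnatr_eq0. Qed.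

Lemma natr_pos_neq0 k : (0 < k)%N -> k%:R != 0 :> K.
Proof. by case: k => // k _; apply: natr_neq0. Qed.

Lemma alg_torsion_free (A : lmodType K) (u : A) k : u *+ k.+1 = 0 -> u = 0.
Proof.
by move/eqP; rewrite -scaler_nat scaler_eq0 (negPf (natr_neq0 _)) => /eqP.
Qed.

Definition lrat (L : seq (rat * seq nat)) := [seq (kap c.1, c.2) | c <- L].

Lemma lrat_wf n L : lwf n (lrat L) = lwf n L.
Proof. by rewrite /lwf all_map; apply: eq_all. Qed.

Lemma lrat_mul L1 L2 : lrat (lmul L1 L2) = lmul (lrat L1) (lrat L2).
Proof.
rewrite /lrat /lmul map_allpairs allpairs_mapl allpairs_mapr /=.
by apply: eq_allpairs => c d /=; rewrite rmorphM.
Qed.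

Variable A : comAlgType K.

Lemma isexp_hl (x : nat -> A) : isexp x (fun k => lev (lrat (hl k)) x).
Proof.
split=> [|[|k]]; first by rewrite /lev /= big_seq1 rmorph1 big_nil scale1r.
  by rewrite big_ord0.
rewrite [in LHS]/lev [in LHS]/lrat hlS big_map big_flatten big_map.
rewrite -(big_mkord xpredT (fun i => x i.+1 * lev (lrat (hl (k.+1 - i.+1)%N)) x)).
rewrite -sumrMnl /index_iota subn0; apply: eq_bigr => i _.
rewrite big_map subSS /lev /lrat big_map mulr_sumr -sumrMnl; apply: eq_bigr => c _ /=.
rewrite big_cons -scalerAr -scaler_nat scalerA; congr (_ *: _).
by rewrite fmorph_div rmorph_nat mulrCA divff ?mulr1 ?natr_neq0.
Qed.

Lemma lev_hls (x : nat -> A) s :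
  lev (lrat (hls s)) x = \prod_(k <- s) lev (lrat (hl k)) x.
Proof.
elim: s => [|k s IH]; first by rewrite /lev big_seq1 !big_nil rmorph1 scale1r.
by rewrite /= lrat_mul lev_mul IH big_cons.
Qed.

(** In characteristic 0 every solution of Newton's recursion is an evaluation of the universal
    polynomial [hl k]. Thus h_k, e_k and h_k[X/(1-t)] share one power sum expansion, up to rescaling
    the p_i. *)
Lemma isexpE (x a : nat -> A) k : isexp x a -> a k = lev (lrat (hl k)) x.
Proof.
move=> ea; have tf (u : A) j : u *+ j.+1 = 0 -> u = 0.
  exact: alg_torsion_free.
exact: (isexp_unique tf ea (isexp_hl x)).
Qed.

End RatLists.

(** * Partitions and the dominance order *)

Lemma geq_trans : transitive geq.
Proof. by move=> a b c /= ba cb; apply: leq_trans cb ba. Qed.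

Lemma geq_anti : antisymmetric geq.
Proof. by move=> a b /= /anti_leq. Qed.

Lemma geq_total : total geq.
Proof. by move=> a b; apply: leq_total. Qed.

Lemma sumn_filter_pos s : sumn [seq k <- s | (0 < k)%N] = sumn s.
Proof. by elim: s => //= -[|k] s IH //=; rewrite IH. Qed.

Lemma parts_sorted n (la : intpart n) : sorted geq (parts la).
Proof.
apply: (sorted_filter geq_trans); by case/andP: (intpartP la).
Qed.

Lemma parts_pos n (la : intpart n) : all (fun k => (0 < k)%N) (parts la).
Proof. exact: filter_all. Qed.

Lemma sumn_parts n (la : intpart n) : sumn (parts la) = n.
Proof. by rewrite sumn_filter_pos; case/andP: (intpartP la) => _ /eqP. Qed.

Lemma size_le_sumn s : all (fun k => (0 < k)%N) s -> (size s <= sumn s)%N.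
Proof. by elim: s => //= k s IH /andP[k0 /IH]; lia. Qed.

Lemma size_parts n (la : intpart n) : (size (parts la) <= n)%N.
Proof. by rewrite -[X in (_ <= X)%N](sumn_parts la) size_le_sumn ?parts_pos. Qed.

Lemma sorted_geq_pad s : sorted geq s ->
  s = [seq k <- s | (0 < k)%N] ++ nseq (count (pred1 0%N) s) 0%N.
Proof.
elim: s => //= -[|k] s IH ss /=.
  have s0 : all (pred1 0%N) s.
    have := order_path_min geq_trans ss.
    by apply: sub_all => x /=; rewrite leqn0.
  have -> : [seq k <- s | (0 < k)%N] = [::].
    apply/eqP; rewrite -size_eq0 size_filter -leqn0 leqNgt -has_count.
    by rewrite -all_predC; apply: sub_all s0 => x /= /eqP ->.
  congr (_ :: _); have /all_pred1P -> := s0.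
  by rewrite count_nseq /= mul1n.
 congr (_ :: _); apply: IH; apply: path_sorted ss.
Qed.

Lemma parts_inj n : injective (@parts n).
Proof.
move=> la mu e; apply/val_inj/val_inj/(inj_map val_inj).
have sl : sorted geq (map val (intpart_tuple la)) by case/andP: (intpartP la).
have sm : sorted geq (map val (intpart_tuple mu)) by case/andP: (intpartP mu).
rewrite /= (sorted_geq_pad sl) (sorted_geq_pad sm) -/(parts la) -/(parts mu) e.
congr (_ ++ nseq _ _).
have cnt (nu : intpart n) :
    (size (parts nu) + count (pred1 0%N) (map val (intpart_tuple nu)) = n)%N.
  rewrite size_filter -[RHS](size_tuple (intpart_tuple nu)) -(size_map val).
  rewrite -[RHS](count_predC (fun k => 0 < k)%N); congr (_ + _)%N.
  by apply: eq_count => -[].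
by have := cnt la; rewrite e => c1; have := cnt mu => c2; apply/eqP;
  rewrite -(eqn_add2l (size (parts mu))) c1 c2.
Qed.

Lemma perm_parts n (la mu : intpart n) :
  perm_eq (parts la) (parts mu) = (la == mu).
Proof.
apply/idP/eqP => [p|-> //].
by apply: parts_inj; apply: (sorted_eq geq_trans geq_anti);
  rewrite ?parts_sorted.
Qed.

Lemma parts_exist n (s : seq nat) : sumn s = n -> sorted geq s ->
  all (fun k => (0 < k)%N) s -> exists la : intpart n, parts la = s.
Proof.
move=> sn ss ps.
have szn : (size s <= n)%N by rewrite -sn size_le_sumn.
pose t := s ++ nseq (n - size s) 0%N.
have tn : size t == n by rewrite size_cat size_nseq subnKC.
have t_le k : k \in t -> (k <= n)%N.
  rewrite mem_cat => /orP[ks|/nseqP[-> //]].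
  rewrite -sn; elim: (s) ks => //= a u IH; rewrite inE => /orP[/eqP ->|/IH].
    exact: leq_addr.
  by move/leq_trans; apply; apply: leq_addl.
have st : size (map (@inord n) t) == n by rewrite size_map.
have mt : map val (Tuple st) = t.
  rewrite /= -map_comp -[RHS]map_id; apply/eq_in_map => k /t_le kn /=.
  by rewrite inordK.
have ip : is_intpart (Tuple st).
  rewrite /is_intpart mt sumn_cat sumn_nseq mul0n addn0 sn eqxx andbT.
  rewrite /t; case: (s) ss => [_|a u /= su].
    by elim: (_ - _)%N => //= -[|m] IH.
  rewrite cat_path su; elim: (n - _)%N (last a u) => //= m IH b; exact: IH.
exists (IntPart ip); rewrite /parts /intpart_tuple mt filter_cat.
have -> : [seq k <- s | (0 < k)%N] = s by apply/all_filterP.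
rewrite (_ : filter _ _ = [::]) ?cats0 //.
by elim: (n - _)%N.
Qed.

Lemma ipart_exist n (s : seq nat) : sumn s = n ->
  all (fun k => (0 < k)%N) s -> exists la : intpart n, perm_eq (parts la) s.
Proof.
move=> sn ps.
have [||| la e] := @parts_exist n (sort geq s).
- by rewrite -sn; apply/perm_sumn; rewrite perm_sort.
- exact: sort_sorted geq_total _.
- by rewrite all_sort.
by exists la; rewrite e perm_sort.
Qed.

Section Collect.
Variables (K : fieldType) (n : nat).
Implicit Types L : seq (K * seq nat).

Definition lcoef L (la : intpart n) : K :=
  \sum_(c <- L | perm_eq c.2 (parts la)) c.1.

Lemma lev_collect (A : comAlgType K) L (x : nat -> A) : lwf n L ->
  lev L x = \sum_(la : intpart n) lcoef L la *: \prod_(k <- parts la) x k.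
Proof.
move=> /allP wf; under eq_bigr => la _ do rewrite /lcoef scaler_suml.
rewrite (exchange_big_dep xpredT) //= /lev big_seq [RHS]big_seq; apply: eq_bigr => c cL.
have /andP[/eqP sc pc] := wf _ cL.
have [la pla] := ipart_exist sc pc.
rewrite (big_pred1 la) => [|mu].
  by congr (_ *: _); apply: perm_big; rewrite perm_sym.
by rewrite perm_sym -(permPr pla) perm_parts.
Qed.

End Collect.

(** For a decreasing s this is the maximum over k of the sum of the first k entries minus k c. Being
    symmetric in the entries, it tests dominance without any sorting. *)
Definition excess c s := (\sum_(k <- s) (k - c))%N.

Lemma sumn_big s : sumn s = (\sum_(k <- s) k)%N.
Proof. by elim: s => [|k s IH]; rewrite ?big_nil //= big_cons IH. Qed.

Lemma excess_perm c s t : perm_eq s t -> excess c s = excess c t.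
Proof. exact: perm_big. Qed.

Lemma sumn_take_le_excess c k s : (sumn (take k s) <= k * c + excess c s)%N.
Proof.
elim: s k => [|a s IH] [|k] //=; rewrite /excess ?big_nil // !big_cons.
have := IH k; rewrite /excess; lia.
Qed.

Lemma count_gt_sorted s j i : sorted geq s ->
  (i < count (fun k => (j < k)%N) s)%N = (j < nth 0%N s i)%N.
Proof.
elim: s i => [|a s IH] [|i] //= ss; rewrite ?nth_nil //.
  case: (ltnP j a) => //= aj; rewrite ?add0n; apply/negbTE; rewrite -leqNgt leqn0.
  rewrite -leqn0 leqNgt -has_count -all_predC.
  have := order_path_min geq_trans ss.
  by apply: sub_all => x /= xa; rewrite -leqNgt (leq_trans xa).
case: (ltnP j a) => /= aj; first by rewrite ?add1n ltnS IH // (path_sorted ss).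
rewrite ?add0n; have := order_path_min geq_trans ss => al.
have -> : count (fun k => (j < k)%N) s = 0%N.
  apply/eqP; rewrite -leqn0 leqNgt -has_count -all_predC.
  by apply: sub_all al => x /= xa; rewrite -leqNgt (leq_trans xa).
rewrite ltn0; apply/esym/negbTE; rewrite -leqNgt.
case: (ltnP i (size s)) => si; last by rewrite nth_default.
by apply: leq_trans aj; move/all_nthP: al => /(_ 0%N i si).
Qed.

Lemma sumn_take_excess c s : sorted geq s ->
  sumn (take (count (fun k => (c < k)%N) s) s)
    = (count (fun k => (c < k)%N) s * c + excess c s)%N.
Proof.
elim: s => [|a s IH] ss; first by rewrite /excess big_nil.
rewrite [count _ _]/= /excess big_cons -/(excess c s).
case: (ltnP c a) => ca; first by rewrite ?add1n /= IH ?(path_sorted ss) //; lia.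
have al := order_path_min geq_trans ss.
have al' : all (fun k => (k <= c)%N) s by apply: sub_all al => x /= xa; lia.
have -> : count (fun k => (c < k)%N) s = 0%N.
  apply/eqP; rewrite -leqn0 leqNgt -has_count -all_predC.
  by apply: sub_all al' => x /= xa; rewrite -leqNgt.
rewrite /= ?mul0n ?add0n; have -> : (a - c = 0)%N by lia.
rewrite add0n /excess big_seq big1 // => k ks.
by apply/eqP; rewrite subn_eq0 (allP al').
Qed.

(** With c the entry of t at k, the number k c + [excess c t] bounds the k-th prefix sum of every
    rearrangement, and the sorted one attains it. *)
Lemma sumn_take_sorted k s t : sorted geq t -> perm_eq s t ->
  (sumn (take k s) <= sumn (take k t))%N.
Proof.
move=> st /(excess_perm (nth 0%N t k)) e.
apply: leq_trans (sumn_take_le_excess (nth 0%N t k) k s) _; rewrite e.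
elim: t k st {s e} => [|a t IH] k ss; rewrite /excess.
  by rewrite big_nil nth_nil muln0.
case: k => [|k].
  rewrite mul0n add0n /= big_cons subnn add0n big_seq big1 // => x xt.
  have /allP/(_ _ xt) := order_path_min geq_trans ss; rewrite /= => xa.
  by apply/eqP; rewrite subn_eq0.
have := IH k (path_sorted ss); rewrite /excess big_cons /=.
suff : (nth 0%N t k <= a)%N by lia.
case: (ltnP k (size t)) => kt; last by rewrite nth_default.
by have /(all_nthP 0%N)/(_ k kt) := order_path_min geq_trans ss.
Qed.

Lemma dominated_excess c r s : sorted geq r -> dominated r s ->
  (excess c r <= excess c s)%N.
Proof.
move=> sr /(_ (count (fun k => (c < k)%N) r)); rewrite sumn_take_excess // => d.
have := sumn_take_le_excess c (count (fun k => (c < k)%N) r) s; lia.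
Qed.

(** The number of cells in the first c columns of s, hence a prefix sum of the conjugate
    partition. *)
Definition minsum c s := (\sum_(k <- s) minn k c)%N.

Lemma minsum_excess c s : (minsum c s + excess c s = sumn s)%N.
Proof.
rewrite /minsum /excess -big_split sumn_big; apply: eq_bigr => k _ /=; lia.
Qed.

(** [minsum] and [excess] add up to the total; this is the reversal of dominance under
    conjugation. *)
Lemma dominated_minsum c r s : sorted geq r -> sumn r = sumn s ->
  dominated r s -> (minsum c s <= minsum c r)%N.
Proof.
move=> sr e d; have := dominated_excess c sr d.
have := minsum_excess c r; have := minsum_excess c s; lia.
Qed.

Lemma nth_conj_parts s j : sorted geq s ->
  nth 0%N (conj_parts s) j = count (fun k => (j < k)%N) s.
Proof.
move=> ss; rewrite /conj_parts; case: (ltnP j (head 0%N s)) => lj.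
  by rewrite nth_mkseq.
rewrite nth_default ?size_mkseq //; apply/esym/eqP.
by rewrite -leqn0 leqNgt count_gt_sorted // nth0 -leqNgt.
Qed.

Lemma sumn_take_nth k s : sumn (take k s) = (\sum_(i < k) nth 0%N s i)%N.
Proof.
elim: s k => [|a s IH] [|k] //=; rewrite ?big_ord0 //.
  by rewrite big1 // => i _; rewrite nth_nil.
by rewrite big_ord_recl IH.
Qed.

Lemma sumn_take_conj j s : sorted geq s ->
  sumn (take j (conj_parts s)) = minsum j s.
Proof.
move=> ss; rewrite sumn_take_nth /minsum.
have -> : (\sum_(i < j) nth 0 (conj_parts s) i
  = \sum_(i < j) \sum_(k <- s) if i < k then 1 else 0)%N.
  by apply: eq_bigr => i _; rewrite nth_conj_parts // -sum1_count big_mkcond.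
rewrite exchange_big /=; apply: eq_bigr => k _.
rewrite -big_mkcond /= sum1_card cardE size_filter -enumT.
rewrite -(@count_map _ _ val (fun i => (i < k)%N)) val_enum_ord.
elim: j k => [|j IH] k; first by rewrite minn0.
by rewrite -addn1 iotaD count_cat IH /= add0n; case: ltnP; lia.
Qed.

Lemma conj_parts_exist n (la : intpart n) :
  exists mu : intpart n, parts mu == conj_parts (parts la).
Proof.
have ss := parts_sorted la.
suff [mu e] : exists mu : intpart n, parts mu = conj_parts (parts la).
  by exists mu; rewrite e.
apply: parts_exist.
- rewrite -[conj_parts _]take_size sumn_take_conj // size_mkseq.
  rewrite -[RHS](sumn_parts la) sumn_big /minsum !big_seq; apply: eq_bigr => k kl.
  apply/minn_idPl; move: kl ss; case: (parts la) => //= a s.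
  rewrite inE => /orP[/eqP -> //|ks] /(order_path_min geq_trans) /allP.
  exact.
- apply/(sortedP 0%N) => i _; rewrite !nth_conj_parts //=.
  by apply: sub_count => k /= /ltnW.
apply/(all_nthP 0%N) => i; rewrite size_mkseq => ih.
by rewrite nth_conj_parts // count_gt_sorted // nth0.
Qed.

Definition conj_part n (la : intpart n) : intpart n :=
  xchoose (conj_parts_exist la).

Lemma parts_conj n (la : intpart n) :
  parts (conj_part la) = conj_parts (parts la).
Proof. exact/eqP/(xchooseP (conj_parts_exist la)). Qed.

Lemma conj_part_inj n : injective (@conj_part n).
Proof.
move=> la mu e; apply/parts_inj/eqP.
have cnt j : count (fun k => (j < k)%N) (parts la)
           = count (fun k => (j < k)%N) (parts mu).
  by rewrite -!nth_conj_parts ?parts_sorted // -!parts_conj e.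
have nt i : nth 0%N (parts la) i = nth 0%N (parts mu) i.
  have := count_gt_sorted _ i (parts_sorted la).
  have := count_gt_sorted _ i (parts_sorted mu).
  move=> c1 c2; apply/eqP; rewrite eqn_leq; apply/andP; split; rewrite leqNgt.
    by rewrite -c2 cnt c1 ltnn.
  by rewrite -c1 -cnt c2 ltnn.
have szn (nu : intpart n) : size (parts nu) = count (fun k => (0 < k)%N) (parts nu).
  by apply/esym/eqP; rewrite -all_count parts_pos.
by apply/eqP/(@eq_from_nth _ 0%N) => [|i _]; rewrite ?nt // !szn cnt.
Qed.

Lemma conj_part_bij n : bijective (@conj_part n).
Proof. exact/injF_bij/conj_part_inj. Qed.

Lemma sum_tri m : (\sum_(i < m) i = 'C(m, 2))%N.
Proof. by rewrite -(big_mkord xpredT id) bin2_sum. Qed.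

(** Row indices are summed over the cells column by column: a column of height m contributes 0 + ...
    + (m - 1). This turns the power of t in the eigenvalue of nabla into a product over the parts of
    the conjugate. *)
Lemma nstat_conj n (la : intpart n) :
  nstat (parts la) = (\sum_(k <- parts (conj_part la)) 'C(k, 2))%N.
Proof.
have ss := parts_sorted la; rewrite parts_conj /conj_parts /mkseq big_map.
rewrite -[X in iota 0 X]subn0 -/(index_iota 0 _) big_mkord.
have szl j : (count (fun k => (j < k)%N) (parts la) <= size (parts la))%N.
  exact: count_size.
have E (j : nat) : ('C(count (fun k => (j < k)%N) (parts la), 2)
  = \sum_(i < size (parts la)) if j < nth 0 (parts la) i then i : nat else 0)%N.
  rewrite -sum_tri (big_ord_widen _ (fun i => i) (szl j)) big_mkcond.
  by apply: eq_bigr => i _; rewrite count_gt_sorted.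
under [RHS]eq_bigr => j _ do rewrite E.
rewrite exchange_big /=; apply: eq_bigr => i _.
rewrite -big_mkcond /= sum_nat_const mulnC; congr (_ * _)%N.
have li : (nth 0 (parts la) i <= head 0 (parts la))%N.
  have := ltn_ord i; move: ss; case: (parts la) (i : nat) => //= a s [|j] //=.
  move=> /(order_path_min geq_trans) /(all_nthP 0%N) al lj; exact: al.
rewrite -sum1_card.
rewrite -(big_ord_widen_cond _ xpredT (fun=> 1%N) li) sum1_card card_ord //.
Qed.

Lemma dominated_size r s : sumn r = sumn s -> all (fun k => (0 < k)%N) s ->
  dominated r s -> (size s <= size r)%N.
Proof.
move=> e ps /(_ (size r)); rewrite take_size e => d.
have := cat_take_drop (size r) s => /(congr1 sumn); rewrite sumn_cat => es.
have : all (fun k => (0 < k)%N) (drop (size r) s).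
  by move: ps; rewrite -{1}(cat_take_drop (size r) s) all_cat => /andP[].
move/size_le_sumn; rewrite size_drop; lia.
Qed.

Lemma dominated_trans r s t : dominated r s -> dominated s t -> dominated r t.
Proof. by move=> rs st k; apply: leq_trans (rs k) (st k). Qed.

(** * Power sums *)

Section Monomials.
Variables (R : comNzRingType) (N : nat).
Implicit Types (m : 'X_{1..N}) (p : {mpoly R[N]}).

Lemma mcoeff_MXn (i : 'I_N) k p m :
  ('X_i ^+ k * p)@_m = if (k <= m i)%N then p@_(m - U_(i) *+ k) else 0.
Proof.
rewrite mulrC mpolyXn; case: leqP => km.
  have {1}-> : m = ((U_(i) *+ k) + (m - U_(i) *+ k))%MM.
    apply/mnmP => j; rewrite mnmDE mnmBE mulmnE mnmE.
    by case: eqP => [<-|_] /=; lia.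
  by rewrite mcoeffMX.
rewrite [p]mpolyE mulr_suml raddf_sum big1 // => m' _.
rewrite -scalerAl -mpolyXD /= mcoeffZ mcoeffX; case: eqP => [e|]; rewrite ?mulr0 //.
by move: km; rewrite -e mnmDE mulmnE mnmE eqxx; lia.
Qed.

(* The number of ways to distribute the parts s into N bins of content m. *)
Fixpoint distributions (s : seq nat) m : nat :=
  if s is k :: s' then
    (\sum_(i < N) if k <= m i then distributions s' (m - U_(i) *+ k)%MM else 0)%N
  else (m == 0%MM).

Lemma mcoeff_power_sums s m :
  (\prod_(k <- s) power_sum R k N)@_m = (distributions s m)%:R.
Proof.
elim: s m => [|k s IH] m; first by rewrite big_nil mcoeff1.
rewrite big_cons /power_sum mulr_suml raddf_sum natr_sum; apply: eq_bigr => i _.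
by rewrite /= mcoeff_MXn; case: ifP => // _; apply: IH.
Qed.

Definition mvals m := [seq k <- [seq m i | i <- enum 'I_N] | (0 < k)%N].

Definition mrest m i := [seq k <- [seq m j | j <- rem i (enum 'I_N)] | (0 < k)%N].

Lemma mvals_rest m i :
  perm_eq (mvals m) ((if (0 < m i)%N then [:: m i] else [::]) ++ mrest m i).
Proof.
have /(perm_map m)/(perm_filter (fun k => 0 < k)%N) :=
  perm_to_rem (mem_enum 'I_N i).
by rewrite /mvals /mrest /=; case: ifP.
Qed.

Lemma mrest_sub m i k : mrest (m - U_(i) *+ k)%MM i = mrest m i.
Proof.
congr filter; apply/eq_in_map => j; rewrite mem_rem_uniq ?enum_uniq // !inE.
move=> /andP[ji _]; rewrite mnmBE mulmnE mnmE eq_sym (negPf ji) mul0n subn0 //.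
Qed.

Lemma mnmB1E m i k : (m - U_(i) *+ k)%MM i = (m i - k)%N.
Proof. by rewrite mnmBE mulmnE mnmE eqxx mul1n. Qed.

(** Every nonempty bin receives at least one part, so there are at least as many parts as such bins,
    with equality only if each receives exactly one. *)
Lemma distributions_size s m : all (fun k => (0 < k)%N) s ->
  (0 < distributions s m)%N ->
  perm_eq s (mvals m) \/ (size (mvals m) < size s)%N.
Proof.
elim: s m => [|k s IH] m /=.
  move=> _; case: eqP => // -> _; left; rewrite /mvals.
  have -> : [seq (0%MM : 'X_{1..N}) i | i <- enum 'I_N] = nseq N 0%N.
    rewrite -[in RHS](size_enum_ord N); elim: (enum 'I_N) => //= i l ->.
    by rewrite mnm0E.
  by elim: N.
move=> /andP[k0 ps]; rewrite lt0n sum_nat_eq0 negb_forall => /existsP[i].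
rewrite implyTb; case: (leqP k (m i)) => // km; rewrite -lt0n => /(IH _ ps).
have p1 := mvals_rest m i; have := mvals_rest (m - U_(i) *+ k)%MM i.
rewrite mrest_sub mnmB1E => p2; rewrite (leq_trans k0 km) /= in p1.
rewrite (perm_size p1) (permPr p1) (perm_size p2) (permPr p2).
have [->|ltk] := eqVneq (m i) k.
  by rewrite subnn /= perm_cons ltnS.
have -> : (0 < m i - k)%N by lia.
by move=> -[/perm_size /=|/=] sz; right; lia.
Qed.

Lemma distributions_mvals s m : all (fun k => (0 < k)%N) s ->
  perm_eq s (mvals m) -> (0 < distributions s m)%N.
Proof.
elim: s m => [|k s IH] m /=.
  move=> _ /perm_size /esym/size0nil e; rewrite lt0b; apply/eqP/mnmP => i.
  rewrite mnm0E; apply/eqP; rewrite -leqn0 leqNgt; apply/negP => mi.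
  suff : m i \in mvals m by rewrite e.
  by rewrite mem_filter mi map_f ?mem_enum.
move=> /andP[k0 ps] pm.
have : k \in mvals m by rewrite -(perm_mem pm) mem_head.
rewrite mem_filter k0 /= => /mapP[i _ ek].
rewrite lt0n sum_nat_eq0 negb_forall; apply/existsP; exists i.
rewrite implyTb ek leqnn -lt0n; apply: IH => //.
have := mvals_rest m i; rewrite -ek k0 -(permPl pm) /= perm_cons => ps'.
have := mvals_rest (m - U_(i) *+ k)%MM i.
by rewrite mrest_sub mnmB1E -ek subnn /= -(permPr ps') perm_sym.
Qed.

End Monomials.

Definition part_mnm N n (la : intpart n) : 'X_{1..N} :=
  [multinom nth 0%N (parts la) i | i < N].

Lemma mvals_part N n (la : intpart n) : (n <= N)%N ->
  mvals (part_mnm N la) = parts la.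
Proof.
move=> nN; rewrite /mvals.
have -> : [seq part_mnm N la i | i <- enum 'I_N]
        = mkseq (fun i => nth 0%N (parts la) i) N.
  rewrite /mkseq -val_enum_ord -map_comp; apply: eq_map => i /=.
  by rewrite mnmE.
have szN := leq_trans (size_parts la) nN.
rewrite -(subnKC szN) /mkseq iotaD map_cat filter_cat add0n.
rewrite -/(mkseq _ _) mkseq_nth (all_filterP (parts_pos la)).
rewrite (_ : filter _ _ = [::]) ?cats0 //.
apply/eqP; rewrite -size_eq0 size_filter -leqn0 leqNgt -has_count -all_predC.
apply/allP => _ /mapP[i + ->] /=.
by rewrite mem_iota => /andP[si _]; rewrite nth_default.
Qed.

(** The coefficient of x^nu in p_rho, taken in n variables, which accommodate every partition of
    n. *)
Definition pmult n (rho nu : intpart n) : nat :=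
  distributions (parts rho) (part_mnm n nu).

Lemma pmult_neq0 n (rho nu : intpart n) : pmult rho nu != 0%N ->
  rho = nu \/ (size (parts nu) < size (parts rho))%N.
Proof.
rewrite -lt0n => /(distributions_size (parts_pos _)).
rewrite mvals_part // perm_parts => -[/eqP|]; [by left | by right].
Qed.

Lemma pmult_diag n (nu : intpart n) : pmult nu nu != 0%N.
Proof.
by rewrite -lt0n distributions_mvals ?parts_pos // mvals_part.
Qed.

Lemma mcoeff_pbasis (R : comNzRingType) n (rho nu : intpart n) :
  (pbasis R rho n)@_(part_mnm n nu) = (pmult rho nu)%:R.
Proof. exact: mcoeff_power_sums. Qed.

Lemma arg_max_size n (P : pred (intpart n)) nu : P nu ->
  exists2 la, P la & forall mu, P mu -> (size (parts mu) <= size (parts la))%N.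
Proof.
by move=> Pnu; case: (arg_maxnP (fun la : intpart n => size (parts la)) Pnu) => i; exists i.
Qed.

Section PowerSums.
Variables (K : fieldType) (kap : {rmorphism rat -> K}).
Let natr_neq0K k : k.+1%:R != 0 :> K := natr_neq0 kap k.

Lemma pmult_diagR n (nu : intpart n) : (pmult nu nu)%:R != 0 :> K.
Proof. by have := pmult_diag nu; case: (pmult _ _). Qed.

(** For a nu with the most parts among those with [c nu] nonzero, the monomial x^nu comes from p_nu
    alone. Independence therefore holds already in n variables. *)
Lemma pbasis_free0 n (c : intpart n -> K) :
  lincomb c (@pbasis K n) n = 0 -> forall la, c la = 0.
Proof.
move=> e la; apply/eqP/negPn/negP => cla.
have [nu cnu max] := @arg_max_size n (fun la => c la != 0) la cla.
have /eqP := congr1 (mcoeff (part_mnm n nu)) e.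
rewrite mcoeff0 raddf_sum (bigD1 nu) //= big1 => [|mu munu].
  by rewrite /= mcoeffZ mcoeff_pbasis addr0 mulf_eq0 (negPf cnu) (negPf (pmult_diagR _)).
rewrite /= mcoeffZ mcoeff_pbasis; have [->|cmu] := eqVneq (c mu) 0; first by rewrite mul0r.
have [->|/pmult_neq0 [e'|lt]] := eqVneq (pmult mu nu) 0%N; first by rewrite mulr0.
  by rewrite e' eqxx in munu.
by have := max _ cmu; rewrite leqNgt lt.
Qed.

Lemma pbasis_free n (c d : intpart n -> K) :
  lincomb c (@pbasis K n) n = lincomb d (@pbasis K n) n -> c =1 d.
Proof.
move=> e la; apply/eqP; rewrite -subr_eq0; apply/eqP.
apply: (@pbasis_free0 n (fun la => c la - d la)) la.
rewrite /lincomb; under eq_bigr => la _ do rewrite scalerBl.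
by rewrite sumrB; apply/eqP; rewrite subr_eq0; apply/eqP.
Qed.

End PowerSums.

Lemma sum_ord_lt a k : (\sum_(i < k) (i < a) = minn a k)%N.
Proof. by elim: k => [|k IH]; rewrite ?big_ord0 ?minn0 // big_ord_recr /= IH; lia. Qed.

Section Newton.
Variables (R : comNzRingType) (N : nat).
Implicit Types (m : 'X_{1..N}).

Lemma mcoeff_complete_sym k m :
  (complete_sym R k N)@_m = (mdeg m == k)%:R.
Proof.
rewrite raddf_sum /=; case: eqP => [e|ne].
  have lt : (mdeg m < k.+1)%N by rewrite e.
  rewrite (bigD1 (BMultinom lt)) /= ?e //= mcoeffX eqxx big1 ?addr0 // => m'.
  move=> /andP[_ ne]; rewrite mcoeffX; case: eqP => // e'.
  by case/eqP: ne; apply: val_inj.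
rewrite big1 // => m' /eqP e; rewrite mcoeffX; case: eqP => // e'.
by rewrite -e' in ne.
Qed.

(** The right-hand coefficient of a monomial x^m of degree k counts the pairs (i, j) with 1 <= i <=
    m_j, one for each power x_j^i dividing it; there are k of them. *)
Lemma isexp_complete_sym :
  isexp (fun i => power_sum R i N) (fun k => complete_sym R k N).
Proof.
split=> [|k]; apply/mpolyP => m.
  by rewrite mcoeff_complete_sym mdeg_eq0 mcoeff1.
rewrite mcoeffMn mcoeff_complete_sym raddf_sum /=.
have E (i : 'I_k) : (power_sum R i.+1 N * complete_sym R (k - i.+1) N)@_m
    = (\sum_(j < N) ((i < m j) && (mdeg m == k)))%N%:R.
  rewrite /power_sum mulr_suml raddf_sum natr_sum; apply: eq_bigr => j _ /=.
  rewrite mcoeff_MXn; case: ltnP => //= ij; rewrite mcoeff_complete_sym.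
  have {1}-> : mdeg (m - U_(j) *+ i.+1)%MM = (mdeg m - i.+1)%N.
    suff -> : mdeg m = (mdeg (m - U_(j) *+ i.+1)%MM + i.+1)%N by rewrite addnK.
    rewrite -[in LHS](@submK _ (U_(j) *+ i.+1)%MM m).
      by rewrite mdegD mdegMn mdeg1 mul1n.
    by apply/mnm_lepP => l; rewrite mulmnE mnmE; case: eqP => [<-|] //=; lia.
  have ik := ltn_ord i; congr (_%:R); congr nat_of_bool.
  have : (m j <= mdeg m)%N by rewrite mdegE (bigD1 j) //= leq_addr.
  by move=> mj; apply/eqP/eqP; lia.
rewrite (eq_bigr _ (fun i _ => E i)) -natr_sum exchange_big /= -mulrnA.
congr (_%:R); case: eqP => [e|_]; last first.
  by rewrite big1 // => j _; rewrite big1 // => i _; rewrite andbF.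
rewrite mul1n -[LHS]e mdegE; apply: eq_bigr => j _.
have mj : (m j <= k)%N by rewrite -e mdegE (bigD1 j) //= leq_addr.
under [RHS]eq_bigr => i _ do rewrite andbT.
by rewrite sum_ord_lt; apply/esym/minn_idPl.
Qed.

End Newton.

Section NewtonElem.
Variable A : comNzRingType.

(** The logarithm of 1 + u z is \sum_(i >= 1) [altpow u i] z^i / i. *)
Definition altpow (u : A) (i : nat) : A := (-1) ^+ i.-1 * u ^+ i.

Lemma isexp_linear (u : A) : isexp (altpow u) (fun k => (1 + u *: 'X)`_k).
Proof.
have cE k : (1 + u *: 'X : {poly A})`_k = if k is k'.+1 then u * (k' == 0%N)%:R else 1.
  by rewrite coefD coefZ coefX coef1; case: k => [|[|k]] /=; rewrite ?mulr0 ?addr0 ?add0r.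
split=> [|k]; first by rewrite cE.
rewrite cE; case: k => [|[|k]]; first by rewrite big_ord0.
  by rewrite big_ord1 cE /altpow /= expr0 mul1r expr1 mulr1n mulr1.
rewrite mulr0 mul0rn !big_ord_recr /= big1 => [|i _]; rewrite cE.
  rewrite !cE subnn subSnn /altpow /= add0r !mulr1 [u ^+ k.+2]exprSr.
  by rewrite [(-1) ^+ k.+1]exprS; ring.
have -> : (k.+2 - i.+1 = (k - i).+1)%N by have := ltn_ord i; lia.
have -> : (k - i == 0)%N = false by have := ltn_ord i; lia.
by rewrite !mulr0.
Qed.

Lemma isexp_prod_linear (I : finType) (P : pred I) (v : I -> A) :
  isexp (fun i => \sum_(j | P j) altpow (v j) i)
        (fun k => (\prod_(j | P j) (1 + v j *: 'X))`_k).
Proof.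
suff E (s : seq I) : isexp (fun i => \sum_(j <- s) altpow (v j) i)
                           (fun k => (\prod_(j <- s) (1 + v j *: 'X))`_k).
  by apply: isexp_ext (E [seq j <- index_enum I | P j]) => [i|k]; rewrite big_filter.
elim: s => [|j s IH].
  apply: isexp_ext (isexp0 A) => [i|k]; first by rewrite big_nil.
  by rewrite big_nil coef1.
apply: isexp_ext (isexp_conv (isexp_linear (v j)) IH) => [i|k].
  by rewrite big_cons.
by rewrite big_cons coefM.
Qed.

End NewtonElem.

Section NewtonMesym.
Variables (R : comNzRingType) (N : nat).

Lemma coef_prod_mesym k :
  (\prod_(j < N) (1 + 'X_j *: 'X : {poly {mpoly R[N]}}))`_k = mesym N R k.
Proof.
under eq_bigr => j _ do rewrite addrC.
rewrite bigA_distr /= coef_sum /mesym [RHS]big_mkcond /=; apply: eq_bigr => J _.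
rewrite -big_mkcond /= -(mulr1 (\prod_(i in J) _)).
have -> : \prod_(i in J) ('X_i *: 'X : {poly {mpoly R[N]}}) * 1
        = (\prod_(i in J) 'X_i) *: 'X^#|J|.
  rewrite mulr1 -prodr_const; apply: (big_rec3 (fun a b c => a = b *: c)).
    by rewrite scale1r.
  by move=> i a b c _ ->; rewrite -scalerAl -scalerAr scalerA.
by rewrite coefZ coefXn eq_sym; case: eqP; rewrite ?mulr1 ?mulr0.
Qed.

Lemma isexp_mesym :
  isexp (fun i => (-1) ^+ i.-1 * power_sum R i N) (fun k => mesym N R k).
Proof.
apply: isexp_ext (isexp_prod_linear xpredT (fun j : 'I_N => 'X_j)) => [i|k].
  by rewrite /power_sum mulr_sumr.
exact: coef_prod_mesym.
Qed.

End NewtonMesym.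

(** The only term of h_k with a single factor is that of p_k; choosing any other term for some k
    lengthens the product. *)
Lemma hls_refine s (c : rat * seq nat) : all (fun k => (0 < k)%N) s ->
  c \in hls s -> perm_eq c.2 s \/ (size s < size c.2)%N.
Proof.
elim: s c => [|k s IH] c /=; first by rewrite inE => _ /eqP ->; left.
move=> /andP[k0 ps] /allpairsP[[c1 c2] /= [c1L c2L ->]] /=.
have /andP[/eqP s1 p1] := allP (hl_wf k) _ c1L.
rewrite size_cat; case: c1 s1 p1 {c1L} => u [|i [|j l]] /= s1 p1.
- by rewrite -s1 in k0.
- rewrite addn0 in s1; rewrite s1 perm_cons /=.
  by case: (IH _ ps c2L) => [|lt]; [left | right; rewrite ltnS].
- case: (IH _ ps c2L) => [/perm_size|] sz; right; rewrite /= !addSn !ltnS.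
    by rewrite sz leq_addl.
  exact: leq_trans (ltnW sz) (leq_addl _ _).
Qed.

Lemma hl_gt0 k c : c \in hl k -> 0 < c.1.
Proof.
elim/ltn_ind: k c => -[|k] IH c; first by rewrite inE => /eqP ->.
rewrite hlS => /flattenP[_ /mapP[i + ->] /mapP[d dL ->]] /=.
rewrite mem_iota add0n => /andP[_ lik].
by rewrite divr_gt0 ?ltr0Sn // (IH (k - i)%N) //; lia.
Qed.

Lemma hls_gt0 s c : c \in hls s -> 0 < c.1.
Proof.
elim: s c => [|k s IH] c /=; first by rewrite inE => /eqP ->.
by move=> /allpairsP[[c1 c2] /= [/hl_gt0 ? /IH ? ->]] /=; rewrite mulr_gt0.
Qed.

Lemma hl_top k : (0 < k)%N -> exists u, (u, [:: k]) \in hl k.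
Proof.
case: k => // k _; exists (1 / k.+1%:R); rewrite hlS.
apply/flattenP; exists [seq (c.1 / k.+1%:R, k.+1 :: c.2) | c <- hl (k - k)].
  by apply/mapP; exists k; rewrite // mem_iota add0n /= ltnSn.
by rewrite subnn; apply/mapP; exists (1, [::]).
Qed.

Lemma hls_top s : all (fun k => (0 < k)%N) s -> exists u, (u, s) \in hls s.
Proof.
elim: s => [|k s IH] /=; first by exists 1; rewrite inE.
move=> /andP[/hl_top[u uL] /IH[v vL]]; exists (u * v).
by apply/allpairsP; exists ((u, [:: k]), (v, s)).
Qed.

(* chi la rho is the coefficient of p_rho in h_la. *)
Definition chi n (la rho : intpart n) : rat := lcoef (hls (parts la)) rho.

Lemma chi_neq0 n (la rho : intpart n) : chi la rho != 0 ->
  rho = la \/ (size (parts la) < size (parts rho))%N.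
Proof.
move=> ne; have [c cL pc] : exists2 c, c \in hls (parts la) & perm_eq c.2 (parts rho).
  apply/hasP/negPn/negP => /hasPn no; case/eqP: ne.
  by rewrite /chi /lcoef big_seq_cond big1 // => c /andP[/no /negbTE ->].
case: (hls_refine (parts_pos la) cL).
  by rewrite (permPl pc) perm_parts => /eqP; left.
by rewrite (perm_size pc); right.
Qed.

(** Several terms of the list may sort to la, but all coefficients are positive and cannot
    cancel. *)
Lemma chi_diag n (la : intpart n) : chi la la != 0.
Proof.
have [u uL] := hls_top (parts_pos la).
rewrite gt_eqF // /chi /lcoef (big_rem _ uL) perm_refl ltr_wpDr ?(hls_gt0 uL) //.
by rewrite big_seq_cond sumr_ge0 // => c /andP[/mem_rem /hls_gt0 /ltW].
Qed.

Section Expansions.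
Variables (K : fieldType) (kap : {rmorphism rat -> K}).

Lemma lcoef_lrat n L (la : intpart n) : lcoef (lrat kap L) la = kap (lcoef L la).
Proof. by rewrite /lcoef big_map rmorph_sum. Qed.

Lemma chi_lev (A : comAlgType K) n (la : intpart n) (x : nat -> A) :
  \prod_(k <- parts la) lev (lrat kap (hl k)) x
    = \sum_rho kap (chi la rho) *: \prod_(k <- parts rho) x k.
Proof.
rewrite -lev_hls (@lev_collect _ n); last first.
  by rewrite lrat_wf -[X in lwf X _](sumn_parts la) hls_wf.
by apply: eq_bigr => rho _; rewrite lcoef_lrat.
Qed.

Lemma complete_symE k N :
  complete_sym K k N = lev (lrat kap (hl k)) (fun i => power_sum K i N).
Proof. exact: (isexpE kap k (isexp_complete_sym K N)). Qed.

Lemma elem_symE k N :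
  elem_sym K k N
    = lev (lrat kap (hl k)) (fun i => (-1) ^+ i.-1 *: power_sum K i N).
Proof.
rewrite /elem_sym (isexpE kap k (isexp_mesym K N)); apply: eq_bigr => c _.
congr (_ *: _); apply: eq_bigr => i _.
exact: sign_scale.
Qed.

(** The eigenvalue of omega on p_rho. *)
Definition parts_sign n (rho : intpart n) : K := \prod_(k <- parts rho) (-1) ^+ k.-1.

Lemma hbasisE n (la : intpart n) N :
  hbasis K la N = lincomb (fun rho => kap (chi la rho)) (@pbasis K n) N.
Proof.
rewrite /hbasis /lincomb -(chi_lev la (fun i => power_sum K i N)).
by apply: eq_bigr => k _; apply: complete_symE.
Qed.

Lemma ebasisE n (la : intpart n) N :
  ebasis K la N
    = lincomb (fun rho => kap (chi la rho) * parts_sign rho) (@pbasis K n) N.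
Proof.
rewrite /ebasis (eq_bigr _ (fun k _ => elem_symE k N)).
rewrite (chi_lev la (fun i => (-1) ^+ i.-1 *: power_sum K i N)).
by apply: eq_bigr => rho _; rewrite scaler_prod scalerA.
Qed.

End Expansions.

(** * Schur polynomials: the Jacobi-Trudi identity *)

Section JacobiTrudi.
Variables (A : comNzRingType) (x : nat -> A).

(* The complete symmetric functions of x_0, ..., x_(N-1). *)
Fixpoint hcomp N : nat -> A :=
  if N is N'.+1 then conv (fun i => x N' ^+ i) (hcomp N')
  else fun k => (k == 0%N)%:R.

Lemma isexp_hcomp N : isexp (fun i => \sum_(j < N) x j ^+ i) (hcomp N).
Proof.
elim: N => [|N IH] /=.
  by apply: isexp_ext (isexp0 A) => [i|//]; rewrite big_ord0.
apply: isexp_ext (isexp_conv (isexp_powers (x N)) IH) => [i|//].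
by rewrite big_ord_recr /= addrC.
Qed.

Lemma hcomp0 N : hcomp N 0 = 1.
Proof. exact: (isexp_hcomp N).1. Qed.

Lemma hcompSS N k : hcomp N.+1 k.+1 = x N * hcomp N.+1 k + hcomp N k.+1.
Proof.
rewrite /= /conv big_ord_recl expr0 mul1r subn0 addrC mulr_sumr; congr (_ + _).
by apply: eq_bigr => i _; rewrite ?lift0 subSS exprS mulrA.
Qed.

(* h_(b - q), read as 0 for b < q. *)
Definition hshift N q b := if (q <= b)%N then hcomp N (b - q) else 0.

Lemma hshiftS N q b : hshift N.+1 q b.+1 = x N * hshift N.+1 q b + hshift N q b.+1.
Proof.
rewrite /hshift; case: (ltngtP q b.+1) => qb.
- by rewrite ltnS in qb; rewrite qb subSn // hcompSS.
- have -> : (q <= b)%N = false by lia. by rewrite mulr0 addr0.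
by rewrite qb ltnn mulr0 add0r subnn !hcomp0.
Qed.

Lemma hshift_rec N q b0 b : (b0 <= b)%N ->
  hshift N.+1 q b = x N ^+ (b - b0) * hshift N.+1 q b0
                    + \sum_(b0.+1 <= c < b.+1) x N ^+ (b - c) * hshift N q c.
Proof.
elim: b => [|b IH]; first by rewrite leqn0 => /eqP ->; rewrite big_nil addr0 mul1r.
rewrite leq_eqVlt ltnS => /predU1P[->|le].
  by rewrite subnn mul1r big_geq ?addr0.
rewrite hshiftS IH // [X in _ = _ + X]big_nat_recr //= subnn mul1r mulrDr addrA; congr (_ + _ + _).
  by rewrite mulrA -exprS subSn.
rewrite mulr_sumr !big_nat; apply: eq_bigr => c /andP[_ cb].
by rewrite mulrA -exprS subSn.
Qed.

Lemma hshift_rec0 N q b :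
  hshift N.+1 q b = \sum_(0 <= c < b.+1) x N ^+ (b - c) * hshift N q c.
Proof.
rewrite (hshift_rec N q (leq0n b)) [RHS]big_nat_recl // subn0; congr (_ * _ + _).
  by rewrite /hshift leqn0; case: eqP => // ->; rewrite !hcomp0.
by rewrite big_add1.
Qed.

Section Rows.
Variable m : nat.

Definition jt_mx N (la : nat -> nat) : 'M[A]_m :=
  \matrix_(i < m, j < m) hshift N (m - j.+1) (la i + (m - i.+1)).

Definition jt N la := \det (jt_mx N la).

Definition elim_mx (u : nat -> A) : 'M[A]_m :=
  \matrix_(i, j) ((i == j)%:R - (j == i.+1 :> nat)%:R * u i).

Lemma det_elim_mx u : \det (elim_mx u) = 1.
Proof.
rewrite -det_tr det_trig; last first.
  apply/is_trig_mxP => i j ij; rewrite !mxE.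
  have -> : (j == i) = false by apply/eqP => e; rewrite e ltnn in ij.
  have -> : (i == j.+1 :> nat) = false by lia.
  by rewrite mul0r subr0.
by rewrite big1 // => i _; rewrite !mxE eqxx ltn_eqF // mul0r subr0.
Qed.

(* Subtracting from each row a multiple of the next leaves in row i only the
   terms with la_(i+1) <= c <= la_i, the range of the i-th part of a shape
   interlacing la. *)
Lemma jt_eliminate N (la : nat -> nat) :
  la m = 0%N -> (forall i, (la i.+1 <= la i)%N) ->
  jt N.+1 la = \det (\matrix_(i < m, j < m)
    \sum_(la i.+1 <= c < (la i).+1)
      x N ^+ (la i - c) * hshift N (m - j.+1) (c + (m - i.+1))).
Proof.
(* The shifted lengths la_i + m - i - 1 of consecutive rows differ by la_i - la_(i+1) + 1, the
   number of times [hshift_rec] is unrolled to reach the entry of row i + 1. *)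
move=> lam dec; pose u i := x N ^+ (la i - la i.+1).+1.
rewrite /jt -[LHS]mul1r -(det_elim_mx u) -det_mulmx; congr (\det _).
apply/matrixP => i j; rewrite !mxE.
have -> : \sum_(k < m) elim_mx u i k * jt_mx N.+1 la k j
  = jt_mx N.+1 la i j - \sum_(k < m | k == i.+1 :> nat) u i * jt_mx N.+1 la k j.
  rewrite (bigD1 i) //= [X in _ = _ - X]big_mkcond [X in _ = _ - X](bigD1 i) //=.
  rewrite !mxE eqxx (ltn_eqF (ltnSn i)) mul0r subr0 mul1r /= add0r; congr (_ + _).
  rewrite -sumrN; apply: eq_bigr => k ki; rewrite !mxE eq_sym (negPf ki).
  by case: eqP; rewrite ?mul1r ?mul0r ?sub0r ?oppr0 ?mul0r ?mulNr.
rewrite mxE.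
have shiftE : \sum_(la i.+1 <= c < (la i).+1)
      x N ^+ (la i - c) * hshift N (m - j.+1) (c + (m - i.+1))
  = \sum_(la i.+1 + (m - i.+1) <= c < (la i + (m - i.+1)).+1)
      x N ^+ (la i + (m - i.+1) - c) * hshift N (m - j.+1) c.
  rewrite -addSn [RHS]big_addn addnK; apply: eq_bigr => c _.
  by rewrite subnDr.
(* The last row has nothing below it to subtract; since la_m = 0, its recursion is unrolled down to
   0. *)
rewrite shiftE; case: (ltnP i.+1 m) => im; last first.
  have ei : i.+1 = m by apply/eqP; rewrite eqn_leq im ltn_ord.
  rewrite big_pred0 => [|k]; last by rewrite ei ltn_eqF.
  by rewrite subr0 ei subnn lam !addn0 hshift_rec0.
rewrite (big_pred1 (Ordinal im)) //.
rewrite mxE /= /u.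
have e1 : (m - i.+1 = (m - i.+2).+1)%N by lia.
rewrite (@hshift_rec _ _ (la i.+1 + (m - i.+2)) (la i + (m - i.+1))); last first.
  by rewrite leq_add ?dec // e1.
have -> : (la i + (m - i.+1) - (la i.+1 + (m - i.+2)) = (la i - la i.+1).+1)%N.
  by have := dec i; lia.
by rewrite -addnS -e1 addrAC subrr add0r.
Qed.

End Rows.

Lemma det_sum_rows m (T : finType) (c : 'I_m -> T -> A) (F : 'I_m -> T -> 'I_m -> A) :
  \det (\matrix_(i, j) \sum_(b : T) c i b * F i b j)
  = \sum_(f : {ffun 'I_m -> T})
      (\prod_i c i (f i)) * \det (\matrix_(i, j) F i (f i) j).
Proof.
rewrite /determinant.
under [RHS]eq_bigr => f _ do rewrite mulr_sumr.
rewrite [RHS]exchange_big /=; apply: eq_bigr => s _.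
under eq_bigr => i _ do rewrite mxE.
rewrite bigA_distr_bigA mulr_sumr; apply: eq_bigr => f _.
rewrite mulrCA -big_split /=; congr (_ * _).
by apply: eq_bigr => i _; rewrite mxE.
Qed.

End JacobiTrudi.

(** * The branching rule shared by determinants and tableaux *)

Section Shapes.
Variables (m B : nat).
Implicit Types la mu : {ffun 'I_m -> 'I_B.+1}.

Definition row_len la (k : nat) : nat :=
  if insub k is Some i then la i else 0%N.

Definition is_shape la := [forall i : 'I_m, (row_len la i.+1 <= la i)%N].

Definition interlace mu la :=
  [forall i : 'I_m, (row_len la i.+1 <= mu i <= la i)%N].

Lemma row_len_ord la (i : 'I_m) : row_len la i = la i.
Proof. by rewrite /row_len valK. Qed.

Lemma row_len_out la k : (m <= k)%N -> row_len la k = 0%N.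
Proof. by move=> mk; rewrite /row_len insubF // ltnNge mk. Qed.

Lemma row_len_dec la k : is_shape la -> (row_len la k.+1 <= row_len la k)%N.
Proof.
move=> /forallP sh; case: (ltnP k m) => km; last by rewrite !row_len_out // leqW.
by have := sh (Ordinal km); rewrite -row_len_ord.
Qed.

Lemma row_len_mono la k l : is_shape la -> (k <= l)%N ->
  (row_len la l <= row_len la k)%N.
Proof.
move=> sh /subnK <-; elim: (l - k)%N => // d IH; rewrite addSn.
exact: leq_trans (row_len_dec _ sh) IH.
Qed.

Lemma interlace_shape mu la : interlace mu la -> is_shape la -> is_shape mu.
Proof.
move=> /forallP inter sh; apply/forallP => i.
case: (ltnP i.+1 m) => im; last by rewrite row_len_out.
rewrite -[i.+1]/(val (Ordinal im)) row_len_ord.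
have /andP[_ le1] := inter (Ordinal im); have /andP[le2 _] := inter i.
by apply: leq_trans le2; rewrite -[i.+1]/(val (Ordinal im)) row_len_ord.
Qed.

Variables (A : comNzRingType) (x : nat -> A).

(** After the elimination each row ranges over its own interval, independently of the others. By
    multilinearity in the rows the determinant splits into one term for each interlacing shape. *)
Lemma jt_rec N la : is_shape la ->
  jt x m N.+1 (row_len la)
  = \sum_(mu | interlace mu la) (\prod_i x N ^+ (la i - mu i)) * jt x m N (row_len mu).
Proof.
move=> sh; rewrite jt_eliminate ?row_len_out //; last first.
  by move=> i; apply: row_len_dec.
pose c (i : 'I_m) (b : 'I_B.+1) :=
  (row_len la i.+1 <= b <= la i)%N%:R * x N ^+ (la i - b).
pose F (i : 'I_m) (b : 'I_B.+1) (j : 'I_m) := hshift x N (m - j.+1) (b + (m - i.+1)).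
transitivity (\det (\matrix_(i, j) \sum_b c i b * F i b j)).
  congr (\det _); apply/matrixP => i j; rewrite !mxE row_len_ord.
  rewrite (big_nat_widen _ _ B.+1) // big_geq_mkord big_mkcond /=.
  apply: eq_bigr => b _; rewrite /c /F ?andTb ltnS andbC.
  by case: andb => /=; rewrite ?mul1r ?mul0r.
rewrite det_sum_rows [RHS]big_mkcond; apply: eq_bigr => mu _.
rewrite /c big_split /= -natr_prod; case: ifP => [/forallP inter|].
  rewrite big1 ?mul1r => [|i _]; last by rewrite inter.
  congr (_ * \det _); apply/matrixP => i j; rewrite !mxE row_len_ord //.
move=> /negbT/forallPn [i ninter].
by rewrite (bigD1 i) //= (negPf ninter) mul0n mul0r mul0r.
Qed.

(** Without variables the matrix is the identity for the empty shape, and its first row vanishes for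
    any other. *)
Lemma jt0 la : is_shape la ->
  jt x m 0 (row_len la) = [forall i, la i == 0%N :> nat]%:R.
Proof.
move=> sh; rewrite /jt.
have e (i j : 'I_m) : jt_mx x m 0 (row_len la) i j = (la i + j == i)%N%:R.
  rewrite mxE row_len_ord /hshift /=; have := ltn_ord i; have := ltn_ord j.
  move=> jm im; case: leqP => le /=; first by congr (_%:R); congr nat_of_bool; lia.
  by have -> : (la i + j == i)%N = false by lia.
case: forallP => [z|nz].
  rewrite (_ : jt_mx _ _ _ _ = 1%:M) ?det1 //; apply/matrixP => i j.
  by rewrite e (eqP (z i)) add0n mxE eq_sym.
have [i nzi] : exists i, la i != 0%N :> nat.
  by apply/existsP; rewrite -negb_forall; apply/negP => /forallP.
have im := ltn_ord i; have m0 : (0 < m)%N by lia.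
have la0 : (0 < la (Ordinal m0))%N.
  rewrite -row_len_ord (leq_trans _ (row_len_mono sh (leq0n i))) //.
  by rewrite row_len_ord lt0n.
rewrite (expand_det_row _ (Ordinal m0)) big1 // => j _.
by rewrite e addn_eq0 -leqn0 leqNgt la0 mul0r.
Qed.

End Shapes.

Lemma card_ord_prefix B (f : pred 'I_B) :
  (forall j j' : 'I_B, (j <= j')%N -> f j' -> f j) ->
  forall j : 'I_B, (j < #|f|)%N = f j.
Proof.
move=> dec j.
have cardlt a : (a <= B)%N -> #|[pred i : 'I_B | (i < a)%N]| = a.
  move=> aB; rewrite -sum1_card big_mkcond /=.
  transitivity (\sum_(i < B) (i < a))%N.
    by apply: eq_bigr => i _; rewrite inE; case: ifP.
  by rewrite sum_ord_lt; apply/minn_idPl.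
case fj: (f j).
  rewrite -{1}(cardlt _ (ltn_ord j)); apply: subset_leq_card.
  by apply/subsetP => i; rewrite !inE ltnS => /dec; apply.
apply/negbTE; rewrite -leqNgt -[X in (_ <= X)%N](cardlt _ (ltnW (ltn_ord j))).
apply: subset_leq_card; apply/subsetP => i fi; rewrite inE ltnNge.
by apply/negP => /dec /(_ fi); rewrite fj.
Qed.

Section BoxTableaux.
Variables (m B Q : nat).
Implicit Types la mu : {ffun 'I_m -> 'I_B.+1}.
(* Semistandard tableaux on an m x B box; a cell outside the shape holds ord_max. *)
Implicit Types T : {ffun 'I_m * 'I_B -> 'I_Q.+1}.

(** A fixed box keeps the type independent of the shape, so that shapes can vary in an induction on
    the number k of letters. Column strictness is relaxed at the filler. *)
Definition box_valid k la T :=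
  [&& [forall i, forall j : 'I_B, forall j' : 'I_B,
         (j <= j')%N ==> (T (i, j) <= T (i, j'))%N],
      [forall i : 'I_m, forall i' : 'I_m, forall j,
         (i < i')%N ==> (T (i, j) < T (i', j))%N || (T (i', j) == ord_max)]
    & [forall i, forall j : 'I_B,
         ((T (i, j) < k)%N == (j < la i)%N) && ((j < la i)%N || (T (i, j) == ord_max))]].

Lemma box_validP k la T : reflect
  [/\ forall i (j j' : 'I_B), (j <= j')%N -> (T (i, j) <= T (i, j'))%N,
      forall (i i' : 'I_m) j, (i < i')%N -> (T (i, j) < T (i', j))%N \/ T (i', j) = ord_max,
      forall i (j : 'I_B), (T (i, j) < k)%N = (j < la i)%N
    & forall i (j : 'I_B), (la i <= j)%N -> T (i, j) = ord_max]
  (box_valid k la T).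
Proof.
apply: (iffP and3P) => [[/forallP r /forallP c /forallP s]|[r c s o]].
  split.
  - by move=> i j j' jj; have /forallP/(_ j)/forallP/(_ j')/implyP/(_ jj) := r i.
  - move=> i i' j ii; have /forallP/(_ i')/forallP/(_ j)/implyP/(_ ii) := c i.
    by case/orP => [|/eqP]; [left | right].
  - by move=> i j; have /forallP/(_ j)/andP[/eqP] := s i.
  - move=> i j ij; have /forallP/(_ j)/andP[_] := s i.
    by rewrite ltnNge ij /= => /eqP.
split.
- by apply/forallP => i; apply/forallP => j; apply/forallP => j'; apply/implyP/r.
- apply/forallP => i; apply/forallP => i'; apply/forallP => j; apply/implyP => ii.
  by case: (c i i' j ii) => ->; rewrite ?eqxx ?orbT.
apply/forallP => i; apply/forallP => j; rewrite s eqxx /=.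
by case: ltnP => //= /o ->.
Qed.

Variables (A : comNzRingType) (x : nat -> A).

Definition box_sum k la : A :=
  \sum_(T | box_valid k la T) \prod_(c : 'I_m * 'I_B | (c.2 < la c.1)%N) x (T c).

Definition below k T : {ffun 'I_m -> 'I_B.+1} :=
  [ffun i => inord #|[pred j : 'I_B | (T (i, j) < k)%N]|].

Definition restrict k T : {ffun 'I_m * 'I_B -> 'I_Q.+1} :=
  [ffun c => if (T c < k)%N then T c else ord_max].

Definition extend k mu la T : {ffun 'I_m * 'I_B -> 'I_Q.+1} :=
  [ffun c : 'I_m * 'I_B => if (c.2 < mu c.1)%N then T c
            else if (c.2 < la c.1)%N then inord k else ord_max].

Lemma belowE k T i (j : 'I_B) :
  (forall i (j j' : 'I_B), (j <= j')%N -> (T (i, j) <= T (i, j'))%N) ->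
  (j < below k T i)%N = (T (i, j) < k)%N.
Proof.
move=> r; rewrite ffunE inordK; last by rewrite ltnS -[X in (_ <= X)%N](card_ord B) max_card.
rewrite (@card_ord_prefix _ [pred j : 'I_B | (T (i, j) < k)%N]) //= => j1 j2 j12.
exact: leq_ltn_trans (r _ _ _ j12).
Qed.

Lemma row_eq (a b : 'I_B.+1) : (forall j : 'I_B, (j < a)%N = (j < b)%N) -> a = b.
Proof.
move=> e; apply: val_inj => /=; have la := ltn_ord a; have lb := ltn_ord b.
by case: (ltngtP a b) => // ab;
  [have lt : (a < B)%N by lia | have lt : (b < B)%N by lia];
  have := e (Ordinal lt); rewrite /= ltnn ab.
Qed.

(** If row i had fewer letters below k than row i + 1 has cells, some column would hold a letter at
    least k in row i and at most k in row i + 1, against column strictness. *)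
Lemma below_interlace k la T : (k < Q)%N -> is_shape la ->
  box_valid k.+1 la T -> interlace (below k T) la.
Proof.
move=> kQ sh /box_validP[r c s o]; apply/forallP => i; apply/andP; split.
  case: (ltnP i.+1 m) => im; last by rewrite row_len_out.
  rewrite -[i.+1]/(val (Ordinal im)) row_len_ord leqNgt; apply/negP => lt.
  have ltB : (below k T i < B)%N.
    by apply: leq_trans lt _; rewrite -ltnS ltn_ord.
  pose j := Ordinal ltB.
  have := belowE k i j r; rewrite ltnn => /esym/negbT; rewrite -leqNgt => kT.
  have : (T (Ordinal im, j) < k.+1)%N by rewrite s.
  have [|lt'|e] := c i (Ordinal im) j; first by rewrite /=.
    by rewrite ltnS leqNgt (leq_ltn_trans kT).
  by rewrite e /=; lia.
rewrite leqNgt; apply/negP => lt.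
have ltB : (la i < B)%N by apply: leq_trans lt _; rewrite -ltnS ltn_ord.
have := belowE k i (Ordinal ltB) r; rewrite /= lt => /esym Tk.
by have := s i (Ordinal ltB); rewrite /= ltnn ltnS (ltnW Tk).
Qed.

Lemma restrict_valid k la T : (k < Q)%N ->
  box_valid k.+1 la T -> box_valid k (below k T) (restrict k T).
Proof.
move=> kQ /box_validP[r c s o]; apply/box_validP; split.
- move=> i j j' /(r i) le; rewrite !ffunE; case: ltnP => // kT.
    by case: ifP => // _; rewrite -ltnS ltn_ord.
  by rewrite ltnNge (leq_trans kT le).
- move=> i i' j ii; rewrite !ffunE; case: (ltnP (T (i', j)) k) => T'k; last by right.
  by left; case: (c i i' j ii) => [lt|e]; [rewrite (ltn_trans lt T'k) | move: T'k; rewrite e /=; lia].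
- by move=> i j; rewrite belowE // ffunE; case: (ltnP (T (i, j)) k) => // _; apply/negbTE; rewrite -leqNgt ltnW.
move=> i j; rewrite leqNgt belowE // ffunE => /negbTE -> //.
Qed.

Lemma extend_valid k mu la T : (k < Q)%N -> is_shape la -> interlace mu la ->
  box_valid k mu T -> box_valid k.+1 la (extend k mu la T).
Proof.
move=> kQ sh /forallP inter /box_validP[r c s o].
have mula i : (mu i <= la i)%N by case/andP: (inter i).
have ik : @inord Q k = k :> nat by rewrite inordK // ltnW.
have lQ (a : 'I_Q.+1) : (a <= Q)%N by rewrite -ltnS ltn_ord.
apply/box_validP; split.
- move=> i j j' le; rewrite !ffunE /=; case: (ltnP j (mu i)) => jm.
    case: ifP => [_|_]; first exact: r.
    have Tk : (T (i, j) < k)%N by rewrite s.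
    by case: ifP => _; [rewrite ik ltnW | exact: lQ].
  rewrite [(j' < mu i)%N]ltnNge (leq_trans jm le) /=.
  case: (ltnP j (la i)) => jl; first by case: ifP => _; [rewrite ik | exact: lQ].
  by rewrite ltnNge (leq_trans jl le).
- move=> i i' j ii; rewrite !ffunE /=.
  have mui : (row_len la i.+1 <= mu i)%N by case/andP: (inter i).
  have lai : (la i' <= mu i)%N.
    by apply: leq_trans mui; rewrite -row_len_ord row_len_mono.
  case: (ltnP j (mu i')) => jm.
    have jmi : (j < mu i)%N by apply: leq_trans jm (leq_trans (mula _) lai).
    by rewrite jmi; apply: c.
  case: (ltnP j (la i')) => jl; last by right.
  by left; rewrite (leq_trans jl lai) ik s (leq_trans jl lai).
- move=> i j; rewrite ffunE /=; case: (ltnP j (mu i)) => jm.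
    by rewrite (leq_trans jm (mula i)) ltnS ltnW // s.
  by case: (ltnP j (la i)) => jl; rewrite ?ik ?ltnSn //=; apply/negbTE; rewrite -leqNgt.
move=> i j jl; rewrite ffunE /= !ltnNge (leq_trans (mula i) jl) jl //.
Qed.

Lemma extendK k mu la T : (k < Q)%N -> interlace mu la -> box_valid k mu T ->
  restrict k (extend k mu la T) = T.
Proof.
move=> kQ inter /box_validP[r c s o]; apply/ffunP => -[i j]; rewrite !ffunE /=.
case: (ltnP j (mu i)) => jm; first by rewrite s jm.
rewrite (o i j jm); case: (ltnP j (la i)) => _; last by case: ifP.
by rewrite inordK ?ltnn // ltnW.
Qed.

Lemma below_extend k mu la T : (k < Q)%N -> is_shape la -> interlace mu la ->
  box_valid k mu T -> below k (extend k mu la T) = mu.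
Proof.
move=> kQ sh inter vT; have /box_validP[r _ _ _] := extend_valid kQ sh inter vT.
have /box_validP[_ _ s _] := vT.
apply/ffunP => i; apply: row_eq => j; rewrite belowE // ffunE /=.
case: ifP => jm; first by rewrite s jm.
by case: ifP => _; rewrite ?inordK ?ltnn //=; lia.
Qed.

Lemma restrictK k la T : (k < Q)%N -> box_valid k.+1 la T ->
  extend k (below k T) la (restrict k T) = T.
Proof.
move=> kQ /box_validP[r c s o]; apply/ffunP => -[i j]; rewrite !ffunE -/(below k T).
have := belowE k i j r; rewrite ffunE /= => ->.
case: ltnP => kT //; have := s i j; case: (ltnP j (la i)) => jl.
  rewrite ltnS => Tk; apply: val_inj; rewrite /= inordK; last exact: ltnW.
  by apply/eqP; rewrite eqn_leq kT Tk.
by rewrite o.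
Qed.

(** Tableaux are grouped by the subshape of their letters below k; the remaining cells form a
    horizontal strip, filled with the letter k in exactly one way. *)
Lemma box_sum_rec k la : (k < Q)%N -> is_shape la ->
  box_sum k.+1 la = \sum_(mu | interlace mu la)
      (\prod_i x k ^+ (la i - mu i)) * box_sum k mu.
Proof.
move=> kQ sh; rewrite /box_sum.
rewrite (partition_big (below k) (fun mu => interlace mu la)) /=; last first.
  by move=> T; apply: below_interlace.
apply: eq_bigr => mu inter; rewrite mulr_sumr.
rewrite (reindex_onto (extend k mu la) (restrict k)) /=; last first.
  by move=> T /andP[vT /eqP <-]; apply: restrictK.
apply: eq_big => [T|T /andP[/andP[vT /eqP bT] /eqP rT]].
  apply/idP/idP => [/andP[/andP[vT /eqP bT] /eqP rT]|vT].
    by have := restrict_valid kQ vT; rewrite bT rT.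
  by rewrite extend_valid // below_extend // extendK // !eqxx.
have vT' : box_valid k mu T by have := restrict_valid kQ vT; rewrite bT rT.
have /box_validP[_ _ s _] := vT'.
have mula i : (mu i <= la i)%N by have /forallP/(_ i)/andP[] := inter.
rewrite (bigID (fun c : 'I_m * 'I_B => (c.2 < mu c.1)%N)) /= mulrC; congr (_ * _).
  have -> : \prod_i x k ^+ (la i - mu i)
    = \prod_(i < m) \prod_(j < B | (j < la i)%N && ~~ (j < mu i)%N) x k.
    apply: eq_bigr => i _; rewrite prodr_const; congr (_ ^+ _).
    rewrite -sum1_card big_mkcond /=.
    have -> : \sum_(j < B) (if (j \in [pred j : 'I_B | (j < la i) && ~~ (j < mu i)]) then 1 else 0)%N
      = (\sum_(j < B) (j < la i) - \sum_(j < B) (j < mu i))%N.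
      apply/eqP; rewrite -(eqn_add2r (\sum_(j < B) (j < mu i))) subnK.
        rewrite -big_split /=; apply/eqP; apply: eq_bigr => j _; rewrite inE.
        have := mula i; case: (ltnP j (mu i)); case: (ltnP j (la i)) => //=; lia.
      by apply: leq_sum => j _; have := mula i; case: (ltnP j (mu i)); case: (ltnP j (la i)) => //=; lia.
    rewrite !sum_ord_lt; have := ltn_ord (la i); have := ltn_ord (mu i); lia.
  rewrite pair_big_dep /=; apply: eq_big => [[i j]|[i j]] //=.
  by move=> /andP[jl jm]; rewrite ffunE /= (negPf jm) jl inordK // ltnW.
apply: eq_big => [[i j]|[i j]] /=.
  by apply/andP/idP => [[]//|jm]; rewrite jm (leq_trans jm (mula i)).
by move=> /andP[_ jm]; rewrite ffunE /= jm.
Qed.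

Lemma box_sum0 la : box_sum 0 la = [forall i, la i == 0%N :> nat]%:R.
Proof.
rewrite /box_sum; case: forallP => [z|nz].
  rewrite (big_pred1 [ffun=> ord_max]) => [|T].
    by rewrite big1 // => -[i j] /=; rewrite (eqP (z i)).
  apply/box_validP/eqP => [[_ _ _ o]|->].
    by apply/ffunP => -[i j]; rewrite ffunE o // (eqP (z i)).
  split=> *; rewrite ?ffunE //; first by right.
  by rewrite (eqP (z _)) !ltn0.
rewrite big_pred0 // => T; apply/negbTE/negP => /box_validP[_ _ s _].
apply: nz => i; rewrite -leqn0 leqNgt; apply/negP => la0.
have B0 : (0 < B)%N by apply: leq_trans la0 _; rewrite -ltnS ltn_ord.
by have := s i (Ordinal B0); rewrite la0 ltn0.
Qed.

Theorem box_sum_jt k la : (k <= Q)%N -> is_shape la ->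
  box_sum k la = jt x m k (row_len la).
Proof.
elim: k la => [|k IH] la kQ sh; first by rewrite box_sum0 jt0.
rewrite box_sum_rec // jt_rec //; apply: eq_bigr => mu inter.
by rewrite IH ?(ltnW kQ) // (interlace_shape inter).
Qed.

End BoxTableaux.

Section Schur.
Variables (R : comNzRingType) (n : nat) (la : intpart n) (N : nat).

Definition mvar (i : nat) : {mpoly R[N]} := if insub i is Some j then 'X_j else 0.

Lemma mvar_ord (i : 'I_N) : mvar i = 'X_i.
Proof. by rewrite /mvar valK. Qed.

Definition part_shape : {ffun 'I_n -> 'I_n.+1} :=
  [ffun i : 'I_n => inord (nth 0%N (parts la) i)].

Lemma nth_parts_le i : (nth 0%N (parts la) i <= n)%N.
Proof.
case: (ltnP i (size (parts la))) => si; last by rewrite nth_default.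
rewrite -[X in (_ <= X)%N](sumn_parts la) sumn_big.
by rewrite (big_nth 0%N) (bigD1_seq i) ?leq_addr ?iota_uniq //= mem_index_iota.
Qed.

Lemma part_shapeE (i : 'I_n) : part_shape i = nth 0%N (parts la) i :> nat.
Proof. by rewrite ffunE inordK // ltnS nth_parts_le. Qed.

Lemma row_len_part_shape i : row_len part_shape i = nth 0%N (parts la) i.
Proof.
case: (ltnP i n) => lt; first by rewrite -[i]/(val (Ordinal lt)) row_len_ord part_shapeE.
by rewrite row_len_out // nth_default // (leq_trans (size_parts la)).
Qed.

Lemma nth_parts_dec i : (nth 0%N (parts la) i.+1 <= nth 0%N (parts la) i)%N.
Proof.
case: (ltnP i.+1 (size (parts la))) => si; last by rewrite nth_default.
by have /(sortedP 0%N) /(_ i si) := parts_sorted la.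
Qed.

Lemma part_shape_shape : is_shape part_shape.
Proof. by apply/forallP => i; rewrite row_len_part_shape part_shapeE nth_parts_dec. Qed.

Definition to_box (U : {ffun cell la -> 'I_N}) : {ffun 'I_n * 'I_n -> 'I_N.+1} :=
  [ffun c => if insub c is Some y then widen_ord (leqnSn N) (U y) else ord_max].

Lemma to_box_cell U (y : cell la) : to_box U (val y) = U y :> nat.
Proof. by rewrite ffunE valK. Qed.

Lemma to_box_out U (c : 'I_n * 'I_n) : (nth 0%N (parts la) c.1 <= c.2)%N -> to_box U c = ord_max.
Proof. by move=> h; rewrite ffunE insubF // ltnNge h. Qed.

Lemma to_box_inj : injective to_box.
Proof.
by move=> U V e; apply/ffunP => y; apply: val_inj; rewrite /= -!to_box_cell e.
Qed.

Lemma to_box_in U (i j : 'I_n) (h : (j < nth 0%N (parts la) i)%N) :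
  to_box U (i, j) = U (exist _ (i, j) h) :> nat.
Proof. exact: (to_box_cell U (exist _ (i, j) h)). Qed.

Lemma nth_parts_mono i i' : (i <= i')%N ->
  (nth 0%N (parts la) i' <= nth 0%N (parts la) i)%N.
Proof.
by move=> ii; rewrite -!row_len_part_shape row_len_mono // part_shape_shape.
Qed.

Lemma to_box_valid U : semistandard U -> box_valid N part_shape (to_box U).
Proof.
move=> /forallP ss; apply/box_validP.
have in_lt (i j : 'I_n) (h : (j < nth 0%N (parts la) i)%N) : (to_box U (i, j) < N)%N.
  by rewrite (to_box_in U h).
split.
- move=> i j j'; rewrite leq_eqVlt => /predU1P[/val_inj -> //|jj].
  case: (ltnP j' (nth 0%N (parts la) i)) => h'; last first.
    by rewrite (@to_box_out U (i, j')) //= -ltnS ltn_ord.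
  have h := ltn_trans jj h'; rewrite (to_box_in U h) (to_box_in U h').
  have /forallP /(_ (exist _ (i, j') h')) /andP[/implyP + _] := ss (exist _ (i, j) h).
  by apply; rewrite /= eqxx.
- move=> i i' j ii; case: (ltnP j (nth 0%N (parts la) i')) => h'; last first.
    by right; apply: to_box_out.
  have h := leq_trans h' (nth_parts_mono (ltnW ii)).
  left; rewrite (to_box_in U h) (to_box_in U h').
  have /forallP /(_ (exist _ (i', j) h')) /andP[_ /implyP] := ss (exist _ (i, j) h).
  by apply; rewrite /= eqxx.
- move=> i j; rewrite part_shapeE; case: (ltnP j (nth 0%N (parts la) i)) => h; first exact: in_lt.
  by rewrite to_box_out // ltnn.
by move=> i j; rewrite part_shapeE => h; apply: to_box_out.
Qed.

Lemma to_box_surj T : box_valid N part_shape T ->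
  exists2 U, semistandard U & T = to_box U.
Proof.
move=> /box_validP[r c s o].
have lt (y : cell la) : (T (val y) < N)%N.
  by case: y => -[i j] /= h; rewrite s part_shapeE.
exists [ffun y => Ordinal (lt y)].
  apply/forallP => -[[i j] h]; apply/forallP => -[[i' j'] h'] /=.
  rewrite !ffunE /=; apply/andP; split; apply/implyP => /andP[/eqP e l].
    by rewrite /= in e *; rewrite -e r // ltnW.
  rewrite /= in e *; rewrite -e; case: (c i i' j l) => // e'.
  by have := lt (exist _ (i', j') h'); rewrite /= -e e' /= ltnn.
apply/ffunP => -[i j]; apply: val_inj.
case: (ltnP j (nth 0%N (parts la) i)) => h.
  by rewrite [RHS](to_box_in _ h) ffunE.
by rewrite to_box_out // o // part_shapeE.
Qed.

(** The definition of [schur] indexes tableaux by the subtype of cells. [to_box] transports them to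
    the n x n box, where the additional letter N is the filler. *)
Lemma schur_jt : schur R la N = jt mvar n N (row_len part_shape).
Proof.
rewrite -(@box_sum_jt n n N) ?part_shape_shape // /box_sum.
rewrite (eq_bigl (mem (to_box @: [set U | semistandard U]))); last first.
  move=> T; apply/idP/imsetP => [/to_box_surj [U sU ->]|[U + ->]].
    by exists U; rewrite ?inE.
  by rewrite inE => /to_box_valid.
rewrite big_imset /=; last by move=> U V _ _; apply: to_box_inj.
apply: eq_big => [U|U _]; first by rewrite inE.
rewrite (reindex_omap (fun y : cell la => val y) insub) /=.
  apply: eq_big => [y|y _]; last by rewrite to_box_cell mvar_ord.
  by rewrite valK eqxx andbT part_shapeE; case: y.
by move=> c; rewrite part_shapeE => h; case: insubP => [y _ /= -> //|]; rewrite h.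
Qed.

End Schur.

Lemma sumn_take_ord n r t : (size t <= n)%N ->
  sumn (take r t) = (\sum_(i < n | i < r) nth 0 t i)%N.
Proof.
move=> szn; have -> : take r t = take (minn r n) t.
  by case: (leqP r n) => // /ltnW nr; rewrite !take_oversize ?(leq_trans szn).
rewrite sumn_take_nth (big_ord_widen n (fun i => nth 0%N t i)) ?geq_minr //.
by apply: eq_bigl => i; rewrite leq_min ltn_ord andbT.
Qed.

Lemma sumn_take_pos r t :
  (sumn (take r t) <= sumn (take r [seq k <- t | (0 < k)%N]))%N.
Proof.
elim: t r => [|[|k] t IH] [|r] //=; last by rewrite leq_add2l.
apply: leq_trans (IH r) _; rewrite !sumn_take_nth big_ord_recr /= leq_addr //.
Qed.

(** The values of s on the prefix are distinct. Sorting them is avoided by the truncated differences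
    r - s i, whose total over all i does not depend on s. *)
Lemma sum_perm_prefix n (s : 'S_n) r :
  (\sum_(i < n | i < r) i <= \sum_(i < n | i < r) s i)%N.
Proof.
have e : (\sum_(i < n) (r - s i) = \sum_(i < n | i < r) (r - i))%N.
  rewrite [RHS]big_mkcond [RHS](reindex_inj (@perm_inj _ s)); apply: eq_bigr => i _.
  by case: ltnP => // /eqP ->.
have le : (\sum_(i < n | i < r) (r - s i) <= \sum_(i < n) (r - s i))%N.
  by rewrite [X in (_ <= X)%N](bigID (fun i : 'I_n => (i < r)%N)) leq_addr.
have e1 : (\sum_(i < n | i < r) i + \sum_(i < n | i < r) (r - i) =
           \sum_(i < n | i < r) r)%N.
  by rewrite -big_split; apply: eq_bigr => i /= ir; lia.
have e2 : (\sum_(i < n | i < r) r <=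
  \sum_(i < n | i < r) s i + \sum_(i < n | i < r) (r - s i))%N.
  by rewrite -big_split; apply: leq_sum => i _ /=; lia.
by rewrite -(leq_add2r (\sum_(i < n | i < r) (r - i))%N) e1 (leq_trans e2) // leq_add2l -e.
Qed.

Section SchurH.
Variables (K : fieldType) (kap : {rmorphism rat -> K}).

Lemma hcomp_complete_sym N k : hcomp (mvar K N) N k = complete_sym K k N.
Proof.
rewrite (complete_symE kap).
apply: isexpE; apply: isexp_ext (isexp_hcomp (mvar K N) N) => [i|//].
by apply: eq_bigr => j _; rewrite mvar_ord.
Qed.

Lemma complete_sym0 N : complete_sym K 0 N = 1.
Proof. exact: (isexp_complete_sym K N).1. Qed.

Definition jt_index n (la : intpart n) (s : 'S_n) (i : 'I_n) : nat :=
  (nth 0%N (parts la) i + s i - i)%N.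

Lemma prod_pos_parts N (l : seq nat) :
  \prod_(k <- l) complete_sym K k N
    = \prod_(k <- [seq k <- l | (0 < k)%N]) complete_sym K k N.
Proof.
rewrite big_filter [RHS]big_mkcond; apply: eq_bigr => -[|k] _ //.
by rewrite complete_sym0.
Qed.

(* Jacobi-Trudi: the term of a permutation s is a product of h_k with
   k = la_i + s(i) - i, and the sum of the first r of these is at least
   la_1 + ... + la_r. *)
Lemma jt_term n (la : intpart n) (s : 'S_n) :
  exists b : bool, exists ka : intpart n,
    (b -> dominated (parts la) (parts ka)) /\
    forall N, \prod_i jt_mx (mvar K N) n N (row_len (part_shape la)) i (s i)
      = if b then hbasis K ka N else 0.
Proof.
have entry N (i : 'I_n) :
    jt_mx (mvar K N) n N (row_len (part_shape la)) i (s i)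
  = if (i <= nth 0%N (parts la) i + s i)%N then complete_sym K (jt_index la s i) N
    else 0.
  rewrite mxE /hshift row_len_part_shape hcomp_complete_sym /jt_index.
  have := ltn_ord i; have := ltn_ord (s i) => hs hi.
  have -> : (n - (s i).+1 <= nth 0 (parts la) i + (n - i.+1))%N
          = (i <= nth 0 (parts la) i + s i)%N by lia.
  case: ifP => // le; apply: (congr1 (fun k => complete_sym K k N)); lia.
(* A negative index gives a zero entry and hence a zero term; [la] then serves as a dummy
   partition. *)
have [/forallP ok|nok] := boolP [forall i : 'I_n, (i <= nth 0%N (parts la) i + s i)%N]; last first.
  exists false, la; split=> // N; move: nok; rewrite negb_forall => /existsP[i ni].
  by rewrite (bigD1 i) //= entry (negPf ni) mul0r.
pose l := [seq jt_index la s i | i <- enum 'I_n].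
have szl : size l = n by rewrite size_map size_enum_ord.
have nthl (i : 'I_n) : nth 0%N l i = jt_index la s i.
  by rewrite (nth_map i) ?size_enum_ord // nth_ord_enum.
have addl r : (\sum_(i < n | i < r) nth 0 l i + \sum_(i < n | i < r) i
             = \sum_(i < n | i < r) nth 0 (parts la) i + \sum_(i < n | i < r) s i)%N.
  rewrite -!big_split; apply: eq_bigr => i _ /=.
  by rewrite nthl /jt_index subnK.
have sums r : (sumn (take r (parts la)) <= sumn (take r l))%N.
  rewrite !(@sumn_take_ord n) ?szl ?size_parts //.
  by rewrite -(leq_add2r (\sum_(i < n | i < r) s i)%N) -addl leq_add2l sum_perm_prefix.
have suml : sumn l = n.
  rewrite -[l]take_size szl (@sumn_take_ord n) ?szl //; have := addl n.
  rewrite -(@sumn_take_ord n n (parts la)) ?size_parts // take_oversize ?size_parts //.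
  rewrite sumn_parts; have -> : (\sum_(i < n | i < n) s i = \sum_(i < n | i < n) i)%N.
    rewrite [RHS](reindex_inj (@perm_inj _ s)).
    by apply: eq_bigl => i; rewrite !ltn_ord.
  by move/addIn.
have [|ka pka] := @ipart_exist n [seq k <- l | (0 < k)%N] _ (filter_all _ _).
  by rewrite sumn_filter_pos.
exists true, ka; split=> [_ r|N].
  apply: leq_trans (sums r) (leq_trans (sumn_take_pos r l) _).
  by apply: sumn_take_sorted; rewrite ?parts_sorted // perm_sym.
rewrite /hbasis (perm_big _ pka) -prod_pos_parts big_map big_enum /=.
by apply: eq_bigr => i _; rewrite entry ok.
Qed.

Lemma schur_hbasis n (la : intpart n) :
  exists d : intpart n -> K,
    (forall ka, d ka != 0 -> dominated (parts la) (parts ka)) /\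
    (forall N, schur K la N = lincomb d (@hbasis K n) N).
Proof.
have [b] := fin_all_exists (jt_term la); move/fin_all_exists => [ka jtE].
exists (fun mu => \sum_(s | b s && (ka s == mu)) (-1) ^+ s); split=> [mu|N].
  move=> ne; have [s /andP[bs /eqP <-]] : exists s, b s && (ka s == mu).
    apply/existsP; apply: contraR ne; rewrite negb_exists => /forallP no.
    by rewrite big_pred0 // => s; apply/negbTE.
  exact: (jtE s).1.
rewrite schur_jt /jt /determinant /lincomb.
under [RHS]eq_bigr => mu _ do rewrite scaler_suml.
rewrite (exchange_big_dep b) /=; last by move=> mu s _ /andP[].
rewrite [RHS]big_mkcond; apply: eq_bigr => s _ /=; rewrite (jtE s).2.
case: ifP => bs; last by rewrite mulr0.
rewrite (big_pred1 (ka s)) => [|mu]; last by rewrite eq_sym.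
exact: sign_scale.
Qed.

End SchurH.

(** * Bialternants and the Pieri rule *)

Section Alternants.
Variables (K : fieldType) (kap : {rmorphism rat -> K}) (n : nat).
Local Notation P := {mpoly K[n]}.

Definition alternant (l : 'I_n -> nat) : P := \det (\matrix_(i < n, j < n) 'X_j ^+ l i).

Definition delta (i : 'I_n) : nat := (n - i.+1)%N.

Definition omit (k : 'I_n) : {poly P} := \prod_(j < n | j != k) (1 + - 'X_j *: 'X).

Lemma size_omit k : (size (omit k) <= n)%N.
Proof.
have le : (size (omit k) <= (\sum_(j < n | j != k) 1).+1)%N.
  rewrite /omit; apply: (big_rec2 (fun (a : {poly P}) (b : nat) => (size a <= b.+1)%N)).
    by rewrite size_poly1.
  move=> j a p _ le; apply: leq_trans (size_polyMleq _ _) _.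
  have : (size (1 + - 'X_j *: 'X : {poly P})%R <= 2)%N.
    apply: leq_trans (size_polyD _ _) _; rewrite geq_max size_poly1 /=.
    by apply: leq_trans (size_scale_leq _ _) _; rewrite size_polyX.
  by move=> le2; rewrite -subn1 leq_subLR; apply: leq_trans (leq_add le2 le) _; rewrite !addSn.
apply: leq_trans le _; rewrite sum1_card cardC1 card_ord prednK //.
exact: leq_ltn_trans (leq0n k) (ltn_ord k).
Qed.

(** Multiplying \sum_b h_b z^b by \prod_(j != k) (1 - x_j z) leaves 1 / (1 - x_k z). As [omit k] has
    degree less than n, the n values of [delta] reach all its coefficients. *)
Lemma omit_hcomp (k : 'I_n) b :
  \sum_(j < n) hshift (mvar K n) n (delta j) b * (omit k)`_(delta j) = 'X_k ^+ b.
Proof.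
have e : isexp (fun i => 'X_k ^+ i : P) (conv (fun q => (omit k)`_q) (hcomp (mvar K n) n)).
  apply: isexp_ext (isexp_conv (isexp_prod_linear (fun j => j != k)
    (fun j : 'I_n => - 'X_j : P)) (isexp_hcomp (mvar K n) n)) => [i|//].
  rewrite [X in _ + X](bigD1 k) //= mvar_ord addrCA -[RHS]addr0; congr (_ + _).
  rewrite -big_split big1 //= => j _; rewrite mvar_ord /altpow /= [(- 'X_j) ^+ _]exprNn.
  by rewrite mulrA -exprD addnS addnn -mul2n exprS exprM sqrrN !expr1n mulr1 mulN1r addNr.
rewrite (isexpE kap b (isexp_powers ('X_k : P))) -(isexpE kap b e) /conv.
rewrite (reindex_inj rev_ord_inj) /=.
have -> : \sum_(i < b.+1) (omit k)`_i * hcomp (mvar K n) n (b - i)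
  = \sum_(0 <= q < maxn b.+1 n) (omit k)`_q * hshift (mvar K n) n q b.
  rewrite big_mkord (big_ord_widen _ (fun i => (omit k)`_i * hcomp (mvar K n) n (b - i)) (leq_maxl b.+1 n)).
  rewrite big_mkcond; apply: eq_bigr => i _; rewrite /hshift ltnS.
  by case: ifP; rewrite ?mulr0.
rewrite (@big_cat_nat _ _ _ n) ?leq_maxr //= [X in _ = _ + X]big_nat [X in _ = _ + X]big1 ?addr0; last first.
  by move=> q /andP[nq _]; rewrite nth_default ?mul0r // (leq_trans (size_omit k)).
rewrite big_mkord; apply: eq_bigr => i _; rewrite mulrC /delta /=.
have -> // : (n - (n - i.+1).+1)%N = i by have := ltn_ord i; lia.
Qed.

Definition omit_mx : 'M[P]_n := \matrix_(j, k) (omit k)`_(delta j).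

Lemma alternant_jt (la : nat -> nat) :
  alternant (fun i => la i + delta i)%N = jt (mvar K n) n n la * \det omit_mx.
Proof.
rewrite /jt -det_mulmx; congr (\det _); apply/matrixP => i k; rewrite !mxE.
by rewrite -omit_hcomp; apply: eq_bigr => j _; rewrite !mxE.
Qed.

Lemma jt_empty : jt (mvar K n) n n (fun=> 0%N) = 1.
Proof.
rewrite /jt -det_tr det_trig.
  by rewrite big1 // => i _; rewrite !mxE /hshift add0n leqnn subnn hcomp0.
apply/is_trig_mxP => i j ij; rewrite !mxE /hshift add0n.
have jn := ltn_ord j; have in_ := ltn_ord i.
by have -> : (n - i.+1 <= n - j.+1)%N = false by lia.
Qed.

(** The factor [\det omit_mx] does not depend on the shape. The empty shape, whose Jacobi-Trudi
    matrix is unitriangular, identifies it with [alternant delta]. *)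
Lemma alternant_schur (la : intpart n) :
  alternant (fun i => nth 0 (parts la) i + delta i)%N = alternant delta * schur K la n.
Proof.
have -> : alternant delta = \det omit_mx.
  by rewrite -[RHS]mul1r -jt_empty -alternant_jt; congr (\det _); apply/matrixP => i j; rewrite !mxE.
rewrite alternant_jt mulrC.
congr (_ * _); rewrite schur_jt; congr (\det _); apply/matrixP => i j.
by rewrite !mxE row_len_part_shape.
Qed.

Lemma alternant_delta_neq0 : alternant delta != 0.
Proof.
pose s : 'S_n := perm (@rev_ord_inj n).
have -> : alternant delta = \det (row_perm s (Vandermonde n (\row_j 'X_j))).
  congr (\det _); apply/matrixP => i j; rewrite !mxE permE /=; congr (_ ^+ _).
rewrite row_permE det_mulmx det_perm mulf_neq0 ?signr_eq0 // det_Vandermonde.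
apply/prodf_neq0 => i _; apply/prodf_neq0 => j ij; rewrite !mxE subr_eq0.
apply/eqP => /(congr1 (mcoeff U_(i)))/eqP; rewrite !mcoeffXU eqxx.
have -> : (j == i) = false by apply/eqP => e; rewrite e ltnn in ij.
by rewrite eq_sym oner_eq0.
Qed.

Definition decr (f : {ffun 'I_n -> nat}) :=
  [forall i : 'I_n, forall j : 'I_n, (j == i.+1 :> nat) ==> (f j <= f i)%N].

Definition add_strip (f : {ffun 'I_n -> nat}) (D : {set 'I_n}) : {ffun 'I_n -> nat} :=
  [ffun i => f i + (i \in D)]%N.

(** In the term of a permutation s, the subset chosen in e_k is written as the image of D under s;
    its variables then raise by one the exponents of the rows in D. *)
Lemma mesym_alternant k (l : 'I_n -> nat) :
  mesym n K k * alternant l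
    = \sum_(D : {set 'I_n} | #|D| == k) alternant (fun i => l i + (i \in D))%N.
Proof.
rewrite /alternant /determinant exchange_big mulr_sumr /=; apply: eq_bigr => s _.
rewrite mulrCA -mulr_sumr; congr (_ * _).
rewrite /mesym mulr_suml (reindex_inj (imset_inj (@perm_inj _ s))) /=.
apply: eq_big => [D|D _]; first by rewrite card_imset //; apply: perm_inj.
rewrite big_imset /=; last by move=> i j _ _; apply: perm_inj.
rewrite big_mkcond -big_split /=; apply: eq_bigr => i _; rewrite !mxE exprD mulrC.
by case: (i \in D).
Qed.

(** A vertical strip breaks the order only when f i = f j for consecutive i, j with j in D and i
    outside D; rows i and j of the alternant then coincide. *)
Lemma alternant_not_decr f D : decr f -> ~~ decr (add_strip f D) ->
  alternant (fun i => f i + delta i + (i \in D))%N = 0.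
Proof.
move=> /forallP df /forallPn[i /forallPn[j]]; rewrite negb_imply => /andP[/eqP ji].
rewrite -ltnNge !ffunE => lt; have /forallP/(_ j)/implyP := df i; rewrite ji eqxx.
move=> /(_ isT) le.
have ij : i != j by apply/eqP => e; rewrite e in ji; lia.
apply: (determinant_alternate ij) => k; rewrite !mxE; congr (_ ^+ _).
rewrite /delta ji; have := ltn_ord j; rewrite ji.
by move: lt; case: (i \in D); case: (j \in D); rewrite /=; lia.
Qed.

Lemma pieri_chain (s : seq nat) :
  exists L : seq {ffun 'I_n -> nat},
    (forall f, f \in L -> decr f /\ (\sum_i f i = sumn s)%N) /\
    alternant delta * \prod_(k <- s) mesym n K k
      = \sum_(f <- L) alternant (fun i => f i + delta i)%N.
Proof.
elim: s => [|k s [L [wf e]]].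
  exists [:: [ffun=> 0%N]]; split=> [f|].
    rewrite inE => /eqP ->; split; last by rewrite big1 // => i _; rewrite ffunE.
    by apply/forallP => i; apply/forallP => j; rewrite !ffunE implybT.
  rewrite big_nil big_seq1 mulr1; congr (\det _).
  by apply/matrixP => i j; rewrite !mxE ffunE add0n.
pose Ss f := [seq D : {set 'I_n} <- index_enum _ | (#|D| == k) && decr (add_strip f D)].
exists (flatten [seq [seq add_strip f D | D <- Ss f] | f <- L]); split.
  move=> g /flattenP[_ /mapP[f fL ->] /mapP[D + ->]].
  rewrite mem_filter => /andP[/andP[/eqP cS dS] _]; split=> //.
  have [_ sf] := wf f fL; rewrite /= -sf -cS addnC.
  rewrite -sum1_card [X in (_ + X)%N]big_mkcond -big_split /=.
  by apply: eq_bigr => i _; rewrite ffunE; case: (i \in D).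
rewrite big_cons mulrCA e mulr_sumr big_flatten big_map !big_seq.
apply: eq_bigr => f fL; have [df _] := wf f fL.
rewrite mesym_alternant big_map big_filter (bigID (fun D => decr (add_strip f D))) /=.
rewrite [X in _ + X]big1 ?addr0 => [|D /andP[_ nd]]; last exact: alternant_not_decr.
apply: eq_bigr => D _; congr (\det _); apply/matrixP => i j; rewrite !mxE ffunE.
by rewrite addnAC.
Qed.

Lemma decr_part (f : {ffun 'I_n -> nat}) : decr f -> (\sum_i f i = n)%N ->
  exists la : intpart n, forall i : 'I_n, nth 0%N (parts la) i = f i.
Proof.
move=> df sf; pose t := [seq f i | i <- enum 'I_n].
have szt : size t = n by rewrite size_map size_enum_ord.
have nt (i : 'I_n) : nth 0%N t i = f i.
  by rewrite (nth_map i) ?size_enum_ord // nth_ord_enum.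
have st : sorted geq t.
  apply/(sortedP 0%N) => i; rewrite szt => lt.
  have /forallP/(_ (Ordinal (ltnW lt)))/forallP/(_ (Ordinal lt)) := df.
  by rewrite eqxx /= -!nt.
have [||| la e] := @parts_exist n [seq k <- t | (0 < k)%N].
- by rewrite sumn_filter_pos sumn_big big_map big_enum.
- exact: sorted_filter geq_trans _ _ st.
- exact: filter_all.
exists la => i; rewrite e -nt [in RHS](sorted_geq_pad st) nth_cat.
case: ltnP => si //; rewrite nth_nseq; case: ifP => _; rewrite nth_default //.
Qed.

(** The iterated Pieri rule divided by the nonzero [alternant delta]; the list records
    multiplicities. *)
Lemma ebasis_schur_top (nu : intpart n) :
  exists L : seq (intpart n), ebasis K nu n = \sum_(la <- L) schur K la n.
Proof.
have [L [wf e]] := pieri_chain (parts nu).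
suff [L' e'] : exists L' : seq (intpart n),
    \sum_(f <- L) alternant (fun i => f i + delta i)%N
      = alternant delta * \sum_(la <- L') schur K la n.
  exists L'; apply: (mulfI alternant_delta_neq0); rewrite -e' -e.
  by congr (_ * _); apply: eq_bigr.
rewrite sumn_parts in wf; elim: L wf {e} => [|f L IH] wf.
  by exists [::]; rewrite !big_nil mulr0.
have [|L' e'] := IH; first by move=> g gL; apply: wf; rewrite inE gL orbT.
have [df sf] := wf f (mem_head _ _); have [la laE] := decr_part df sf.
exists (la :: L'); rewrite !big_cons mulrDr e' -alternant_schur; congr (_ + _).
by congr (\det _); apply/matrixP => i j; rewrite !mxE laE.
Qed.

End Alternants.

(** * From n variables to any number of variables *)

Section Transfer.
Variables (K : fieldType) (kap : {rmorphism rat -> K}) (n : nat).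

Definition p_expandable (F : symfamily K) :=
  exists c : intpart n -> K, forall N, F N = lincomb c (@pbasis K n) N.

(** The power sum coefficients are determined in n variables and serve for every N. *)
Lemma p_expandable_eq F G : p_expandable F -> p_expandable G -> F n = G n ->
  forall N, F N = G N.
Proof.
move=> [c cF] [d dG] e N; rewrite cF dG.
have cd : c =1 d by apply: (pbasis_free kap); rewrite -cF -dG.
by apply: eq_bigr => la _; rewrite cd.
Qed.

Lemma lincomb_trans (d : intpart n -> K) (B B' : intpart n -> symfamily K)
    (c : intpart n -> intpart n -> K) N :
  (forall la, B la N = lincomb (c la) B' N) ->
  lincomb d B N = lincomb (fun mu => \sum_la d la * c la mu) B' N.
Proof.
move=> e; rewrite /lincomb; under eq_bigr => la _ do rewrite e /lincomb scaler_sumr.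
rewrite exchange_big; apply: eq_bigr => mu _; rewrite scaler_suml.
by apply: eq_bigr => la _; rewrite scalerA.
Qed.

Lemma p_expandable_lincomb (d : intpart n -> K) (B : intpart n -> symfamily K) :
  (forall la, p_expandable (B la)) -> p_expandable (lincomb d B).
Proof.
move=> /fin_all_exists[c cB]; exists (fun mu => \sum_la d la * c la mu) => N.
by apply: lincomb_trans => la; apply: cB.
Qed.

Lemma p_expandable_h la : p_expandable (hbasis K (n := n) la).
Proof. by exists (fun rho => kap (chi la rho)) => N; apply: hbasisE. Qed.

Lemma p_expandable_e la : p_expandable (ebasis K (n := n) la).
Proof. by exists (fun rho => kap (chi la rho) * parts_sign K rho) => N; apply: ebasisE. Qed.

Lemma p_expandable_ext F G : (forall N, F N = G N) -> p_expandable F -> p_expandable G.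
Proof. by move=> e [c cF]; exists c => N; rewrite -e. Qed.

Lemma p_expandable_schur la : p_expandable (schur K (n := n) la).
Proof.
have [d [_ e]] := schur_hbasis kap la.
apply: (@p_expandable_ext (lincomb d (@hbasis K n))) => [N|]; first by rewrite e.
exact/p_expandable_lincomb/p_expandable_h.
Qed.

Lemma ebasis_schur (nu : intpart n) :
  exists c : intpart n -> nat, forall N,
    ebasis K nu N = lincomb (fun la => (c la)%:R) (@schur K n) N.
Proof.
have [L eL] := ebasis_schur_top kap nu.
exists (fun la => count_mem la L); apply: p_expandable_eq.
- exact: p_expandable_e.
- by apply: p_expandable_lincomb => la; apply: p_expandable_schur.
rewrite eL /lincomb; elim: L {eL} => [|la L IH].
  by rewrite big_nil big1 // => la _; rewrite scale0r.
rewrite big_cons IH [RHS](eq_bigr (fun mu => (la == mu)%:R *: schur K mu n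
    + (count_mem mu L)%:R *: schur K mu n)); last first.
  by move=> mu _; rewrite /= natrD scalerDl.
rewrite big_split /= [X in _ = X + _](bigD1 la) //= eqxx scale1r.
rewrite [X in _ = _ + X + _]big1 ?addr0 //.
by move=> mu ne; rewrite eq_sym (negPf ne) scale0r.
Qed.

End Transfer.

(** * Specialization at q = 1 *)

(* An abstract form of the specialization at q = 1: [reg c v] means that c has
   no pole and that its value is v. *)
Record specialization (K L : fieldType) (reg : K -> L -> Prop)
    (kapK : {rmorphism rat -> K}) (kapL : {rmorphism rat -> L})
    (q t : K) (t1 : L) : Prop := Specialization {
  reg_unique : forall c v w, reg c v -> reg c w -> v = w;
  reg1 : reg 1 1;
  reg_add : forall c d v w, reg c v -> reg d w -> reg (c + d) (v + w);
  reg_opp : forall c v, reg c v -> reg (- c) (- v);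
  reg_mul : forall c d v w, reg c v -> reg d w -> reg (c * d) (v * w);
  reg_inv : forall c v, reg c v -> v != 0 -> reg c^-1 v^-1;
  reg_rat : forall a, reg (kapK a) (kapL a);
  reg_q : reg q 1;
  reg_t : reg t t1;
  q_neq1 : 1 - q != 0;
  t1_pow_neq1 : forall k, 1 - t1 ^+ k.+1 != 0;
  reg_primitive : forall (I : finType) (x : I -> K) i0, x i0 != 0 ->
    exists s : K, exists y : I -> L,
      [/\ s != 0, forall i, reg (s * x i) (y i) & exists i, y i != 0]
}.

Section Specialization.
Variables (K L : fieldType) (reg : K -> L -> Prop).
Variables (kapK : {rmorphism rat -> K}) (kapL : {rmorphism rat -> L}).
Variables (q t : K) (t1 : L).
Hypothesis sp : specialization reg kapK kapL q t t1.

Lemma reg0 : reg 0 0.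
Proof.
rewrite -(subrr 1) -[X in reg _ X](subrr 1).
by apply: (reg_add sp); [| apply: (reg_opp sp)]; apply: (reg1 sp).
Qed.

Lemma reg_sum (I : Type) (r : seq I) (P : pred I) (c : I -> K) (v : I -> L) :
  (forall i, P i -> reg (c i) (v i)) ->
  reg (\sum_(i <- r | P i) c i) (\sum_(i <- r | P i) v i).
Proof. by move=> h; apply: big_rec2 => [|i ? ? /h]; [exact: reg0 | exact: (reg_add sp)]. Qed.

Lemma reg_prod (I : Type) (r : seq I) (P : pred I) (c : I -> K) (v : I -> L) :
  (forall i, P i -> reg (c i) (v i)) ->
  reg (\prod_(i <- r | P i) c i) (\prod_(i <- r | P i) v i).
Proof.
by move=> h; apply: big_rec2 => [|i ? ? /h]; [exact: (reg1 sp) | exact: (reg_mul sp)].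
Qed.

Lemma reg_exp c v k : reg c v -> reg (c ^+ k) (v ^+ k).
Proof.
by move=> h; elim: k => [|k IH]; rewrite ?expr0 ?exprS; [exact: (reg1 sp) | exact: (reg_mul sp)].
Qed.

Lemma reg_nat k : reg k%:R k%:R.
Proof.
elim: k => [|k IH]; rewrite ?mulrS; first exact: reg0.
exact: (reg_add sp) (reg1 sp) IH.
Qed.

Lemma reg_det m (C : 'M[K]_m) (Cb : 'M[L]_m) :
  (forall i j, reg (C i j) (Cb i j)) -> reg (\det C) (\det Cb).
Proof.
move=> r; apply: reg_sum => s _; apply: (reg_mul sp); last by apply: reg_prod.
exact/reg_exp/(reg_opp sp)/(reg1 sp).
Qed.

Lemma reg_adj m (C : 'M[K]_m) (Cb : 'M[L]_m) :
  (forall i j, reg (C i j) (Cb i j)) ->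
  forall i j, reg ((\adj C) i j) ((\adj Cb) i j).
Proof.
move=> r i j; rewrite !mxE; apply: (reg_mul sp); first exact/reg_exp/(reg_opp sp)/(reg1 sp).
by apply: reg_det => k l; rewrite !mxE.
Qed.

(* Cramer's rule in the local ring of q = 1. *)
Lemma reg_solve (I : finType) (C : I -> I -> K) (Cb : I -> I -> L)
    (f : I -> K) (w : I -> L) :
  (forall i j, reg (C i j) (Cb i j)) ->
  (forall j, reg (f j) (\sum_i w i * Cb i j)) ->
  (forall v : I -> L, (forall j, \sum_i v i * Cb i j = 0) -> forall i, v i = 0) ->
  exists a : I -> K, (forall j, f j = \sum_i a i * C i j) /\
    forall i, reg (a i) (w i).
Proof.
move=> rC rf free.
pose M : 'M[K]_#|I| := \matrix_(k, l) C (enum_val k) (enum_val l).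
pose Mb : 'M[L]_#|I| := \matrix_(k, l) Cb (enum_val k) (enum_val l).
have sumE (R : nmodType) (F : I -> R) : \sum_i F i = \sum_(k < #|I|) F (enum_val k).
  by rewrite (reindex (@enum_val I I)) //=; apply/onW_bij/enum_val_bij.
have rM i j : reg (M i j) (Mb i j) by rewrite !mxE.
have uMb : Mb \in unitmx.
  rewrite -row_free_unit; apply/inj_row_free => v vM.
  have v0 : forall i : I, v 0 (enum_rank i) = 0.
    apply: free => j; have /matrixP/(_ 0 (enum_rank j)) := vM; rewrite !mxE => e.
    rewrite sumE -[RHS]e; apply: eq_bigr => k _.
    by rewrite mxE enum_valK enum_rankK.
  by apply/rowP => k; rewrite mxE -(enum_valK k) v0.
have dMb : \det Mb != 0 by rewrite unitmxE unitfE in uMb.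
have dM : \det M != 0.
  apply: contraNneq dMb => e; have := reg_det rM.
  by rewrite e => /(reg_unique sp reg0) <-.
have uM : M \in unitmx by rewrite unitmxE unitfE.
pose fr : 'rV[K]_#|I| := \row_l f (enum_val l).
pose wr : 'rV[L]_#|I| := \row_l w (enum_val l).
exists (fun i => (fr *m invmx M) 0 (enum_rank i)); split=> [j|i].
  have /matrixP/(_ 0 (enum_rank j)) := mulmxKV uM fr; rewrite !mxE enum_rankK => <-.
  by rewrite sumE; apply: eq_bigr => k _; rewrite enum_valK !mxE enum_rankK.
have wE : wr *m Mb *m invmx Mb = wr by rewrite mulmxK.
have -> : w i = (wr *m Mb *m invmx Mb) 0 (enum_rank i) by rewrite wE mxE enum_rankK.
rewrite [(_ *m _) 0 _]mxE [X in reg _ X]mxE; apply: reg_sum => k _.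
apply: (reg_mul sp).
  rewrite !mxE; have := rf (enum_val k); rewrite sumE.
  by rewrite (eq_bigr (fun l => wr 0 l * Mb l k)) // => l _; rewrite !mxE.
rewrite /invmx uM uMb mxE [X in reg _ X]mxE; apply: (reg_mul sp); last exact: reg_adj.
exact: (reg_inv sp) (reg_det rM) dMb.
Qed.

(** The substitution X -> X/(1-t) multiplies p_rho by this factor. *)
Definition tau n (rho : intpart n) : L := \prod_(k <- parts rho) (1 - t1 ^+ k)^-1.

Lemma tau_inv n (rho : intpart n) :
  tau rho * \prod_(k <- parts rho) (1 - t1 ^+ k) = 1.
Proof.
rewrite /tau -big_split big_seq big1 // => k kr /=.
have := allP (parts_pos rho) _ kr; case: k {kr} => // k _.
exact/mulVf/(t1_pow_neq1 sp).
Qed.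

Local Notation x := (fun i => (1 - t1 ^+ i)^-1).

(** This is h_k[1/(1-t)], the value of h_k[X/(1-t)] at the single variable x_1 = 1. *)
Definition gspec k : L := lev (A := L^o) (lrat kapL (hl k)) x.

(** From 1/(1 - t^i) = 1 + t^i/(1 - t^i), the generating series satisfies G(z) = G(tz) / (1 - z). *)
Lemma gspec_rec k : gspec k.+1 * (1 - t1 ^+ k.+1) = gspec k.
Proof.
have e : isexp (A := L^o) x gspec by apply: isexp_hl.
have e1 : isexp (A := L^o) x (conv (fun i => 1 ^+ i) (fun k => t1 ^+ k * gspec k)).
  apply: isexp_ext (isexp_conv (isexp_powers 1) (isexp_scale t1 e)) => [i|//].
  rewrite expr1n; have nz := t1_pow_neq1 sp i.
  by apply: (mulIf nz); rewrite mulrDl mul1r -mulrA mulVf // mulr1 subrK.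
have E j : gspec j = conv (fun i => 1 ^+ i) (fun k => t1 ^+ k * gspec k) j.
  have tf (u : L^o) l : u *+ l.+1 = 0 -> u = 0 by apply: (alg_torsion_free kapL).
  exact: (isexp_unique tf e e1).
rewrite mulrBr mulr1 {1}E /conv big_ord_recl expr1n mul1r subn0 mulrC.
rewrite [X in X - _]addrC addrK E /conv; apply: eq_bigr => i _.
by rewrite !expr1n subSS.
Qed.

Lemma gspec_neq0 k : gspec k != 0.
Proof.
elim: k => [|k IH].
  by have [-> _] : isexp (A := L^o) x gspec by [apply: isexp_hl]; apply: oner_neq0.
by apply: contraNneq IH => e; rewrite -gspec_rec e mul0r.
Qed.

End Specialization.

(** * Macdonald polynomials at q = 1 *)

Lemma dominated_anti n (la mu : intpart n) :
  dominated (parts la) (parts mu) -> dominated (parts mu) (parts la) -> la = mu.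
Proof.
move=> lm ml; apply/parts_inj.
have tk k : sumn (take k (parts la)) = sumn (take k (parts mu)).
  by apply/eqP; rewrite eqn_leq lm ml.
have nt i : nth 0%N (parts la) i = nth 0%N (parts mu) i.
  by have := tk i.+1; rewrite !sumn_take_nth !big_ord_recr /= -!sumn_take_nth tk => /addnI.
have sz (nu ka : intpart n) : (forall i, nth 0%N (parts nu) i = nth 0%N (parts ka) i) ->
    (size (parts nu) <= size (parts ka))%N.
  move=> e; rewrite leqNgt; apply/negP => lt.
  have /(all_nthP 0%N) /(_ _ lt) := parts_pos nu.
  by rewrite e nth_default.
by apply: (@eq_from_nth _ 0%N) => [|i _]; rewrite ?nt //; apply/eqP; rewrite eqn_leq !sz.
Qed.

(* Each factor e_k is multilinear, so it puts at most min(k, j) of the exponent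
   of a monomial on the first j variables. *)
Lemma mesym_support (K : fieldType) N s (m : 'X_{1..N}) j :
  (\prod_(k <- s) mesym N K k)@_m != 0 ->
  (\sum_(i < N | i < j) m i <= minsum j s)%N.
Proof.
elim: s m => [|k s IH] m.
  rewrite big_nil mcoeff1; case: (m =P 0%MM) => [-> _|_]; last by rewrite eqxx.
  by rewrite big1 // => i _; rewrite mnm0E.
rewrite big_cons -mcoeff_msupp => /msuppM_le /allpairsP[[m1 m2] /= [m1s m2s ->]].
rewrite /minsum big_cons -/(minsum j s).
have le2 : (\sum_(i < N | i < j) m2 i <= minsum j s)%N by apply: IH; rewrite -mcoeff_msupp.
have le1 : (\sum_(i < N | i < j) m1 i <= minn k j)%N.
  move: m1s; rewrite msupp_mesymP => /existsP[h /andP[/eqP <- /eqP ->]].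
  under eq_bigr => i _ do rewrite mnmE.
  rewrite leq_min; apply/andP; split.
    rewrite -sum1_card [X in (_ <= X)%N]big_mkcond [X in (X <= _)%N]big_mkcond /=.
    by apply: leq_sum => i _; case: ifP; case: (i \in h).
  have : (\sum_(i < N) (i < j) = minn j N)%N by exact: sum_ord_lt.
  move=> e; apply: leq_trans (geq_minl j N); rewrite -e [X in (X <= _)%N]big_mkcond.
  by apply: leq_sum => i _; case: ifP; case: (i \in h).
under eq_bigr => i _ do rewrite mnmDE.
by rewrite big_split leq_add.
Qed.

(** e_ka involves x^nu only if nu is dominated by ka', and ka' is dominated by mu' because mu is
    dominated by ka. *)
Lemma ebasis_coef0 (K : fieldType) n (mu ka nu : intpart n) :
  dominated (parts mu) (parts ka) ->
  ~ dominated (parts nu) (parts (conj_part mu)) ->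
  (ebasis K ka n)@_(part_mnm n nu) = 0.
Proof.
move=> mk nd; apply/eqP/negPn/negP => ne; apply: nd => j.
rewrite parts_conj sumn_take_conj ?parts_sorted //.
apply: leq_trans (dominated_minsum j (parts_sorted mu) _ mk); last by rewrite !sumn_parts.
rewrite (@sumn_take_ord n) ?size_parts //.
apply: leq_trans (mesym_support j ne); apply: eq_leq.
by apply: eq_bigr => i _; rewrite mnmE.
Qed.

Section Plethysm.
Variables (K : fieldType) (kap : {rmorphism rat -> K}) (n : nat).

(** By Jacobi-Trudi a Schur function only involves h's at or above it in dominance order, so the
    span condition passes to the basis h; the relations then compare power sum coefficients. *)
Lemma pleth_schur_span (a : nat -> K) (X : seq nat) (F G : symfamily K)
    (c : intpart n -> K) :
  (forall N, F N = lincomb c (@pbasis K n) N) ->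
  scale_power_sums n a F G ->
  in_schur_span (fun la : intpart n => dominated X (parts la)) G ->
  exists d : intpart n -> K,
    (forall ka, d ka != 0 -> dominated X (parts ka)) /\
    (forall rho, c rho * \prod_(k <- parts rho) a k = \sum_ka d ka * kap (chi ka rho)).
Proof.
move=> Fc [c' [Fc' Gc']] [b [bX Gb]].
have cc : c =1 c' by apply: (pbasis_free kap); rewrite -Fc -Fc'.
have /fin_all_exists[u uE] := fun la : intpart n => schur_hbasis kap la.
exists (fun ka => \sum_la b la * u la ka); split=> [ka|].
  move=> ne; have [la] : exists la, b la * u la ka != 0.
    apply/existsP; apply: contraR ne; rewrite negb_exists => /forallP no.
    by rewrite big1 // => la _; apply/eqP/negPn/no.
  rewrite mulf_eq0 negb_or => /andP[/bX Xla /(uE la).1 lk].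
  exact: dominated_trans lk.
move=> rho; rewrite cc; move: rho; apply: (pbasis_free kap).
rewrite -Gc' Gb (lincomb_trans b (B' := @hbasis K n) (c := u)); last first.
  by move=> la; apply: (uE la).2.
by apply: lincomb_trans => ka; apply: hbasisE.
Qed.

End Plethysm.

Section MacdonaldReduction.
Variables (K L : fieldType) (reg : K -> L -> Prop).
Variables (kapK : {rmorphism rat -> K}) (kapL : {rmorphism rat -> L}).
Variables (q t : K) (t1 : L).
Hypothesis sp : specialization reg kapK kapL q t t1.
Local Notation tau := (tau t1).
Local Notation gspec := (gspec kapL t1).

Section Macdonald.
Variables (n : nat) (mu : intpart n) (c d : intpart n -> K).
Local Notation mu' := (conj_part mu).
(** Here c gives the coefficients of H_mu in the p_rho, and d those of H_mu[X(1-t)] in the h_ka. The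
    sum in [c_dom] is the coefficient of x^nu in omega(H_mu[X(1-q)]). *)
Hypothesis c_dom : forall nu, ~ dominated (parts nu) (parts mu') ->
  \sum_rho c rho * (\prod_(k <- parts rho) (1 - q ^+ k)
                    * (parts_sign K rho * (pmult rho nu)%:R)) = 0.
Hypothesis d_dom : forall ka, d ka != 0 -> dominated (parts mu') (parts ka).
Hypothesis cdE : forall rho, c rho * \prod_(k <- parts rho) (1 - t ^+ k)
  = \sum_ka d ka * kapK (chi ka rho).
Hypothesis c_sum : \sum_rho c rho = 1.

Section Reduction.
Variables (s : K) (cb db : intpart n -> L).
Hypothesis s0 : s != 0.
Hypothesis c_reg : forall rho, reg (s * c rho) (cb rho).
Hypothesis d_reg : forall ka, reg (s * d ka) (db ka).

(* Dividing the relation [c_dom] by (1 - q)^(number of parts of nu), only the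
   term of nu survives at q = 1. *)
Lemma cb_dom nu : cb nu != 0 -> dominated (parts nu) (parts mu').
Proof.
move=> cbn k; rewrite leqNgt; apply/negP => ltk.
have nd : ~ dominated (parts nu) (parts mu') by move=> /(_ k); rewrite leqNgt ltk.
(* The product of the 1 - q^(rho_i), divided by the power of 1 - q. The truncated exponent is right
   whenever x^nu occurs in p_rho; otherwise [pmult rho nu] is 0. *)
pose quot (rho : intpart n) := (1 - q) ^+ (size (parts rho) - size (parts nu))
   * \prod_(k <- parts rho) \sum_(i < k) q ^+ i.
have prodE rho : (pmult rho nu)%:R * \prod_(k <- parts rho) (1 - q ^+ k)
    = (1 - q) ^+ size (parts nu) * ((pmult rho nu)%:R * quot rho).
  have [->|/pmult_neq0 le] := eqVneq (pmult rho nu) 0%N; first by rewrite !mul0r mulr0.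
  rewrite mulrCA; congr (_ * _); rewrite /quot mulrA -exprD subnKC; last first.
    by case: le => [->|/ltnW].
  rewrite (eq_bigr (fun k => (1 - q) * \sum_(i < k) q ^+ i)) => [|j _].
    by rewrite big_split /= big_const_seq count_predT -Monoid.iteropE.
  by rewrite -opprB subrX1 -mulNr opprB.
have sum0 : \sum_rho (s * c rho) * (parts_sign K rho * ((pmult rho nu)%:R * quot rho)) = 0.
  have q0 : (1 - q) ^+ size (parts nu) != 0 by rewrite expf_neq0 ?(q_neq1 sp).
  apply: (mulfI q0); rewrite mulr0; have e0 := congr1 (GRing.mul s) (c_dom nd).
  rewrite mulr0 in e0; apply: etrans e0; rewrite !mulr_sumr.
  apply: eq_bigr => rho _; transitivity (s * c rho * (parts_sign K rho *
    ((pmult rho nu)%:R * \prod_(k <- parts rho) (1 - q ^+ k)))).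
    by rewrite prodE mulrCA; congr (_ * _); rewrite mulrCA.
  rewrite -mulrA; congr (_ * (_ * _)); rewrite mulrA mulrC; congr (_ * _).
pose quot1 (rho : intpart n) : L := 0 ^+ (size (parts rho) - size (parts nu))
   * \prod_(k <- parts rho) k%:R.
have reg_quot rho : reg (quot rho) (quot1 rho).
  apply: (reg_mul sp).
    apply: (reg_exp sp); rewrite -(subrr 1); apply: (reg_add sp); first exact: (reg1 sp).
    exact/(reg_opp sp)/(reg_q sp).
  apply: (reg_prod sp) => j _; rewrite -[j in j%:R]card_ord -sumr_const.
  by apply: (reg_sum sp) => i _; rewrite -(expr1n _ i); apply/(reg_exp sp)/(reg_q sp).
have reg_sign (rho : intpart n) : reg (parts_sign K rho) (parts_sign L rho).
  by apply: (reg_prod sp) => j _; apply/(reg_exp sp)/(reg_opp sp)/(reg1 sp).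
have := reg_sum sp (index_enum (intpart n)) (P := xpredT) (fun rho _ => reg_mul sp (c_reg rho) (reg_mul sp (reg_sign rho)
  (reg_mul sp (reg_nat sp (pmult rho nu)) (reg_quot rho)))).
rewrite sum0 => /(reg_unique sp (reg0 sp))/esym/eqP.
rewrite (bigD1 nu) //= big1 ?addr0 => [|rho ne].
  rewrite /quot1 subnn expr0 mul1r !mulf_eq0 (negPf cbn) (negPf (pmult_diagR kapL nu)) /=.
  case/orP; apply/negP; rewrite /parts_sign prodf_seq_neq0.
    by apply/allP => j _; rewrite signr_eq0.
  apply/allP => j jn; apply/implyP => _.
  exact: natr_pos_neq0 kapL _ (allP (parts_pos nu) _ jn).
have [->|/pmult_neq0 [e|lt]] := eqVneq (pmult rho nu) 0%N.
- by rewrite mul0r !mulr0.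
- by rewrite e eqxx in ne.
by rewrite /quot1 -(subnSK lt) exprS !mul0r !mulr0.
Qed.

Lemma db_dom ka : db ka != 0 -> dominated (parts mu') (parts ka).
Proof.
move=> ne; apply: d_dom; apply: contraNneq ne => e.
by have := d_reg ka; rewrite e mulr0 => /(reg_unique sp (reg0 sp)) <-.
Qed.

Lemma cbdbE rho : cb rho = tau rho * \sum_ka db ka * kapL (chi ka rho).
Proof.
have e : reg (s * c rho * \prod_(k <- parts rho) (1 - t ^+ k))
                    (cb rho * \prod_(k <- parts rho) (1 - t1 ^+ k)).
  apply: (reg_mul sp) => //; apply: (reg_prod sp) => k _; apply: (reg_add sp); first exact: (reg1 sp).
  exact/(reg_opp sp)/(reg_exp sp)/(reg_t sp).
rewrite -mulrA cdE mulr_sumr in e.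
have e' : reg (\sum_ka s * (d ka * kapK (chi ka rho))) (\sum_ka db ka * kapL (chi ka rho)).
  by apply: (reg_sum sp) => ka _; rewrite mulrA; apply: (reg_mul sp) => //; apply: (reg_rat sp).
by rewrite (reg_unique sp e' e) mulrC -mulrA [_ * tau _]mulrC (tau_inv sp) mulr1.
Qed.

(** Otherwise take such a la with the fewest parts. No other h in the support contributes to p_la,
    as [mu'] has at least as many parts as la; so [cb la] is nonzero, and la is both below and above
    [mu']. *)
Lemma db_only ka : ka != mu' -> db ka = 0.
Proof.
move=> ne; apply/eqP/negPn/negP => dne.
have [la /andP[lam dla] min] := @arg_minnP _ ka
  (fun la => (la != mu') && (db la != 0)) (fun la => size (parts la)) (introT andP (conj ne dne)).
have cla : cb la != 0.
  rewrite cbdbE (bigD1 la) //= big1 ?addr0 => [|ka' kl].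
    rewrite mulf_neq0 ?mulf_neq0 ?fmorph_eq0 ?chi_diag //.
    by have := tau_inv sp la; apply: contra_eq_neq => ->; rewrite mul0r eq_sym oner_neq0.
  have [->|dk] := eqVneq (db ka') 0; first by rewrite mul0r.
  have [->|/chi_neq0 [e|lt]] := eqVneq (chi ka' la) 0; first by rewrite rmorph0 mulr0.
    by rewrite e eqxx in kl.
  have [e|km] := eqVneq ka' mu'.
    have := dominated_size _ (parts_pos la) (db_dom dla).
    by rewrite !sumn_parts leqNgt -e lt => /(_ erefl).
  by have := min ka'; rewrite km dk leqNgt lt => /(_ isT).
by case/eqP: lam; apply: dominated_anti (cb_dom cla) (db_dom dla).
Qed.

Lemma cb_value rho : cb rho = db mu' * (kapL (chi mu' rho) * tau rho).
Proof.
rewrite cbdbE (bigD1 mu') //= big1 ?addr0; first by rewrite mulrC -mulrA.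
by move=> ka ne; rewrite db_only // mul0r.
Qed.

End Reduction.

Theorem macdonald_at_q1 : exists2 g : L, g != 0 &
  forall rho, reg (c rho) (g * (kapL (chi mu' rho) * tau rho)).
Proof.
have [rho0 c0] : exists rho, c rho != 0.
  apply/existsP; apply: contraT; rewrite negb_exists => /forallP no.
  by move/eqP: c_sum; rewrite big1 => [|rho _]; [rewrite eq_sym oner_eq0 | apply/eqP/negPn/no].
(* Scaling c and d by one common factor ensures that a nonzero value in either family forces
   [db mu'] to be nonzero. *)
pose x (i : intpart n + intpart n) := match i with inl rho => c rho | inr ka => d ka end.
have [s [y [s0 yE [i yi]]]] := @reg_primitive _ _ _ _ _ _ _ _ sp _ x (inl rho0) c0.
pose cb rho := y (inl rho).
pose db ka := y (inr ka).
have c_reg rho : reg (s * c rho) (cb rho) by exact: (yE (inl rho)).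
have d_reg ka : reg (s * d ka) (db ka) by exact: (yE (inr ka)).
have cbE := cb_value c_reg d_reg.
have db0 : db mu' != 0.
  apply: contraNneq yi => e; case: i => [rho|ka].
    by rewrite -/(cb rho) cbE e mul0r.
  have [->|ne] := eqVneq ka mu'; first by rewrite -/(db _) e.
  by rewrite -/(db ka) (db_only c_reg d_reg ne).
(* Since the c_rho sum to H_mu[1] = 1, the scaled ones sum to s. Its value at q = 1 is nonzero, so
   the scaling can be divided out. *)
have s_reg : reg s (db mu' * \prod_(k <- parts mu') gspec k).
  have := reg_sum sp (index_enum (intpart n)) (P := xpredT) (fun rho _ => c_reg rho).
  rewrite -mulr_sumr c_sum mulr1 (eq_bigr _ (fun rho _ => cbE rho)) -mulr_sumr.
  suff -> : \sum_rho kapL (chi mu' rho) * tau rho = \prod_(k <- parts mu') gspec k by [].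
  exact/esym/(@chi_lev _ kapL L^o).
have g0 : \prod_(k <- parts mu') gspec k != 0.
  by rewrite prodf_seq_neq0; apply/allP => k _; apply: (gspec_neq0 sp).
exists (\prod_(k <- parts mu') gspec k)^-1; first by rewrite invr_eq0.
move=> rho; have := reg_mul sp (c_reg rho) (reg_inv sp s_reg (mulf_neq0 db0 g0)).
rewrite mulrAC mulfV // mul1r cbE invfM.
by rewrite [db _ * _ * _]mulrACA mulfV // mul1r mulrC.
Qed.

End Macdonald.

Lemma macdonald_coords n (mu : intpart n) (H G G' : symfamily K) :
  pleth_1minus n q H G ->
  in_schur_span (fun la : intpart n => dominated (parts mu) (parts la)) G ->
  pleth_1minus n t H G' ->
  in_schur_span (fun la : intpart n => dominated (conj_parts (parts mu)) (parts la)) G' ->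
  (H 1%N).@[fun _ => 1] = 1 ->
  exists2 c : intpart n -> K, forall N, H N = lincomb c (@pbasis K n) N &
  exists2 g : L, g != 0 &
    forall rho, reg (c rho) (g * (kapL (chi (conj_part mu) rho) * tau rho)).
Proof.
move=> pG GW pG' G'U H1.
have [c [Hc _]] := pG; exists c => //.
have [d' [d'W cd'E]] := pleth_schur_span kapK Hc pG GW.
have [d [dU cdE]] := pleth_schur_span kapK Hc pG' G'U.
apply: (@macdonald_at_q1 n mu c d) => [nu nd|ka /dU||].
(* Under omega the condition on X(1-q) becomes a combination of e_ka with ka above mu, in which x^nu
   does not occur. *)
- have e : \sum_ka d' ka * (ebasis K ka n)@_(part_mnm n nu) = 0.
    rewrite big1 // => ka _; have [->|/d'W dk] := eqVneq (d' ka) 0; first by rewrite mul0r.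
    by rewrite (ebasis_coef0 _ dk nd) mulr0.
  rewrite -[RHS]e; under [RHS]eq_bigr => ka _ do
    rewrite (ebasisE kapK) /lincomb raddf_sum mulr_sumr.
  rewrite exchange_big /=; apply: eq_bigr => rho _.
  rewrite mulrA cd'E mulr_suml; apply: eq_bigr => ka _.
  by rewrite mcoeffZ mcoeff_pbasis !mulrA.
- by rewrite parts_conj.
- exact: cdE.
(* Every p_rho takes the value 1 at x_1 = 1. *)
rewrite -H1 Hc /lincomb raddf_sum /=; apply: eq_bigr => rho _.
rewrite mevalZ rmorph_prod big1 ?mulr1 //= => k _.
by rewrite /power_sum big_ord1 rmorphXn /= mevalXU expr1n.
Qed.

End MacdonaldReduction.

(** * Nabla at q = 1 *)

Lemma chi_free (K : fieldType) (kap : {rmorphism rat -> K}) n (u : intpart n -> K) :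
  (forall rho, \sum_nu u nu * kap (chi nu rho) = 0) -> forall nu, u nu = 0.
Proof.
move=> e nu0; apply/eqP/negPn/negP => u0.
have [nu unu min] := @arg_minnP _ nu0 (fun nu => u nu != 0) (fun nu => size (parts nu)) u0.
have /eqP := e nu; rewrite (bigD1 nu) //= big1 ?addr0 => [|ka ne].
  by rewrite mulf_eq0 (negPf unu) fmorph_eq0 (negPf (chi_diag nu)).
have [->|uka] := eqVneq (u ka) 0; first by rewrite mul0r.
have [->|/chi_neq0 [e'|lt]] := eqVneq (chi ka nu) 0; first by rewrite rmorph0 mulr0.
  by rewrite e' eqxx in ne.
by have := min ka uka; rewrite leqNgt lt.
Qed.

Section SymfunSpace.
Variable R : comNzRingType.

Lemma kill_lastE N (p : {mpoly R[N.+1]}) :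
  kill_last p = p \mPo [tuple oapp (fun j : 'I_N => 'X_j) 0 (unlift ord_max i) | i < N.+1].
Proof. by []. Qed.

Lemma is_symfun0 : is_symfun (fun N => 0 : {mpoly R[N]}).
Proof.
split=> [N|N|]; first exact: rpred0.
  by rewrite kill_lastE comp_mpoly0.
by exists 0%N => N; rewrite msize0.
Qed.

Lemma is_symfun_lin (a : R) (F G : symfamily R) : is_symfun F -> is_symfun G ->
  is_symfun (fun N => a *: F N + G N).
Proof.
move=> [sF kF [d dF]] [sG kG [e eG]]; split=> [N|N|].
- by apply: rpredD; [apply: rpredZ; apply: sF | apply: sG].
- by rewrite kill_lastE comp_mpolyD comp_mpolyZ -!kill_lastE kF kG.
exists (maxn d e) => N; apply: leq_trans (msizeD_le _ _) _.
by rewrite geq_max !leq_max (leq_trans (msizeZ_le _ _) (dF N)) eG orbT.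
Qed.

End SymfunSpace.

Section NablaLinear.
Variables (K : fieldType) (nabla : symfamily K -> symfamily K).
Hypothesis nabla_lin : forall (a : K) (F G : symfamily K), is_symfun F -> is_symfun G ->
  forall N, nabla (fun M => a *: F M + G M) N = a *: nabla F N + nabla G N.

Lemma nabla_lincomb n (a : intpart n -> K) (H : intpart n -> symfamily K) N :
  (forall mu, is_symfun (H mu)) ->
  nabla (lincomb a H) N = \sum_mu a mu *: nabla (H mu) N.
Proof.
move=> symH; rewrite /lincomb.
suff E (r : seq (intpart n)) : is_symfun (fun M => \sum_(mu <- r) a mu *: H mu M) /\
    nabla (fun M => \sum_(mu <- r) a mu *: H mu M) N = \sum_(mu <- r) a mu *: nabla (H mu) N.
  by have [_] := E (index_enum (intpart n)).
elim: r => [|mu r [symr IH]].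
  have -> : (fun M => \sum_(mu <- [::]) a mu *: H mu M) = (fun M => 0).
    by apply: functional_extensionality_dep => M; rewrite big_nil.
  split; first exact: is_symfun0.
  (* Linearity at F = G = 0 reads nabla 0 = nabla 0 + nabla 0. *)
  have := nabla_lin 1 (is_symfun0 K) (is_symfun0 K) N.
  have -> : (fun M => 1 *: (0 : {mpoly K[M]}) + 0) = (fun M => 0).
    by apply: functional_extensionality_dep => M; rewrite scaler0 addr0.
  by rewrite scale1r -[X in X = _]addr0 => /addrI <-; rewrite big_nil.
have -> : (fun M => \sum_(mu <- mu :: r) a mu *: H mu M)
        = (fun M => a mu *: H mu M + \sum_(mu <- r) a mu *: H mu M).
  by apply: functional_extensionality_dep => M; rewrite big_cons.
split; first exact: is_symfun_lin.
by rewrite nabla_lin // big_cons IH.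
Qed.

End NablaLinear.

Section NablaAtOne.
Variables (K L : fieldType) (reg : K -> L -> Prop).
Variables (kapK : {rmorphism rat -> K}) (kapL : {rmorphism rat -> L}).
Variables (q t : K) (t1 : L).
Hypothesis sp : specialization reg kapK kapL q t t1.
Variables (n : nat) (H : intpart n -> symfamily K) (nabla : symfamily K -> symfamily K).
Hypothesis symH : forall mu, is_symfun (H mu).
Hypothesis coordsH : forall mu, exists2 c : intpart n -> K,
  forall N, H mu N = lincomb c (@pbasis K n) N &
  exists2 g : L, g != 0 &
    forall rho, reg (c rho) (g * (kapL (chi (conj_part mu) rho) * tau t1 rho)).
Hypothesis nabla_lin : forall (a : K) (F G : symfamily K), is_symfun F -> is_symfun G ->
  forall N, nabla (fun M => a *: F M + G M) N = a *: nabla F N + nabla G N.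
Hypothesis nablaH : forall mu N, nabla (H mu) N =
  (t ^+ nstat (parts mu) * q ^+ nstat (conj_parts (parts mu))) *: H mu N.

(* b expands F in the basis h_nu[X/(1-t)]; at q = 1, nabla multiplies the latter
   by t^(sum of binomial(nu_i, 2)). *)
Lemma nabla_reg (f : intpart n -> rat) (b : intpart n -> L) :
  (forall rho, kapL (f rho) = \sum_nu b nu * (kapL (chi nu rho) * tau t1 rho)) ->
  forall N m, reg (nabla (lincomb (fun rho => kapK (f rho)) (@pbasis K n)) N)@_m
    (lincomb (fun rho => \sum_nu b nu * t1 ^+ (\sum_(k <- parts nu) 'C(k, 2))
                          * (kapL (chi nu rho) * tau t1 rho)) (@pbasis L n) N)@_m.
Proof.
move=> fb N m.
have [c cH] := fin_all_exists (fun mu => let: ex_intro2 c h1 h2 := coordsH mu in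
  ex_intro (fun c => _ /\ _) c (conj h1 h2)).
have [g gH] := fin_all_exists (fun mu => let: conj _ (ex_intro2 g h1 h2) := cH mu in
  ex_intro (fun g => _ /\ _) g (conj h1 h2)).
have g0 mu := (gH mu).1; have creg mu := (gH mu).2.
(* [v mu] is the limit of the power sum coefficients of H_mu, and [w mu] the value expected at q = 1
   for the coefficient of H_mu in F. *)
pose v mu rho : L := g mu * (kapL (chi (conj_part mu) rho) * tau t1 rho).
pose w mu : L := b (conj_part mu) / g mu.
have reidx (F : intpart n -> L) : \sum_nu F nu = \sum_mu F (conj_part mu).
  by rewrite (reindex_inj (@conj_part_inj n)).
have fE rho : kapL (f rho) = \sum_mu w mu * v mu rho.
  rewrite fb reidx; apply: eq_bigr => mu _.
  by rewrite /w /v [RHS]mulrA divfK.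
have vfree (u : intpart n -> L) :
    (forall rho, \sum_mu u mu * v mu rho = 0) -> forall mu, u mu = 0.
  move=> e mu; have [K1 c1 _] := conj_part_bij n.
  have z : forall nu, u (K1 nu) * g (K1 nu) = 0.
    apply: (chi_free (kap := kapL)) => rho; rewrite reidx.
    have tau0 : tau t1 rho != 0.
      by have := tau_inv sp rho; apply: contra_eq_neq => ->; rewrite mul0r eq_sym oner_neq0.
    apply: (mulIf tau0); rewrite mul0r -[RHS](e rho) mulr_suml; apply: eq_bigr => ka _.
    by rewrite c1 /v -!mulrA.
  by have /eqP := z (conj_part mu); rewrite c1 mulf_eq0 (negPf (g0 mu)) orbF => /eqP.
(* The limits [v] being independent, F has coefficients in the H_mu that are regular at q = 1 with
   values [w]. *)
have [a [faE areg]] : exists a : intpart n -> K,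
    (forall rho, kapK (f rho) = \sum_mu a mu * c mu rho) /\ forall mu, reg (a mu) (w mu).
  apply: (reg_solve sp (Cb := v)) => // rho.
  by rewrite -fE; apply: (reg_rat sp).
(* [nabla] is an arbitrary function on families, so its argument must be replaced by an equal
   family, not just by equal polynomials for each N. *)
have FE : lincomb (fun rho => kapK (f rho)) (@pbasis K n) = lincomb a H.
  apply: functional_extensionality_dep => M.
  rewrite (lincomb_trans a (B' := @pbasis K n) (c := c)); last by move=> mu; rewrite (cH mu).1.
  by apply: eq_bigr => rho _; rewrite faE.
rewrite FE (nabla_lincomb nabla_lin) //.
have -> : \sum_mu a mu *: nabla (H mu) N
  = lincomb (fun rho => \sum_mu a mu * (t ^+ nstat (parts mu) * q ^+ nstat (conj_parts (parts mu)))
      * c mu rho) (@pbasis K n) N.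
  rewrite -(lincomb_trans (fun mu => a mu * (t ^+ nstat (parts mu) * q ^+ nstat (conj_parts (parts mu))))
    (B := H) (c := c)) => [|mu]; last by rewrite (cH mu).1.
  by apply: eq_bigr => mu _; rewrite nablaH scalerA.
rewrite !raddf_sum /=; apply: (reg_sum sp) => rho _; rewrite !mcoeffZ.
rewrite /pbasis !mcoeff_power_sums; apply: (reg_mul sp); last exact: (reg_nat sp).
rewrite reidx; apply: (reg_sum sp) => mu _.
have -> : b (conj_part mu) * t1 ^+ (\sum_(k <- parts (conj_part mu)) 'C(k, 2))
      * (kapL (chi (conj_part mu) rho) * tau t1 rho)
    = w mu * (t1 ^+ nstat (parts mu) * 1 ^+ nstat (conj_parts (parts mu))) * v mu rho.
  rewrite nstat_conj expr1n mulr1 /w /v -[in LHS](divfK (g0 mu) (b (conj_part mu))).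
  ring.
apply: (reg_mul sp); last exact: creg.
apply: (reg_mul sp); first exact: areg.
by apply: (reg_mul sp); apply: (reg_exp sp); [apply: (reg_t sp) | apply: (reg_q sp)].
Qed.

End NablaAtOne.

(** * The local ring of q = 1 in the field of rational functions *)

Lemma fraction_exists (R : idomainType) (x : {fraction R}) :
  exists a b : R, b != 0 /\ x = FracField.tofrac a / FracField.tofrac b.
Proof.
elim/quotW: x => r; exists \n_r, \d_r; have d0 := denom_ratioP r; split=> //.
have F0 : FracField.tofrac \d_r != 0 by rewrite tofrac_eq0.
apply: (canRL (mulfK F0)).
have -> : FracField.tofrac \n_r = (\pi_(FracField.type R) (Ratio \n_r 1))%qT by unlock FracField.tofrac.
have -> : FracField.tofrac \d_r = (\pi_(FracField.type R) (Ratio \d_r 1))%qT by unlock FracField.tofrac.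
rewrite -[LHS]FracField.pi_mul; apply/eqmodP.
by rewrite /= FracField.equivfE /= /FracField.mulf !numden_Ratio ?mulr1 ?oner_neq0 // mulrC.
Qed.

Section Regular.
Implicit Types (c : Qqt) (v : Qt).
Local Notation "x %:F" := (FracField.tofrac x).

Lemma q1_poly (a : {poly {poly rat}}) : coef_at_q1 a%:F a.[1]%:F.
Proof. by exists a, 1; rewrite hornerC oner_neq0 !tofrac1 !divr1. Qed.

Lemma q1_unique c v w : coef_at_q1 c v -> coef_at_q1 c w -> v = w.
Proof.
move=> [a [b [b1 -> ->]]] [a' [b' [b'1 + ->]]].
have b0 : b != 0 by apply: contraNneq b1 => ->; rewrite horner0.
have b'0 : b' != 0 by apply: contraNneq b'1 => ->; rewrite horner0.
move/eqP; rewrite eqr_div ?tofrac_eq0 // -!tofracM tofrac_eq => /eqP/(congr1 (horner^~ 1)).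
rewrite !hornerM => e; apply/eqP.
by rewrite eqr_div ?tofrac_eq0 // -!tofracM e.
Qed.

Lemma q1_add c d v w : coef_at_q1 c v -> coef_at_q1 d w -> coef_at_q1 (c + d) (v + w).
Proof.
move=> [a [b [b1 -> ->]]] [a' [b' [b'1 -> ->]]].
have b0 : b != 0 by apply: contraNneq b1 => ->; rewrite horner0.
have b'0 : b' != 0 by apply: contraNneq b'1 => ->; rewrite horner0.
exists (a * b' + a' * b), (b * b'); rewrite !hornerE mulf_neq0 //; split=> //.
  by rewrite addf_div ?tofrac_eq0 // !tofracD !tofracM.
by rewrite addf_div ?tofrac_eq0 // !tofracD !tofracM.
Qed.

Lemma q1_mul c d v w : coef_at_q1 c v -> coef_at_q1 d w -> coef_at_q1 (c * d) (v * w).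
Proof.
move=> [a [b [b1 -> ->]]] [a' [b' [b'1 -> ->]]].
exists (a * a'), (b * b'); rewrite !hornerM mulf_neq0 //.
by split=> //; rewrite mulf_div !tofracM.
Qed.

Lemma q1_inv c v : coef_at_q1 c v -> v != 0 -> coef_at_q1 c^-1 v^-1.
Proof.
move=> [a [b [b1 -> ->]]]; rewrite mulf_eq0 negb_or tofrac_eq0 => /andP[a1 _].
by exists b, a; rewrite !invf_div.
Qed.

Lemma q1_one : coef_at_q1 1 1.
Proof. by have := q1_poly 1; rewrite hornerC !tofrac1. Qed.

Lemma q1_opp c v : coef_at_q1 c v -> coef_at_q1 (- c) (- v).
Proof.
move=> h; rewrite -mulN1r -[X in coef_at_q1 _ X]mulN1r; apply: q1_mul => //.
by have := q1_poly (-1); rewrite hornerN hornerC !tofracN !tofrac1.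
Qed.

Definition kapq : {rmorphism rat -> Qqt} :=
  (@FracField.tofrac {poly {poly rat}}) \o polyC \o polyC.
Definition kapt : {rmorphism rat -> Qt} := (@FracField.tofrac {poly rat}) \o polyC.

Lemma q1_rat (a : rat) : coef_at_q1 (kapq a) (kapt a).
Proof. by have := q1_poly a%:P%:P; rewrite hornerC. Qed.

Definition tt : Qt := ('X : {poly rat})%:F.

Lemma q1_t : coef_at_q1 tvar tt.
Proof. by have := q1_poly ('X : {poly rat})%:P; rewrite hornerC. Qed.

Lemma q1_q : coef_at_q1 qvar 1.
Proof. by have := q1_poly 'X; rewrite hornerX tofrac1. Qed.

Lemma tt_pow_neq1 k : 1 - tt ^+ k.+1 != 0.
Proof.
rewrite subr_eq0 -tofracXn -tofrac1 tofrac_eq; apply/eqP => /(congr1 (fun p : {poly rat} => size p)).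
by rewrite size_poly1 size_polyXn.
Qed.

Lemma qvar_neq1 : 1 - qvar != 0.
Proof.
rewrite subr_eq0 -tofrac1 tofrac_eq; apply/eqP => /(congr1 (fun p : {poly {poly rat}} => size p)).
by rewrite size_poly1 size_polyX.
Qed.

(* Clear denominators and divide by the largest possible power of q - 1. *)
Lemma primitive_scaling (I : finType) (x : I -> Qqt) i0 : x i0 != 0 ->
  exists s : Qqt, exists y : I -> {poly {poly rat}},
    [/\ s != 0, forall i, s * x i = (y i)%:F & exists i, (y i).[1] != 0].
Proof.
move=> x0.
have [s [y [sn0 sy]]] : exists s : Qqt, exists y : I -> {poly {poly rat}},
    s != 0 /\ forall i, s * x i = (y i)%:F.
  have /fin_all_exists[a] := fun i => fraction_exists (x i).
  move/fin_all_exists => [b ab]; exists (\prod_i b i)%:F.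
  exists (fun i => a i * \prod_(j | j != i) b j); split.
    by rewrite tofrac_eq0; apply/prodf_neq0 => i _; case: (ab i).
  move=> i; have bi : (b i)%:F != 0 by rewrite tofrac_eq0; case: (ab i).
  rewrite (ab i).2 (bigD1 i) //= !tofracM [RHS]mulrC -mulrA mulrCA; congr (_ * _).
  by rewrite mulrCA mulfV ?mulr1.
have yn0 : y i0 != 0 by rewrite -tofrac_eq0 -sy; exact: mulf_neq0 sn0 x0.
(* Each division by q - 1 lowers the size of the nonzero [y i0], which bounds the number of
   divisions. *)
move: {2}(size (y i0)) (leqnn (size (y i0))) => d.
elim: d s y sn0 sy yn0 => [|d IH] s y sn0 sy yn0 sz.
  by rewrite leqn0 size_poly_eq0 (negPf yn0) in sz.
have [/existsP[i yi]|/existsPn all0] := boolP [exists i, (y i).[1] != 0].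
  by exists s, y; split=> //; exists i.
have /fin_all_exists[z zE] : forall i, exists z, y i = z * ('X - 1%:P).
  by move=> i; apply/factor_theorem; rewrite /root; apply/negPn/all0.
have X1 : ('X - 1%:P : {poly {poly rat}}) != 0 by rewrite polyXsubC_eq0.
have X1F : ('X - 1%:P : {poly {poly rat}})%:F != 0 by rewrite tofrac_eq0.
apply: (IH (s / ('X - 1%:P : {poly {poly rat}})%:F) z).
- exact: mulf_neq0 sn0 (invr_neq0 X1F).
- by move=> i; rewrite mulrAC sy zE tofracM mulfK.
- by apply: contraNneq yn0 => e; rewrite zE e mul0r.
move: sz; rewrite zE size_Mmonic ?monicXsubC ?size_XsubC ?addn2 //.
by apply: contraNneq yn0 => e; rewrite zE e mul0r.
Qed.

Lemma specialization_q1 : specialization coef_at_q1 kapq kapt qvar tvar tt.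
Proof.
split; [exact: q1_unique | exact: q1_one | exact: q1_add | exact: q1_opp
  | exact: q1_mul | exact: q1_inv | exact: q1_rat | exact: q1_q | exact: q1_t
  | exact: qvar_neq1 | exact: tt_pow_neq1 | ].
move=> I x i0 /primitive_scaling[s [y [s0 yE [i yi]]]].
exists s, (fun i => (y i).[1]%:F); split=> // [j|]; first by rewrite yE; apply: q1_poly.
by exists i; rewrite tofrac_eq0.
Qed.

End Regular.

(** * Positivity *)

Section StrongRecursion.
Variables (T : Type) (x0 : T) (F : nat -> (nat -> T) -> T).

(** Course-of-values recursion: table n is meaningful below n only, which suffices for an F whose
    value at k looks at arguments below k. *)
Fixpoint srec_table n : nat -> T :=
  if n is n'.+1 then
    fun k => if k == n' then F n' (srec_table n') else srec_table n' k
  else fun=> x0.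

Definition srec k : T := srec_table k.+1 k.

Lemma srecE k : (forall f g, (forall j, (j < k)%N -> f j = g j) -> F k f = F k g) ->
  srec k = F k srec.
Proof.
have tabE n j : (j < n)%N -> srec_table n j = srec j.
  elim: n => // n IH; rewrite ltnS leq_eqVlt /=; case: eqP => [-> _|_] /=.
    by rewrite /srec /= eqxx.
  exact: IH.
by move=> ext; rewrite {1}/srec /= eqxx; apply: ext => j /tabE.
Qed.

End StrongRecursion.

(** * Power series as coefficient sequences, and the recursion for P(z) *)

Section Convolution.
Variable A : comNzRingType.
Implicit Types a b c u v : nat -> A.

Definition tpoly M a : {poly A} := \poly_(i < M) a i.

Lemma conv_tpoly M a b k : (k < M)%N -> conv a b k = (tpoly M a * tpoly M b)`_k.
Proof.
move=> kM; rewrite coefM; apply: eq_bigr => i _; have ik := ltn_ord i.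
have iM : (i < M)%N by apply: leq_trans ik kM.
by rewrite !coef_poly iM (leq_ltn_trans (leq_subr _ _) kM).
Qed.

Lemma coefM_eq (p p' r : {poly A}) k :
  (forall i, (i <= k)%N -> p`_i = p'`_i) -> (p * r)`_k = (p' * r)`_k.
Proof.
by move=> e; rewrite !coefM; apply: eq_bigr => i _; rewrite e // -ltnS.
Qed.

Lemma eq_conv a a' b b' k : (forall i, (i <= k)%N -> a i = a' i) ->
  (forall i, (i <= k)%N -> b i = b' i) -> conv a b k = conv a' b' k.
Proof.
by move=> ea eb; apply: eq_bigr => i _; rewrite ea ?eb ?leq_subr // -ltnS.
Qed.

Lemma convA a b c : conv (conv a b) c =1 conv a (conv b c).
Proof.
move=> k; rewrite !(@conv_tpoly k.+1) //.
have e (u v : nat -> A) i : (i <= k)%N -> (tpoly k.+1 (conv u v))`_i = (tpoly k.+1 u * tpoly k.+1 v)`_i.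
  by move=> ik; rewrite coef_poly ltnS ik (@conv_tpoly k.+1).
rewrite (coefM_eq _ (e a b)) [tpoly _ a * tpoly _ (conv b c)]mulrC.
by rewrite (coefM_eq _ (e b c)) [_ * tpoly _ a]mulrC mulrA.
Qed.

Lemma convDl a a' b k : conv (fun i => a i + a' i) b k = conv a b k + conv a' b k.
Proof. by rewrite /conv -big_split; apply: eq_bigr => i _; rewrite mulrDl. Qed.

Lemma conv1 b k : conv (fun i => (i == 0%N)%:R) b k = b k.
Proof.
rewrite /conv big_ord_recl subn0 mul1r big1 ?addr0 // => i _.
by rewrite mul0r.
Qed.

Lemma conv_lead0 a b k : a 0%N = 0 -> conv a b k = \sum_(i < k) a i.+1 * b (k - i.+1)%N.
Proof. by move=> a0; rewrite /conv big_ord_recl a0 mul0r add0r. Qed.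

Lemma conv_fix_unique p y u v : p 0%N = 0 ->
  (forall k, u k = y k + conv p u k) -> (forall k, v k = y k + conv p v k) -> u =1 v.
Proof.
move=> p0 eu ev; elim/ltn_ind => k IH; rewrite eu ev; congr (_ + _).
rewrite !conv_lead0 //; apply: eq_bigr => i _; rewrite IH //.
by have := ltn_ord i; lia.
Qed.

Lemma conv_cancel u v b : b 0%N = 1 -> conv u b =1 conv v b -> u =1 v.
Proof.
move=> b0 e; elim/ltn_ind => k IH; have := e k.
rewrite /conv !big_ord_recr /= subnn b0 !mulr1.
rewrite (eq_bigr (fun i : 'I_k => v i * b (k - i)%N)) => [|i _]; last by rewrite IH.
exact: addrI.
Qed.

End Convolution.

Section Shuffle.
Variables (A : comNzRingType) (e b K : nat -> A) (t : A).

(* The coefficients of B(z) = \sum_k b_k z^k and of B(t^j z). *)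
Definition dilate j k := t ^+ (j * k) * b k.

Definition pcoef k : A := if k is k'.+1 then (-1) ^+ k' * K k else 0.

Hypothesis b0 : b 0%N = 1.
Hypothesis e0 : e 0%N = 1.
Hypothesis K0 : K 0%N = 1.
Hypothesis bK : forall k, b k = conv (fun i => (-1) ^+ i * K i) (dilate 1) k.
Hypothesis be : forall k,
  dilate 1 k = \sum_(j < k.+1) e j * t ^+ 'C(j, 2) * dilate j (k - j).

Lemma pcoef_conv k : conv pcoef (dilate 1) k = dilate 1 k - b k.
Proof.
rewrite bK /conv !big_ord_recl /= mul0r add0r K0 !mul1r subn0 opprD addrA subrr add0r.
rewrite -sumrN; apply: eq_bigr => i _.
by rewrite exprS mulN1r !mulNr opprK.
Qed.

(** The relation P(z) B(tz) = B(tz) - B(z), taken at t^j z. *)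
Lemma dilate_conv j k :
  conv (fun i => t ^+ (j * i) * pcoef i) (dilate j.+1) k = dilate j.+1 k - dilate j k.
Proof.
have -> : dilate j.+1 k - dilate j k = t ^+ (j * k) * (dilate 1 k - b k).
  by rewrite mulrBr /dilate mulrA -exprD mul1n mulSn addnC.
rewrite -pcoef_conv mulr_sumr; apply: eq_bigr => i _.
have ik : (i <= k)%N by rewrite -ltnS.
have ek : (j * k = j * i + j * (k - i))%N by rewrite -mulnDr subnKC.
by rewrite /dilate ek exprD mulSn mul1n exprD; ring.
Qed.

Variable W : nat -> nat -> A.
Hypothesis W0 : forall k, W 0 k = (k == 0%N)%:R.
Hypothesis WS : forall j k, W j.+1 k = W j k
  + \sum_(i < k) t ^+ (j.+1 * i.+1) * pcoef i.+1 * W j.+1 (k - i.+1)%N.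

(** Since B(t^j z) = (1 - P(t^j z)) B(t^(j+1) z), each new factor of [W] advances B by one power of
    t. Both sides solve one fixed-point equation, whose solution is unique as P has no constant
    term. *)
Lemma W_conv j : conv (W j) (dilate 1) =1 dilate j.+1.
Proof.
elim: j => [|j IH] k.
  by rewrite (eq_conv (a' := fun i => (i == 0%N)%:R) (b' := dilate 1)) ?conv1 // => i _.
pose p i := t ^+ (j.+1 * i) * pcoef i.
have p0 : p 0%N = 0 by rewrite /p /= mulr0.
have Wc l : W j.+1 l = W j l + conv p (W j.+1) l by rewrite WS conv_lead0.
apply: (conv_fix_unique (p := p) (y := dilate j.+1)) => // l.
  rewrite -IH -convA -convDl; apply: eq_conv => // i _; exact: Wc.
by rewrite dilate_conv addrC subrK.
Qed.

(** Multiplied by B(tz), which has constant term 1 and can be cancelled, both sides become \sum_(j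
    >= 1) e_j t^binomial(j, 2) z^j B(t^j z). *)
Lemma pcoefE k :
  pcoef k = \sum_(j < k) e j.+1 * t ^+ 'C(j.+1, 2) * W j (k - j.+1)%N.
Proof.
pose u j := e j.+1 * t ^+ 'C(j.+1, 2).
pose p' k := \sum_(j < k) u j * W j (k - j.+1)%N.
suff: pcoef =1 p' by apply.
apply: (conv_cancel (b := dilate 1)) => [|l].
  by rewrite /dilate muln0 mul1r.
rewrite pcoef_conv be big_ord_recl /= e0 expr0 !mul1r subn0.
rewrite {1}/dilate mul0n expr0 mul1r addrAC subrr add0r.
rewrite (@conv_tpoly _ l.+1) //.
have -> : (tpoly l.+1 p' * tpoly l.+1 (dilate 1))`_l
  = ((\sum_(j < l) u j *: 'X^(j.+1) * tpoly l.+1 (W j)) * tpoly l.+1 (dilate 1))`_l.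
  apply: coefM_eq => i il; rewrite coef_poly ltnS il coef_sum /p'.
  rewrite (big_ord_widen l (fun j => u j * W j (i - j.+1)%N) il) big_mkcond.
  apply: eq_bigr => j _; rewrite -scalerAl coefZ coefXnM ltnNge -ltnS.
  case: ltnP => ij /=; rewrite ?mulr0 // coef_poly.
  by have -> : (i - j.+1 < l.+1)%N by lia.
rewrite mulr_suml coef_sum; apply: eq_bigr => j _.
rewrite -!scalerAl -[in RHS]mulrA coefZ coefXnM; have jl := ltn_ord j.
rewrite ltnNge jl /=; congr (_ * _); rewrite -(@conv_tpoly _ l.+1) ?W_conv //.
by have := jl; lia.
Qed.

End Shuffle.

Lemma big_iota_ord (R : nmodType) k (f : nat -> R) :
  \sum_(i <- iota 0 k) f i = \sum_(i < k) f i.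
Proof. by rewrite -(big_mkord xpredT f) /index_iota subn0. Qed.

Lemma bin2_split j k : (j <= k)%N -> 'C(k, 2) = ('C(j, 2) + 'C(k - j, 2) + j * (k - j))%N.
Proof.
move=> /subnK <-; rewrite addnK; elim: (k - j)%N => [|m IH].
  by rewrite add0n muln0 !addn0.
by rewrite addSn binS bin1 IH binS bin1 mulnS; lia.
Qed.

(** * The images of h_k and p_k under nabla at q = 1 *)

Section Positivity.
Variables (L : fieldType) (kap : {rmorphism rat -> L}) (t : L).
Hypothesis t_pow_neq1 : forall k, 1 - t ^+ k.+1 != 0.
Variable pos : L -> Prop.
Hypothesis pos0 : pos 0.
Hypothesis pos1 : pos 1.
Hypothesis posD : forall x y, pos x -> pos y -> pos (x + y).
Hypothesis posM : forall x y, pos x -> pos y -> pos (x * y).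
Hypothesis post : pos t.

Implicit Types F G : symfamily L.

Definition fadd F G : symfamily L := fun N => F N + G N.
Definition fmul F G : symfamily L := fun N => F N * G N.
Definition fscale (a : L) F : symfamily L := fun N => a *: F N.
Definition fsum (I : Type) (r : seq I) (F : I -> symfamily L) : symfamily L :=
  fun N => \sum_(i <- r) F i N.

(* h_k[X/(1-t)] *)
Definition gfun k N : {mpoly L[N]} :=
  lev (lrat kap (hl k)) (fun i => (1 - t ^+ i)^-1 *: power_sum L i N).

Lemma isexp_gfun N : isexp (fun i => (1 - t ^+ i)^-1 *: power_sum L i N) (gfun^~ N).
Proof. exact: isexp_hl. Qed.

Lemma gfun0 N : gfun 0 N = 1.
Proof. exact: (isexp_gfun N).1. Qed.

(** G(z) = H(z) G(tz), from 1/(1 - t^i) = 1 + t^i/(1 - t^i) on power sums. *)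
Lemma gfunE_h N k :
  gfun k N = conv (fun j => complete_sym L j N) (fun j => t ^+ j *: gfun j N) k.
Proof.
have e : isexp (fun i => (1 - t ^+ i)^-1 *: power_sum L i N)
    (conv (fun j => complete_sym L j N) (fun j => t%:A ^+ j * gfun j N)).
  apply: isexp_ext (isexp_conv (isexp_complete_sym L N) (isexp_scale t%:A (isexp_gfun N))) => // i.
  rewrite exprZn expr1n -scalerAl mul1r scalerA -[X in X + _]scale1r -scalerDl.
  congr (_ *: _); apply: (mulIf (t_pow_neq1 i)).
  by rewrite mulrDl mul1r -mulrA mulVf // mulr1 subrK.
rewrite (isexpE kap k (isexp_gfun N)) -(isexpE kap k e); apply: eq_conv => // j _.
by rewrite exprZn expr1n -scalerAl mul1r.
Qed.

(** G(tz) = E(-z) G(z), from t^i/(1 - t^i) = -1 + 1/(1 - t^i) on power sums. *)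
Lemma gfunE_e N k :
  t ^+ k *: gfun k N
    = \sum_(j < k.+1) ((-1) ^+ j *: elem_sym L j N) * gfun (k - j) N.
Proof.
have e1 := isexp_scale t%:A (isexp_gfun N).
have e2 : isexp (fun i => t%:A ^+ i * ((1 - t ^+ i)^-1 *: power_sum L i N))
    (conv (fun j => (- 1) ^+ j * mesym N L j) (gfun^~ N)).
  apply: isexp_ext (isexp_conv (isexp_scale (-1) (isexp_mesym L N)) (isexp_gfun N)) => // i.
  rewrite exprZn expr1n -scalerAl mul1r scalerA mulrA -exprD /= addSn addnn -mul2n.
  rewrite exprS exprM sqrrN !expr1n mulr1 mulN1r -[X in - X]scale1r -scaleNr -scalerDl.
  congr (_ *: _); apply: (mulIf (t_pow_neq1 i)).
  by rewrite mulrDl -!mulrA mulVf // !mulr1; ring.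
have := isexpE kap k e2; rewrite -(isexpE kap k e1) exprZn expr1n -scalerAl mul1r => <-.
apply: eq_bigr => j _; congr (_ * _).
exact: sign_scale.
Qed.

Definition twist k : L := t ^+ 'C(k, 2).

(* The image of F at q = 1 under nabla is G. *)
Definition nabla1 d F G :=
  exists l : seq (L * seq nat), lwf d l /\
    forall N, F N = lev l (gfun^~ N) /\ G N = lev (ltwist twist l) (gfun^~ N).

Definition epos d G :=
  exists l : seq (L * seq nat), [/\ lwf d l, forall c, c \in l -> pos c.1
    & forall N, G N = lev l (fun k => elem_sym L k N)].

Lemma nabla1_ext d F F' G G' : (forall N, F N = F' N) -> (forall N, G N = G' N) ->
  nabla1 d F G -> nabla1 d F' G'.
Proof. by move=> eF eG [l [w e]]; exists l; split=> // N; rewrite -eF -eG. Qed.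

Lemma nabla1_add d F F' G G' : nabla1 d F G -> nabla1 d F' G' ->
  nabla1 d (fadd F F') (fadd G G').
Proof.
move=> [l [w e]] [l' [w' e']]; exists (l ++ l'); rewrite lwf_cat w w'; split=> // N.
by rewrite ltwist_cat !lev_cat /fadd (e N).1 (e N).2 (e' N).1 (e' N).2.
Qed.

Lemma nabla1_scale d a F G : nabla1 d F G -> nabla1 d (fscale a F) (fscale a G).
Proof.
move=> [l [w e]]; exists (lscale a l); rewrite lwf_scale; split=> // N.
by rewrite ltwist_scale !lev_scale /fscale (e N).1 (e N).2.
Qed.

Lemma nabla1_mul d d' F F' G G' : nabla1 d F G -> nabla1 d' F' G' ->
  nabla1 (d + d')%N (fmul F F') (fmul G G').
Proof.
move=> [l [w e]] [l' [w' e']]; exists (lmul l l'); rewrite lwf_mul //; split=> // N.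
by rewrite ltwist_mul !lev_mul /fmul (e N).1 (e N).2 (e' N).1 (e' N).2.
Qed.

Lemma nabla1_0 d : nabla1 d (fun N => 0) (fun N => 0).
Proof. by exists [::]; split=> // N; rewrite !lev_nil. Qed.

Lemma nabla1_1 : nabla1 0 (fun N => 1) (fun N => 1).
Proof.
by exists [:: (1, [::])]; split=> // N; rewrite /= !lev1 !big_nil mulr1 scale1r.
Qed.

Lemma nabla1_sum d (I : eqType) (r : seq I) (F G : I -> symfamily L) :
  (forall i, i \in r -> nabla1 d (F i) (G i)) -> nabla1 d (fsum r F) (fsum r G).
Proof.
elim: r => [|i r IH] h.
  by apply: nabla1_ext (nabla1_0 d) => N; rewrite /fsum big_nil.
apply: nabla1_ext (nabla1_add (h i (mem_head _ _)) (IH _)) => [N|N|j jr].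
- by rewrite /fsum big_cons.
- by rewrite /fsum big_cons.
by apply: h; rewrite inE jr orbT.
Qed.

Lemma epos_ext d G G' : (forall N, G N = G' N) -> epos d G -> epos d G'.
Proof. by move=> eG [l [w p e]]; exists l; split=> // N; rewrite -eG. Qed.

Lemma epos_add d G G' : epos d G -> epos d G' -> epos d (fadd G G').
Proof.
move=> [l [w p e]] [l' [w' p' e']]; exists (l ++ l'); split; first by rewrite lwf_cat w.
  by move=> c; rewrite mem_cat => /orP[/p|/p'].
by move=> N; rewrite lev_cat /fadd e e'.
Qed.

Lemma epos_scale d a G : pos a -> epos d G -> epos d (fscale a G).
Proof.
move=> pa [l [w p e]]; exists (lscale a l); split; first by rewrite lwf_scale.
  by move=> _ /mapP[c /p pc ->]; apply: posM.
by move=> N; rewrite lev_scale /fscale e.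
Qed.

Lemma epos_mul d d' G G' : epos d G -> epos d' G' -> epos (d + d')%N (fmul G G').
Proof.
move=> [l [w p e]] [l' [w' p' e']]; exists (lmul l l'); split; first exact: lwf_mul.
  by move=> _ /allpairsP[[c c'] /= [/p pc /p' pc' ->]]; apply: posM.
by move=> N; rewrite lev_mul /fmul e e'.
Qed.

Lemma epos_0 d : epos d (fun N => 0).
Proof. by exists [::]; split=> // N; rewrite lev_nil. Qed.

Lemma epos_1 : epos 0 (fun N => 1).
Proof.
exists [:: (1, [::])]; split=> // [c|N]; first by rewrite inE => /eqP ->.
by rewrite lev1 big_nil scale1r.
Qed.

Lemma epos_elem k : epos k (elem_sym L k).
Proof.
case: k => [|k]; first by apply: epos_ext epos_1 => N; rewrite /elem_sym mesym0E.
exists [:: (1, [:: k.+1])]; split=> [|c|N]; first by rewrite /= addn0 eqxx.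
  by rewrite inE => /eqP ->.
by rewrite lev1 big_seq1 scale1r.
Qed.

Lemma epos_sum d (I : eqType) (r : seq I) (G : I -> symfamily L) :
  (forall i, i \in r -> epos d (G i)) -> epos d (fsum r G).
Proof.
elim: r => [|i r IH] h.
  by apply: epos_ext (epos_0 d) => N; rewrite /fsum big_nil.
apply: epos_ext (epos_add (h i (mem_head _ _)) (IH _)) => [N|j jr].
  by rewrite /fsum big_cons.
by apply: h; rewrite inE jr orbT.
Qed.

Lemma pos_exp k : pos (t ^+ k).
Proof. by elim: k => [|k IH]; rewrite ?expr0 // exprS; apply: posM. Qed.

Lemma pos_nat k : pos k%:R.
Proof. by elim: k => // k IH; rewrite mulrS; apply: posD. Qed.

(* The expansion of h_k in the g_j, from h_k = g_k - \sum_(j < k) t^(k-j) h_j g_(k-j). *)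
Definition hg : nat -> seq (L * seq nat) := srec [::] (fun k f =>
  (if k is 0 then [:: (1, [::])] else [:: (1, [:: k])]) ++
    flatten [seq lmul (f j) [:: (- t ^+ (k - j), [:: (k - j)%N])] | j <- iota 0 k]).

Lemma hgE k : hg k = (if k is 0 then [:: (1, [::])] else [:: (1, [:: k])]) ++
    flatten [seq lmul (hg j) [:: (- t ^+ (k - j), [:: (k - j)%N])] | j <- iota 0 k].
Proof.
apply: srecE => f g fg; congr (_ ++ flatten _).
by apply/eq_in_map => j; rewrite mem_iota => /andP[_ jk]; rewrite fg.
Qed.

Lemma hg_wf k : lwf k (hg k).
Proof.
elim/ltn_ind: k => k IH; rewrite hgE lwf_cat; apply/andP; split.
  by case: k {IH} => //= k; rewrite addn0 eqxx.
apply/allP => c /flattenP[_ /mapP[j + ->]]; rewrite mem_iota add0n => /andP[_ jk].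
move=> cj; have w : lwf (k - j)%N [:: (- t ^+ (k - j), [:: (k - j)%N])].
  by rewrite /= addn0 eqxx subn_gt0 jk.
have := lwf_mul (IH j jk) w; rewrite subnKC; last exact: ltnW.
by move=> /allP; apply.
Qed.

(** A general rescaling g_k -> x_k g_k covers two cases: x = 1 identifies [hg k] with h_k, and x =
    [twist] gives the relation between B and the images K_k. *)
Lemma lev_hg (x : nat -> L) N k : x 0%N = 1 ->
  x k *: gfun k N = conv (fun j => lev (ltwist x (hg j)) (gfun^~ N))
                        (fun j => (t ^+ j * x j) *: gfun j N) k.
Proof.
move=> x0; rewrite /conv big_ord_recr /= subnn expr0 x0 mulr1 scale1r gfun0 mulr1.
rewrite [X in _ + lev (ltwist x X) _]hgE ltwist_cat lev_cat.
have -> : lev (ltwist x (if k is 0 then [:: (1, [::])] else [:: (1, [:: k])])) (gfun^~ N)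
    = x k *: gfun k N.
  by case: k => [|k]; rewrite lev1 /= !(big_nil, big_seq1) ?x0 ?gfun0 ?mul1r ?mulr1 // .
rewrite addrCA -[LHS]addr0; congr (_ + _).
have lev_flatten (f : nat -> seq (L * seq nat)) r :
    lev (ltwist x (flatten [seq f j | j <- r])) (gfun^~ N)
      = \sum_(j <- r) lev (ltwist x (f j)) (gfun^~ N).
  elim: r => [|j r IH]; first by rewrite lev_nil big_nil.
  by rewrite /= ltwist_cat lev_cat IH big_cons.
rewrite lev_flatten big_iota_ord -big_split big1 //= => j _.
rewrite ltwist_mul lev_mul /= lev1 !big_seq1 -mulrDr -scalerDl mulNr.
by rewrite subrr scale0r mulr0.
Qed.

Definition kfun k N : {mpoly L[N]} := lev (ltwist twist (hg k)) (gfun^~ N).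

Lemma ltwist1 l : ltwist (fun=> 1) l = l :> seq (L * seq nat).
Proof. by rewrite -[RHS]map_id; apply: eq_map => -[a s]; rewrite big1 ?mulr1. Qed.

Lemma hg_complete N k : lev (hg k) (gfun^~ N) = complete_sym L k N.
Proof.
pose gt j := t ^+ j *: gfun j N.
have gt0 : gt 0%N = 1 by rewrite /gt expr0 scale1r gfun0.
have e : conv (fun j => lev (hg j) (gfun^~ N)) gt =1 conv (fun j => complete_sym L j N) gt.
  move=> l; rewrite -gfunE_h -[RHS]scale1r (@lev_hg (fun=> 1)) //.
  by apply: eq_conv => i _; rewrite ?ltwist1 ?mulr1.
exact: (conv_cancel gt0 e).
Qed.

Lemma nabla1_complete k : nabla1 k (complete_sym L k) (kfun k).
Proof. by exists (hg k); split=> [|N]; [exact: hg_wf | rewrite hg_complete]. Qed.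

(* (-1)^(k-1) times the image of h_k. *)
Definition pfun k N : {mpoly L[N]} := pcoef (fun j => kfun j N) k.

(* With P(z) = \sum_k P_k z^k, W j is the coefficient sequence of
   1 / \prod_(i = 1 .. j) (1 - P(t^i z)). *)
Fixpoint W j : nat -> symfamily L :=
  if j is j'.+1 then
    srec (fun N => 0) (fun k f => fadd (W j' k) (fsum (iota 0 k) (fun i =>
      fscale (t ^+ (j * i.+1)) (fmul (pfun i.+1) (f (k - i.+1)%N)))))
  else fun k N => (k == 0%N)%:R.

Lemma WS j k : W j.+1 k = fadd (W j k) (fsum (iota 0 k) (fun i =>
  fscale (t ^+ (j.+1 * i.+1)) (fmul (pfun i.+1) (W j.+1 (k - i.+1)%N)))).
Proof.
rewrite [LHS]/=; apply: srecE => f g fg; congr (fadd _ _).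
apply: functional_extensionality_dep => N; apply: eq_big_seq => i.
by rewrite mem_iota => /andP[_ ik]; rewrite fg //; lia.
Qed.

Lemma pfunE k N : pfun k N = \sum_(j < k) elem_sym L j.+1 N * (t ^+ 'C(j.+1, 2))%:A
                              * W j (k - j.+1)%N N.
Proof.
pose b k : {mpoly L[N]} := ((-1) ^+ k * twist k) *: gfun k N.
have AX (a : L) i : a%:A ^+ i = (a ^+ i)%:A :> {mpoly L[N]}.
  by rewrite exprZn expr1n.
have dE j l : dilate b t%:A j l = (t ^+ (j * l) * ((-1) ^+ l * twist l)) *: gfun l N.
  by rewrite /dilate AX -scalerAl mul1r scalerA.
rewrite /pfun (@pcoefE _ (fun j => elem_sym L j N) b (fun j => kfun j N) t%:A _ _ _ _ _ (fun j l => W j l N)).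
- by apply: eq_bigr => j _; rewrite AX.
- by rewrite /b /twist expr0 mul1r expr0 scale1r gfun0.
- by rewrite /elem_sym mesym0E.
- by rewrite /kfun hgE /= lev1 big_nil mulr1 scale1r big_nil.
(* B(z) = K(-z) B(tz) is [lev_hg] for x = [twist], the sign (-1)^l being shared between the two
   factors. *)
- move=> l; rewrite /b -scalerA lev_hg /twist ?bin0n //; rewrite /conv scaler_sumr.
  apply: eq_bigr => i _; rewrite dE.
  have il : (i <= l)%N by rewrite -ltnS.
  rewrite sign_scale mul1n -!scalerAl -!scalerAr !scalerA; congr (_ *: _).
  have sl : (-1) ^+ l = (-1) ^+ i * (-1) ^+ (l - i) :> L by rewrite -exprD subnKC.
  by rewrite sl /twist; ring.
(* B(tz) is expanded by [gfunE_e]; the cross term j (l - j) of [bin2_split] is the dilation by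
   t^j. *)
- move=> l; rewrite dE mul1n mulrC -scalerA gfunE_e scaler_sumr.
  apply: eq_bigr => j _; rewrite dE AX -!scalerAl -!scalerAr !scalerA.
  rewrite mulr1 -scalerAl scalerA; congr (_ *: _).
  have jl : (j <= l)%N by rewrite -ltnS.
  have sl : (-1) ^+ l = (-1) ^+ j * (-1) ^+ (l - j) :> L by rewrite -exprD subnKC.
  rewrite /twist (bin2_split jl) sl !exprD.
  have s2 : (-1) ^+ j * (-1) ^+ j = 1 :> L by rewrite -exprMn mulrNN mulr1 expr1n.
  transitivity ((-1) ^+ j * (-1) ^+ j * (t ^+ (j * (l - j)) * ((-1) ^+ (l - j)
    * t ^+ 'C(l - j, 2)) * t ^+ 'C(j, 2))); first by ring.
  by rewrite s2 mul1r.
- by [].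
move=> j l; rewrite WS /fadd /fsum big_iota_ord; congr (_ + _); apply: eq_bigr => i _.
by rewrite /fscale /fmul AX -!scalerAl mul1r.
Qed.

Lemma epos_W k : (forall i, (0 < i <= k)%N -> epos i (pfun i)) ->
  forall j l, (l <= k)%N -> epos l (W j l).
Proof.
move=> eP; elim=> [|j IHj].
  move=> -[|l] _; first exact: epos_1.
  exact: epos_0.
elim/ltn_ind => l IHl lk; rewrite WS; apply: epos_add; first exact: IHj.
apply: epos_sum => i; rewrite mem_iota => /andP[_ il].
apply: epos_scale; first exact: pos_exp.
have -> : l = (i.+1 + (l - i.+1))%N by rewrite subnKC.
rewrite [X in W _ (X - _)%N](_ : _ = l); last by rewrite subnKC.
apply: epos_mul; first by apply: eP; rewrite ltnS leq0n (leq_trans il).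
by apply: IHl; lia.
Qed.

(** In the formula for P_k the factor e_(j+1) takes up at least one degree, so only P_i with i < k
    enter through [W]. *)
Lemma epos_pfun k : (0 < k)%N -> epos k (pfun k).
Proof.
elim/ltn_ind: k => k IH k0.
apply: (@epos_ext _ (fsum (iota 0 k) (fun j => fscale (t ^+ 'C(j.+1, 2))
    (fmul (elem_sym L j.+1) (W j (k - j.+1)%N))))) => [N|].
  rewrite pfunE /fsum big_iota_ord; apply: eq_bigr => j _.
  by rewrite /fscale /fmul -scalerAr mulr1 -scalerAl.
apply: epos_sum => j; rewrite mem_iota => /andP[_ jk].
apply: epos_scale; first exact: pos_exp.
have e : k = (j.+1 + (k - j.+1))%N by rewrite subnKC.
rewrite [X in epos X _]e; apply: epos_mul; first exact: epos_elem.
apply: (epos_W (k := k.-1)); last by lia.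
by move=> i /andP[i0 ik]; apply: IH => //; lia.
Qed.

Hypothesis pos_kap : forall a : rat, 0 <= a -> pos (kap a).

Definition nabla1_epos d F := exists2 G, nabla1 d F G & epos d G.

Lemma nabla1_epos_ext d F F' : (forall N, F N = F' N) ->
  nabla1_epos d F -> nabla1_epos d F'.
Proof. by move=> e [G nG eG]; exists G => //; apply: nabla1_ext nG. Qed.

Lemma nabla1_epos_add d F F' : nabla1_epos d F -> nabla1_epos d F' ->
  nabla1_epos d (fadd F F').
Proof.
by move=> [G n e] [G' n' e']; exists (fadd G G'); [apply: nabla1_add | apply: epos_add].
Qed.

Lemma nabla1_epos_mul d d' F F' : nabla1_epos d F -> nabla1_epos d' F' ->
  nabla1_epos (d + d')%N (fmul F F').
Proof.
by move=> [G n e] [G' n' e']; exists (fmul G G'); [apply: nabla1_mul | apply: epos_mul].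
Qed.

Lemma nabla1_epos_scale d a F : pos a -> nabla1_epos d F -> nabla1_epos d (fscale a F).
Proof.
by move=> pa [G n e]; exists (fscale a G); [apply: nabla1_scale | apply: epos_scale].
Qed.

Lemma nabla1_epos_sum d (I : eqType) (r : seq I) (F : I -> symfamily L) :
  (forall i, i \in r -> nabla1_epos d (F i)) -> nabla1_epos d (fsum r F).
Proof.
elim: r => [|i r IH] h.
  by exists (fsum [::] F); [apply: nabla1_sum | apply: epos_sum].
apply: nabla1_epos_ext (nabla1_epos_add (h i (mem_head _ _)) (IH _)) => [N|j jr].
  by rewrite /fsum big_cons.
by apply: h; rewrite inE jr orbT.
Qed.

Lemma nabla1_epos_prod (F : nat -> symfamily L) s :
  (forall k, (0 < k)%N -> nabla1_epos k (F k)) -> all (fun k => (0 < k)%N) s ->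
  nabla1_epos (sumn s) (fun N => \prod_(k <- s) F k N).
Proof.
move=> h; elim: s => [_|k s IH /= /andP[k0 ps]].
  exists (fun N => 1); last exact: epos_1.
  by apply: nabla1_ext nabla1_1 => N; rewrite ?big_nil.
apply: nabla1_epos_ext (nabla1_epos_mul (h k k0) (IH ps)) => N.
by rewrite /fmul big_cons.
Qed.

Definition signed (B : nat -> symfamily L) k := fscale ((-1) ^+ k.-1) (B k).

Lemma nabla1_epos_h k : (0 < k)%N -> nabla1_epos k (signed (complete_sym L) k).
Proof.
move=> k0; exists (pfun k); last exact: epos_pfun.
apply: nabla1_ext (nabla1_scale ((-1) ^+ k.-1) (nabla1_complete k)) => // N.
by case: k k0 => // k _; rewrite /fscale /pfun /= sign_scale.
Qed.

(** With the signs (-1)^(k-1) absorbed into both h_k and p_k, Newton's identity has only plus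
    signs. *)
Lemma signed_newton k N : signed (power_sum L) k.+1 N =
  k.+1%:R *: signed (complete_sym L) k.+1 N
  + \sum_(i < k) signed (power_sum L) i.+1 N * signed (complete_sym L) (k - i)%N N.
Proof.
have [h0 /(_ k.+1)] := isexp_complete_sym L N; rewrite big_ord_recr /= subnn h0 mulr1.
move=> /esym/(canRL (addKr _)) e; rewrite /signed /fscale /= e scalerDr scalerN addrC.
rewrite scalerA mulrC -scalerA scaler_nat; congr (_ + _).
rewrite scaler_sumr -sumrN; apply: eq_bigr => i _; rewrite subSS.
rewrite -scalerAl -scalerAr scalerA -scaleNr -exprD; congr (_ *: _).
have ek : k = (i + (k - i).-1).+1 by have := ltn_ord i; lia.
by rewrite [X in - (_ ^+ X)]ek exprS mulN1r opprK.
Qed.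

Lemma nabla1_epos_p k : (0 < k)%N -> nabla1_epos k (signed (power_sum L) k).
Proof.
elim/ltn_ind: k => -[//|k] IH _.
apply: (@nabla1_epos_ext _ (fadd (fscale k.+1%:R (signed (complete_sym L) k.+1))
  (fsum (iota 0 k) (fun i => fmul (signed (power_sum L) i.+1)
                               (signed (complete_sym L) (k - i)%N))))) => [N|].
  by rewrite signed_newton /fadd /fsum big_iota_ord.
apply: nabla1_epos_add.
  by apply: nabla1_epos_scale; [exact: pos_nat | exact: nabla1_epos_h].
apply: nabla1_epos_sum => i; rewrite mem_iota => /andP[_ ik].
have e : k.+1 = (i.+1 + (k - i))%N by lia.
rewrite [X in nabla1_epos X _]e; apply: nabla1_epos_mul; first by apply: IH.
by apply: nabla1_epos_h; rewrite subn_gt0.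
Qed.

Lemma parts_signE n (la : intpart n) :
  parts_sign L la = (-1) ^+ (n - size (parts la)).
Proof.
have -> : (n - size (parts la) = sumn (parts la) - size (parts la))%N by rewrite sumn_parts.
rewrite /parts_sign; have := parts_pos la.
elim: (parts la) => [|k s IH /= /andP[k0 ps]]; first by rewrite big_nil.
rewrite big_cons IH // -exprD; congr (_ ^+ _); have := size_le_sumn ps; lia.
Qed.

Lemma nabla1_epos_signed n (c : intpart n -> rat) (B : nat -> symfamily L) :
  (forall la, 0 <= c la) ->
  (forall k, (0 < k)%N -> nabla1_epos k (signed B k)) ->
  nabla1_epos n (fun N => \sum_la (kap (c la) * parts_sign L la) *:
                            \prod_(k <- parts la) B k N).
Proof.
move=> c0 hB.
apply: (@nabla1_epos_ext _ (fsum (index_enum (intpart n)) (fun la =>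
    fscale (kap (c la)) (fun N => \prod_(k <- parts la) signed B k N)))) => [N|].
  apply: eq_bigr => la _; rewrite /fscale /signed /fscale -scalerA; congr (_ *: _).
  by rewrite scaler_prod.
apply: nabla1_epos_sum => la _; apply: nabla1_epos_scale; first exact: pos_kap.
rewrite -[X in nabla1_epos X _](sumn_parts la).
exact: nabla1_epos_prod hB (parts_pos la).
Qed.

Lemma gfun_prod n (nu : intpart n) N :
  \prod_(k <- parts nu) gfun k N
    = lincomb (fun rho => kap (chi nu rho) * tau t rho) (@pbasis L n) N.
Proof.
rewrite (chi_lev kap nu (fun i => (1 - t ^+ i)^-1 *: power_sum L i N)).
by apply: eq_bigr => rho _; rewrite scaler_prod scalerA.
Qed.

(** Turns the list behind [nabla1] into coordinates in the g_nu, the form in which [nabla_reg] meets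
    the operator nabla. *)
Lemma nabla1_coords n (f : intpart n -> rat) G :
  nabla1 n (lincomb (fun rho => kap (f rho)) (@pbasis L n)) G ->
  exists b : intpart n -> L,
    (forall rho, kap (f rho) = \sum_nu b nu * (kap (chi nu rho) * tau t rho)) /\
    forall N, G N = lincomb (fun rho => \sum_nu
        b nu * t ^+ (\sum_(k <- parts nu) 'C(k, 2)) * (kap (chi nu rho) * tau t rho))
      (@pbasis L n) N.
Proof.
move=> [l [w e]]; exists (lcoef l); split=> [|N].
  apply: (pbasis_free kap); rewrite (e n).1 (lev_collect _ w).
  rewrite -(lincomb_trans (lcoef l) (B := fun nu N => \prod_(k <- parts nu) gfun k N)
    (c := fun nu rho => kap (chi nu rho) * tau t rho)) // => nu; exact: gfun_prod.
rewrite (e N).2 lev_twist (lev_collect _ w).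
rewrite -(lincomb_trans (fun nu => lcoef l nu * t ^+ (\sum_(k <- parts nu) 'C(k, 2)))
  (B := fun nu N => \prod_(k <- parts nu) gfun k N)
  (c := fun nu rho => kap (chi nu rho) * tau t rho)); last by move=> nu; exact: gfun_prod.
apply: eq_bigr => nu _; rewrite scaler_prod scalerA; congr (_ * _ *: _).
exact/esym/(big_morph (fun k => t ^+ k) (exprD t) (expr0 t)).
Qed.

Lemma epos_coords n G : epos n G ->
  exists c : intpart n -> L, (forall la, pos (c la)) /\
    forall N, G N = lincomb c (@ebasis L n) N.
Proof.
move=> [l [w p e]]; exists (lcoef l); split=> [la|N]; last by rewrite e (lev_collect _ w).
rewrite /lcoef big_seq_cond; apply: (big_ind pos) => // c /andP[/p //].
Qed.

Lemma schur_coords n (c : intpart n -> L) : (forall la, pos (c la)) ->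
  exists d : intpart n -> L, (forall la, pos (d la)) /\
    forall N, lincomb c (@ebasis L n) N = lincomb d (@schur L n) N.
Proof.
move=> pc; have /fin_all_exists[k kE] := fun nu : intpart n => ebasis_schur kap nu.
exists (fun la => \sum_nu c nu * (k nu la)%:R); split=> [la|N].
  by apply: (big_ind pos) => // nu _; apply: posM => //; apply: pos_nat.
by apply: lincomb_trans => nu; apply: kE.
Qed.

End Positivity.

(** * Polynomials in t with nonnegative coefficients, and the conclusion *)

Definition nneg_poly (x : Qt) : Prop :=
  exists2 p : {poly rat}, p \is a polyOver Num.nneg & x = FracField.tofrac p.

Lemma nneg_polyP (p : {poly rat}) :
  reflect (forall i, 0 <= p`_i) (p \is a polyOver Num.nneg).
Proof.
apply: (iffP (all_nthP 0)) => [h i|h i _]; last exact: h.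
case: (ltnP i (size p)) => ip; first exact: h.
by rewrite nth_default.
Qed.

Lemma nneg_poly0 : nneg_poly 0.
Proof. by exists 0; rewrite ?tofrac0 //; apply/nneg_polyP => i; rewrite coef0. Qed.

Lemma nneg_polyD x y : nneg_poly x -> nneg_poly y -> nneg_poly (x + y).
Proof.
move=> [p /nneg_polyP hp ->] [r /nneg_polyP hr ->]; exists (p + r); last by rewrite tofracD.
by apply/nneg_polyP => i; rewrite coefD addr_ge0.
Qed.

Lemma nneg_polyM x y : nneg_poly x -> nneg_poly y -> nneg_poly (x * y).
Proof.
move=> [p /nneg_polyP hp ->] [r /nneg_polyP hr ->]; exists (p * r); last by rewrite tofracM.
by apply/nneg_polyP => i; rewrite coefM sumr_ge0 // => j _; rewrite mulr_ge0.
Qed.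

Lemma nneg_poly_t : nneg_poly tt.
Proof. by exists 'X => //; apply/nneg_polyP => i; rewrite coefX ler0n. Qed.

Lemma nneg_poly_kap (a : rat) : 0 <= a -> nneg_poly (kapt a).
Proof.
by move=> a0; exists a%:P => //; apply/nneg_polyP => i; rewrite coefC; case: eqP.
Qed.

Lemma nneg_poly1 : nneg_poly 1.
Proof. by rewrite -(rmorph1 kapt); apply: nneg_poly_kap. Qed.

Lemma t_positive_lincomb n (c : intpart n -> Qt) (B : intpart n -> symfamily Qt)
    (G : symfamily Qt) :
  (forall la, nneg_poly (c la)) -> (forall N, G N = lincomb c B N) -> t_positive B G.
Proof.
move=> pc e; have /fin_all_exists[p pE] : forall la, exists p : {poly rat},
    p \is a polyOver Num.nneg /\ c la = FracField.tofrac p.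
  by move=> la; have [p hp cp] := pc la; exists p.
exists p; split=> [la|N]; first by case: (pE la).
by rewrite e; apply: eq_bigr => la _; case: (pE la) => _ ->.
Qed.

Section Main.
Variables (H : forall n, intpart n -> symfamily Qqt).
Hypothesis macdonaldH : forall n (mu : intpart n), is_modified_macdonald mu (H mu).
Variable nabla : symfamily Qqt -> symfamily Qqt.
Hypothesis nablaP : is_nabla H nabla.

Lemma nabla_specialization n (f : intpart n -> rat) G :
  nabla1 kapt tt n (lincomb (fun rho => kapt (f rho)) (@pbasis Qt n)) G ->
  specializes_at_q1 (nabla (extend_scalars (lincomb f (@pbasis rat n)))) G.
Proof.
move=> /nabla1_coords[b [fb Gb]] N m; rewrite Gb.
have -> : extend_scalars (lincomb f (@pbasis rat n))
    = lincomb (fun rho => kapq (f rho)) (@pbasis Qqt n).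
  apply: functional_extensionality_dep => M.
  rewrite /extend_scalars -[rat_to_Qqt]/(kapq : rat -> Qqt) /lincomb raddf_sum /=.
  apply: eq_bigr => rho _; rewrite map_mpolyZ /pbasis rmorph_prod; congr (_ *: _).
  apply: eq_bigr => k _; rewrite /power_sum rmorph_sum; apply: eq_bigr => i _.
  by rewrite rmorphXn /= map_mpolyX.
have [lin eig] := nablaP.
apply: (nabla_reg specialization_q1 (H := @H n) _ _ lin _ fb) => mu.
- by case: (macdonaldH mu).
- have [_ _ [G1 h1 h2] [G2 h3 h4] h5] := macdonaldH mu.
  exact: (macdonald_coords specialization_q1 h1 h2 h3 h4 h5).
exact: eig.
Qed.

Lemma positive_image n (F : symfamily rat) (f : intpart n -> rat) :
  (forall N, F N = lincomb f (@pbasis rat n) N) ->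
  nabla1_epos kapt tt nneg_poly n (lincomb (fun rho => kapt (f rho)) (@pbasis Qt n)) ->
  exists G : symfamily Qt, [/\ specializes_at_q1 (nabla (extend_scalars F)) G,
    e_positive n G & schur_positive n G].
Proof.
move=> Ff [G nG eG]; exists G.
have -> : F = lincomb f (@pbasis rat n) by apply: functional_extensionality_dep.
have [c [cpos cE]] := epos_coords nneg_poly0 nneg_polyD eG.
have [d [dpos dE]] := schur_coords kapt nneg_poly0 nneg_poly1 nneg_polyD nneg_polyM cpos.
split; first exact: nabla_specialization.
- exact: t_positive_lincomb cpos cE.
by apply: t_positive_lincomb dpos _ => N; rewrite cE dE.
Qed.

End Main.

Definition kap0 : {rmorphism rat -> rat} := idfun.

Theorem theorem3p5
  (H : forall n, intpart n -> symfamily Qqt)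
  (macdonaldH : forall n (mu : intpart n), is_modified_macdonald mu (H n mu))
  (nabla : symfamily Qqt -> symfamily Qqt) (nablaP : is_nabla H nabla)
  (n : nat) (F : symfamily rat)
  (symF : is_symfun F) (homF : homogeneous n F) :
  (positively_h_alternating n F ->
     exists G : symfamily Qt,
       [/\ specializes_at_q1 (nabla (extend_scalars F)) G,
           e_positive n G
         & schur_positive n G])
  /\
  (forall omegaF : symfamily rat,
     omega_rel n F omegaF -> p_positive n omegaF ->
     exists G : symfamily Qt,
       specializes_at_q1 (nabla (extend_scalars F)) G /\ e_positive n G).
Proof.
split=> [[c [c0 cF]]|oF [c [Fc oFc]] [c' [c'0 oFc']]].
  pose f rho := \sum_la c la * (-1) ^+ (n - size (parts la)) * chi la rho.
  have Ff N : F N = lincomb f (@pbasis rat n) N.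
    by rewrite cF; apply: lincomb_trans => la; apply: (hbasisE kap0).
  apply: (positive_image macdonaldH nablaP Ff).
  (* The sign (-1)^(n - number of parts) is the product of the (-1)^(k-1) over the parts k, so it
     distributes over the factors h_k. *)
  apply: (nabla1_epos_ext (F := fun N => \sum_la (kapt (c la) * parts_sign Qt la) *:
                            \prod_(k <- parts la) complete_sym Qt k N)) => [N|].
    rewrite -[LHS]/(lincomb (fun la => kapt (c la) * parts_sign Qt la) (@hbasis Qt n) N).
    rewrite (lincomb_trans _ (B' := @pbasis Qt n) (c := fun la rho => kapt (chi la rho))).
      apply: eq_bigr => rho _; congr (_ *: _); rewrite /f rmorph_sum; apply: eq_bigr => la _.
      by rewrite parts_signE 2!rmorphM rmorphXn rmorphN1.
    by move=> la; apply: hbasisE.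
  apply: (nabla1_epos_signed nneg_poly1 nneg_polyM nneg_poly_kap c0).
  exact: (nabla1_epos_h kapt tt_pow_neq1 nneg_poly1 nneg_polyM nneg_poly_t).
(* omega multiplies p_la by a sign of square 1, so F has the coefficients of omega(F) times this
   sign. The signed p_k then take the place of the signed h_k. *)
pose f rho := c' rho * parts_sign rat rho.
have cc : (fun la => c la * parts_sign rat la) =1 c'.
  by apply: (pbasis_free kap0); rewrite -oFc -oFc'.
have Ff N : F N = lincomb f (@pbasis rat n) N.
  rewrite Fc; apply: eq_bigr => la _; congr (_ *: _); rewrite /f -cc -mulrA.
  by rewrite parts_signE -exprD addnn -mul2n exprM sqrrN !expr1n mulr1.
have [|G [sG eG _]] := positive_image macdonaldH nablaP Ff; last by exists G.
apply: (nabla1_epos_ext (F := fun N => \sum_la (kapt (c' la) * parts_sign Qt la) *: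
                            \prod_(k <- parts la) power_sum Qt k N)) => [N|].
  apply: eq_bigr => la _; congr (_ *: _).
  by rewrite /f !parts_signE rmorphM rmorphXn rmorphN1.
apply: (nabla1_epos_signed nneg_poly1 nneg_polyM nneg_poly_kap c'0).
exact: (nabla1_epos_p kapt tt_pow_neq1 nneg_poly0 nneg_poly1 nneg_polyD nneg_polyM nneg_poly_t).
Qed.
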